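(* In $\mathbb Z_\sigma((Y))[[W^v]]$ we have the equality $$P_\sigma=\sum_{w\in W^v}\sigma_wH_w=\mathfrak m_\sigma\,\mathscr J_\sigma=(\Gamma\Delta^{-1})\sum_{w\in W^v}{}^w\!\Delta\,[w],$$ and $\mathfrak m_\sigma=\Gamma\Delta^{-1}\in\mathbb Z_\sigma((Y))$ is invertible and $W^v$-invariant.
   Context: $V$ is a finite-dimensional real vector space, $I$ a finite set, $(\alpha_i)_{i\in I}\subset V^*$ and $(\alpha_i^\vee)_{i\in I}\subset V$ are free families such that $(\alpha_j(\alpha_i^\vee))_{i,j\in I}$ is a generalized Cartan matrix. $r_i(v)=v-\alpha_i(v)\alpha_i^\vee$; $W^v=\langle r_i\mid i\in I\rangle\subset GL(V)$ is a Coxeter group with length $\ell$ (it also acts on $V^*$). $\Phi=\{w\alpha_i\}$ (real roots); for $\alpha=w\alpha_i$, $\alpha^\vee=w\alpha_i^\vee$. $\Phi_+=\Phi\cap\bigoplus\mathbb Z_{\ge0}\alpha_i$, $Q^\vee=\bigoplus\mathbb Z\alpha_i^\vee$, $Q^\vee_+=\bigoplus\mathbb Z_{\ge0}\alpha_i^\vee$. $Y$ is a discrete subgroup of $V$ with $Q^\vee\subset Y\subset\{v\in V\mid\alpha(v)\in\mathbb Z\ \forall\alpha\in\Phi\}$. $\mathbb Z_\sigma=\mathbb Z[\sigma_i^{\pm1},\sigma_i'^{\pm1}]_{i\in I}$, with indeterminates subject to: $\sigma_i=\sigma'_i$ if $\alpha_i(Y)=\mathbb Z$; $\sigma_i=\sigma_j=\sigma'_i=\sigma'_j$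 if $\alpha_i(\alpha_j^\vee)=\alpha_j(\alpha_i^\vee)=-1$. For $\alpha\in W^v\alpha_i$, $\sigma_\alpha=\sigma_i$, $\sigma'_\alpha=\sigma_i'$. For a reduced decomposition $w=r_{i_1}\cdots r_{i_n}$, $\sigma_w=\prod_k\sigma_{i_k}$. For $w\in W^v$, $\mathbb Z_\sigma[[Y,-wQ^\vee_+]]$ is the algebra of formal sums $\sum_{y\in Y}a_ye^y$ ($a_y\in\mathbb Z_\sigma$) with support in a finite union of sets $\mu_j-wQ^\vee_+$, $\mu_j\in Y$. $\mathbb Z_\sigma(Y)$ is the algebra of elements of the fraction field of $\mathbb Z_\sigma[Y]$ which have an expansion in $\mathbb Z_\sigma[[Y,-wQ^\vee_+]]$ for every $w\in W^v$. $\mathbb Z_\sigma((Y))$ is its completion, where a sequence is said to converge if it converges in each $\mathbb Z_\sigma[[Y,-wQ^\vee_+]]$ (coefficientwise eventually constant, supports in a common finite union of sets $\mu_j-wQ^\vee_+$); so an element of $\mathbb Z_\sigma((Y))$ is given by its family of expansions. $W^v$ acts on $\mathbb Z_\sigma(Y)$ and $\mathbb Z_\sigma((Y))$ by ${}^w(e^y)=e^{wy}$. $\mathbb Z_\sigma((Y))[[W^v]]$ is the $\mathbb Z_\sigma((Y))$-module of formal sums $\sum_{w\in W^v}a_w[w]$, $a_w\in\mathbb Z_\sigma((Y))$; finite such sums are multiplied by $[w]f=({}^wf)[w]$, $[w][w']=[ww']$. $b(t,u;z)=\frac{(t-t^{-1})+(u-u^{-1})z}{1-z^2}$, $c(t,u;z)=t-b(t,u;z)$;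 for $\alpha\in\Phi$, $b(\alpha^\vee)=b(\sigma_\alpha,\sigma'_\alpha;e^{\alpha^\vee})$, $c(\alpha^\vee)=c(\sigma_\alpha,\sigma'_\alpha;e^{\alpha^\vee})$, $c'(\alpha^\vee)=\sigma_\alpha c(\alpha^\vee)$, all in $\mathbb Z_\sigma(Y)$. $H_i=c(\alpha_i^\vee)[r_i]+b(\alpha_i^\vee)[e]\in\mathbb Z_\sigma(Y)[W^v]$ and $H_w=H_{i_1}\cdots H_{i_n}$ for a reduced decomposition $w=r_{i_1}\cdots r_{i_n}$ (independent of the decomposition). $P_\sigma=\sum_{w\in W^v}\sigma_wH_w$ is the limit in $\mathbb Z_\sigma((Y))[[W^v]]$ of $P^N_\sigma=\sum_{\ell(w)\le N}\sigma_wH_w$ as $N\to\infty$ (the coefficient of each $[v]$ converges in $\mathbb Z_\sigma((Y))$). Write $P_\sigma=\sum_{v\in W^v}C_v[v]$ and put $\Gamma=C_e$. $\Delta=\prod_{\alpha\in\Phi_+}c'(-\alpha^\vee)$, an invertible element of $\mathbb Z_\sigma((Y))$; $\mathscr J_\sigma=\sum_{w\in W^v}{}^w\Delta\,[w]\in\mathbb Z_\sigma((Y))[[W^v]]$. *)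

(* Defs.v *)
From HB Require Import structures.
From mathcomp Require Import all_boot all_order all_algebra finmap.
From mathcomp Require Import boolp classical_sets functions cardinality fsbigop.
From mathcomp Require Import reals topology normedtype.
From mathcomp Require Import vector.
Import Order.TTheory GRing.Theory Num.Theory.
Import numFieldNormedType.Exports.
Local Open Scope classical_set_scope.
Local Open Scope ring_scope.
Set Implicit Arguments.
Unset Strict Implicit.
Unset Printing Implicit Defensive.

Section Convolution.
Context {G : zmodType} {A : comNzRingType}.
Implicit Types F H K : G -> A.

Definition fsupp F : set G := [set x | F x <> 0].

(* The product of the formal sums [sum_x F x e^x] and [sum_x H x e^x]. It is
   meaningful when every coefficient is a finite sum; [\sum_(x \in _)] is 0
   by convention when infinitely many terms are nonzero. *)
Definition conv F H : G -> A := fun y => \sum_(x \in [set: G]) F x * H (y - x).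

Definition mono (a : A) (x : G) : G -> A := fun y => a *+ (y == x).

Lemma convE (S : {fset G}) F H y : fsupp F `<=` [set` S] ->
  conv F H y = \sum_(x <- S) F x * H (y - x).
Proof.
move=> FS; apply: fsbigTE => x xS.
have [->|/eqP Fx] := eqVneq (F x) 0; first by rewrite mul0r.
by move: (FS x Fx) => /= xS'; rewrite xS' in xS.
Qed.

Lemma convC F H : conv F H = conv H F.
Proof.
apply/funext => y; rewrite /conv (@reindex_fsbigT _ _ _ _ _ (fun x => y - x)).
  by apply: eq_fsbigr => x _; rewrite subKr mulrC.
by exists (fun x => y - x) => x; rewrite subKr.
Qed.

Lemma supp_fset F : finite_set (fsupp F) -> exists S : {fset G}, fsupp F `<=` [set` S].
Proof. by move=> /finite_fsetP[S ->]; exists S. Qed.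

Lemma supp_mono a x : fsupp (mono a x) `<=` [set` [fset x]%fset].
Proof.
by move=> y /=; rewrite inE; apply: contra_notT => /negbTE yx; rewrite /mono yx.
Qed.

Lemma finite_supp_mono a x : finite_set (fsupp (mono a x)).
Proof. exact: (sub_finite_set (@supp_mono a x)). Qed.

Lemma finite_suppN F : finite_set (fsupp F) -> finite_set (fsupp (fun x => - F x)).
Proof.
apply: sub_finite_set => x /= Fx F0; apply: Fx; by rewrite F0 oppr0.
Qed.

Lemma finite_suppD F H : finite_set (fsupp F) -> finite_set (fsupp H) ->
  finite_set (fsupp (fun x => F x + H x)).
Proof.
move=> fF fH; apply: (@sub_finite_set _ _ (fsupp F `|` fsupp H)); last first.
  by rewrite finite_setU.
move=> x FHx; apply: contrapT => /not_orP[/contrapT F0 /contrapT H0].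
by apply: FHx; rewrite F0 H0 addr0.
Qed.

Lemma finite_supp_conv F H : finite_set (fsupp F) -> finite_set (fsupp H) ->
  finite_set (fsupp (conv F H)).
Proof.
move=> /supp_fset[S FS] /supp_fset[T HT].
apply: (@sub_finite_set _ _ [set` [fset (x + y)%R | x in S, y in T]%fset]) => //.
move=> y; rewrite /fsupp /= (convE _ _ FS) => yn0.
apply: contrapT => yST; apply: yn0; rewrite big_seq big1 // => x xS.
have [->|/eqP Hx] := eqVneq (H (y - x)) 0; first by rewrite mulr0.
exfalso; apply: yST; apply/imfset2P; exists x => //; exists (y - x).
  exact: HT.
by rewrite addrC subrK.
Qed.

Lemma convDl F H K : finite_set (fsupp F) -> finite_set (fsupp H) ->
  conv (fun x => F x + H x) K = (fun y => conv F K y + conv H K y).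
Proof.
move=> /supp_fset[S FS] /supp_fset[T HT]; apply/funext => y.
rewrite !(convE (S := (S `|` T)%fset)).
- by rewrite -big_split; apply: eq_bigr => x _; rewrite mulrDl.
- by move=> x /HT /= xT; rewrite inE xT orbT.
- by move=> x /FS /= xT; rewrite inE xT.
- move=> x /= FHx; rewrite inE; apply: contrapT => /negP.
  rewrite negb_or => /andP[xS xT]; apply: FHx.
  have F0 : F x = 0 by apply: contrapT => /FS /=; apply/negP.
  have H0 : H x = 0 by apply: contrapT => /HT /=; apply/negP.
  by rewrite F0 H0 addr0.
Qed.

Lemma conv1 F : conv (mono 1 0) F = F.
Proof.
apply/funext => y; rewrite (convE _ _ (@supp_mono _ _)) big_seq_fset1.
by rewrite /mono eqxx mul1r subr0.
Qed.

Lemma convA F H K : finite_set (fsupp F) -> finite_set (fsupp H) ->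
  conv F (conv H K) = conv (conv F H) K.
Proof.
move=> fF fH; have [S FS] := supp_fset fF; have [T HT] := supp_fset fH.
have [U FHU] := supp_fset (finite_supp_conv fF fH).
apply/funext => y.
pose W := (U `|` [fset (x + y)%R | x in S, y in T])%fset.
have FHW : fsupp (conv F H) `<=` [set` W] by move=> x /FHU /= xU; rewrite !inE xU.
rewrite (convE _ _ FHW) (convE _ _ FS).
under [RHS]eq_bigr do rewrite (convE _ _ FS) mulr_suml.
rewrite exchange_big /=; rewrite big_seq [RHS]big_seq; apply: eq_bigr => x xS.
under [RHS]eq_bigr do rewrite -mulrA.
rewrite -mulr_sumr; congr (_ * _).
transitivity (\sum_(z \in [set: G]) H (z - x) * K (y - z)).
  rewrite /conv (@reindex_fsbigT _ _ _ _ _ (fun z => z - x)); last first.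
    by exists (fun z => z + x) => z; rewrite (addrK, subrK).
  by apply: eq_fsbigr => z _; rewrite opprB addrA subrK.
apply: fsbigTE => z zW.
have [->|/eqP Hx] := eqVneq (H (z - x)) 0; first by rewrite mul0r.
case/negP: zW; rewrite inE; apply/orP; right.
by apply/imfset2P; exists x => //; exists (z - x); [exact: HT|rewrite addrC subrK].
Qed.
End Convolution.

Section GroupAlgebra.
Variables (A : comNzRingType) (G : zmodType).

(* [galg A G] is the group algebra A[G]; [gcoef p x] is the coefficient of
   [e^x] in [p]. *)
Record galg := GAlg { gcoef :> G -> A; _ : `[< finite_set (fsupp gcoef) >] }.

HB.instance Definition _ := [isSub for gcoef].
HB.instance Definition _ := [Choice of galg by <:].
Implicit Types p q r : galg.

Lemma finite_supp p : finite_set (fsupp p).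
Proof. exact/asboolP/(valP p). Qed.

Lemma galgP p q : p =1 q -> p = q.
Proof. by move=> pq; apply/val_inj/funext. Qed.

Definition gmono (a : A) (x : G) : galg := GAlg (asboolT (finite_supp_mono a x)).

Definition gzero : galg := gmono 0 0.
Definition gopp p : galg := GAlg (asboolT (finite_suppN (finite_supp p))).
Definition gadd p q : galg :=
  GAlg (asboolT (finite_suppD (finite_supp p) (finite_supp q))).
Definition gone : galg := gmono 1 0.
Definition gmul p q : galg :=
  GAlg (asboolT (finite_supp_conv (finite_supp p) (finite_supp q))).

Fact gaddA : associative gadd.
Proof. by move=> p q r; apply: galgP => x /=; rewrite addrA. Qed.
Fact gaddC : commutative gadd.
Proof. by move=> p q; apply: galgP => x /=; rewrite addrC. Qed.
Fact gadd0 : left_id gzero gadd.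
Proof. by move=> p; apply: galgP => x /=; rewrite /mono mul0rn add0r. Qed.
Fact gaddN : left_inverse gzero gopp gadd.
Proof. by move=> p; apply: galgP => x /=; rewrite /mono mul0rn addNr. Qed.

HB.instance Definition _ := GRing.isZmodule.Build galg gaddA gaddC gadd0 gaddN.

Fact gmulA : associative gmul.
Proof.
move=> p q r; apply: galgP => x /=.
by rewrite convA //; exact: finite_supp.
Qed.
Fact gmulC : commutative gmul.
Proof. by move=> p q; apply: galgP => x /=; rewrite convC. Qed.
Fact gmul1 : left_id gone gmul.
Proof. by move=> p; apply: galgP => x /=; rewrite conv1. Qed.
Fact gmulDl : left_distributive gmul +%R.
Proof.
by move=> p q r; apply: galgP => x /=; rewrite convDl //; exact: finite_supp.
Qed.
Fact gone_neq0 : gone != 0.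
Proof.
apply/eqP => /(congr1 (fun p : galg => p 0)) /=; rewrite /mono eqxx => /eqP.
by rewrite oner_eq0.
Qed.

HB.instance Definition _ :=
  GRing.Zmodule_isComNzRing.Build galg gmulA gmulC gmul1 gmulDl gone_neq0.

Definition gunit : {pred galg} := fun p => `[< exists q, q * p = 1 >].
Definition ginv p : galg :=
  if p \in gunit then xget p [set q | q * p = 1] else p.

Fact gmulVp : {in gunit, left_inverse 1 ginv *%R}.
Proof.
move=> p up; rewrite /ginv up; case: xgetP => // no.
by case/asboolP: up => q /no.
Qed.
Fact gunitP p q : q * p = 1 -> gunit p.
Proof. by move=> qp; apply/asboolP; exists q. Qed.
Fact ginv_out : {in [predC gunit], ginv =1 id}.
Proof. by move=> p /negbTE; rewrite /ginv => ->. Qed.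

HB.instance Definition _ :=
  GRing.ComNzRing_hasMulInverse.Build galg gmulVp gunitP ginv_out.

Lemma gcoef0 x : (0 : galg) x = 0. Proof. by rewrite /= /mono mul0rn. Qed.
Lemma gcoefM p q x : (p * q) x = conv p q x. Proof. by []. Qed.
End GroupAlgebra.

Section Domain.
Variables (A : idomainType) (G : zmodType).

(* [P] is the set of positive elements of a translation-invariant total order *)
Definition group_order (P : G -> Prop) :=
  [/\ ~ P 0, forall x y, P x -> P y -> P (x + y)
    & forall x, x <> 0 -> P x \/ P (- x)].

Context (P : G -> Prop) (ordP : group_order P).

Lemma group_order_max (s : seq G) : s != [::] ->
  exists2 m, m \in s & forall x, x \in s -> x = m \/ P (m - x).
Proof.
have [_ PD Pt] := ordP; elim: s => // a [|b s] IH _.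
  by exists a; rewrite ?inE // => x; rewrite inE => /eqP; left.
have [//|m ms mx] := IH.
have [->|/eqP am] := eqVneq a m.
  exists m; first by rewrite inE eqxx.
  by move=> x; rewrite in_cons => /orP[/eqP|/mx //]; left.
case: (Pt (a - m)); first by move=> /eqP; rewrite subr_eq0 => /eqP.
- move=> Pam; exists a; first by rewrite inE eqxx.
  move=> x; rewrite in_cons => /orP[/eqP|/mx[->|Pmx]]; [by left|by right|].
  by right; rewrite -(subrK m a) -addrA; exact: PD.
- rewrite opprB => Pma; exists m; first by rewrite inE ms orbT.
  by move=> x; rewrite in_cons => /orP[/eqP ->|/mx //]; right.
Qed.

Lemma lead_galg (p : galg A G) : p != 0 ->
  exists2 m, p m != 0 & forall x, p x != 0 -> x = m \/ P (m - x).
Proof.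
move=> p0; have /finite_fsetP[S Sp] := finite_supp p.
have pS x : (p x != 0) = (x \in S).
  apply/idP/idP => [/eqP px|xS].
    by have : fsupp p x by []; rewrite Sp.
  by apply/eqP; have : fsupp p x by rewrite Sp.
have [|m mS mx] := @group_order_max S.
  apply: contra_neq p0 => S0; apply: galgP => x; rewrite gcoef0.
  apply/eqP; apply: contraT; rewrite pS => xS.
  by have : x \in enum_fset S by []; rewrite S0.
by exists m => [|x]; rewrite pS //; exact: mx.
Qed.

Lemma galg_domain (p q : galg A G) : p * q = 0 -> (p == 0) || (q == 0).
Proof.
have [P0 PD _] := ordP.
move=> pq0; apply: contraT; rewrite negb_or => /andP[/lead_galg[m pm mx]].
move=> /lead_galg[n qn nx].
have : (p * q) (m + n) != 0.
  have /finite_fsetP[S Sp] := finite_supp p.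
  have mS : m \in S by suff : fsupp p m; [rewrite Sp|exact/eqP].
  rewrite gcoefM (@convE _ _ S) ?Sp// (big_fsetD1 m) //= addrAC subrr add0r.
  rewrite big_seq big1 ?addr0 ?mulf_neq0 // => x; rewrite !inE => /andP[xm xS].
  have Pmx : P (m - x).
    have : p x != 0 by apply/eqP; have : fsupp p x by rewrite Sp.
    by move=> /mx[xm'|//]; rewrite xm' eqxx in xm.
  have [->|] := eqVneq (q (m + n - x)) 0; first by rewrite mulr0.
  rewrite addrAC => /nx[/(canRL (addrK n))|].
    by rewrite subrr => /subr0_eq xm'; rewrite xm' eqxx in xm.
  by move=> /(PD _ _ Pmx); rewrite addrA subrr.
by rewrite pq0 gcoef0 eqxx.
Qed.
End Domain.

Lemma lex_group_order (G : zmodType) (T : realDomainType) (n : nat)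
    (c : G -> 'rV[T]_n) :
  {morph c : x y / x + y} -> (forall x, c x = 0 -> x = 0) ->
  group_order (fun x => exists i : 'I_n,
    0 < c x 0 i /\ forall j : 'I_n, (j < i)%N -> c x 0 j = 0).
Proof.
move=> cD c_inj; have c0 : c 0 = 0.
  by apply: (addIr (c 0)); rewrite -cD !add0r.
have cN x : c (- x) = - c x.
  by apply: (addIr (c x)); rewrite -cD !addNr.
split.
- by case=> i []; rewrite c0 mxE ltxx.
- move=> x y [i [xi xj]] [k [yk yj]].
  have [ik|ki|ik] := ltngtP i k.
  + exists i; rewrite cD mxE (yj _ ik) addr0; split=> // j ji.
    by rewrite mxE xj // yj ?addr0 // (ltn_trans ji).
  + exists k; rewrite cD mxE (xj _ ki) add0r; split=> // j jk.
    by rewrite mxE yj // xj ?addr0 // (ltn_trans jk).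
  + exists i; rewrite cD; split=> [|j ji].
      by rewrite mxE addr_gt0 // (val_inj ik).
    by rewrite mxE xj // yj ?addr0 // -(val_inj ik).
- move=> x x0.
  have [i ci ij] : exists2 i : 'I_n, c x 0 i != 0 &
      forall j : 'I_n, (j < i)%N -> c x 0 j = 0.
    have [i0 ci0] : exists i, c x 0 i != 0.
      apply/not_existsP => cx0; apply: x0; apply: c_inj; apply/rowP => i.
      by rewrite mxE; apply/eqP; apply: contrapT => /negP /cx0.
    case: (@arg_minnP _ i0 (fun i => c x 0 i != 0) val ci0) => i ci mi.
    exists i => // j ji; apply/eqP; apply: contraTT ji => /mi.
    by rewrite -leqNgt.
  case: (ltgtP (c x 0 i) 0) ci => // ci _; [right|left]; exists i.
    rewrite cN mxE oppr_gt0; split=> // j ji.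
    by rewrite mxE ij // oppr0.
  by split.
Qed.

(* Laurent polynomials over Z in indeterminates indexed by J *)
Definition laurent (J : finType) := galg int {ffun J -> int}.

HB.instance Definition _ J := GRing.ComUnitRing.on (laurent J).

Fact laurent_domain (J : finType) (p q : laurent J) :
  p * q = 0 -> (p == 0) || (q == 0).
Proof.
apply: galg_domain; apply: (@lex_group_order _ int #|J|
  (fun f : {ffun J -> int} => \row_i f (enum_val i))).
  by move=> f g; apply/rowP => i; rewrite !mxE ffunE.
move=> f f0; apply/ffunP => j; rewrite ffunE -(enum_rankK j).
by move/rowP/(_ (enum_rank j)): f0; rewrite !mxE.
Qed.

HB.instance Definition _ J :=
  GRing.ComUnitRing_isIntegral.Build (laurent J) (@laurent_domain J).

Definition indet (J : finType) (j : J) : laurent J :=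
  gmono 1 [ffun k => (k == j)%:Z].

(* The group algebra A[V] of the additive group of a vector space V *)
Definition vgalg (A : idomainType) (R : realType) (V : vectType R) := galg A V.

HB.instance Definition _ (A : idomainType) (R : realType) (V : vectType R) :=
  GRing.ComUnitRing.on (vgalg A V).

Fact vgalg_domain (A : idomainType) (R : realType) (V : vectType R)
  (p q : vgalg A V) : p * q = 0 -> (p == 0) || (q == 0).
Proof.
apply: galg_domain; apply: (@lex_group_order V R (\dim {:V}) (passmx.rVof (vbasis {:V}))).
  by move=> x y; have := passmx.rVof_linear (vbasis {:V}) 1 x y; rewrite !scale1r.
by move=> x /eqP; rewrite (passmx.rVof_eq0 (vbasisP _)) => /eqP.
Qed.

HB.instance Definition _ (A : idomainType) (R : realType) (V : vectType R) :=
  GRing.ComUnitRing_isIntegral.Build (vgalg A V) (@vgalg_domain A R V).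


Definition gen_cartan (R : numDomainType) (I : Type) (a : I -> I -> R) :=
  [/\ forall i, a i i = 2,
      forall i j, i <> j -> exists n : nat, a i j = - n%:R
    & forall i j, a i j = 0 -> a j i = 0].

Record rootDatum (R : realType) (V : vectType R) (I : finType) := RootDatum {
  sroot : I -> 'Hom(V, R^o);
  scoroot : I -> V;
  sroot_free : free (codom sroot);
  scoroot_free : free (codom scoroot);
  sroot_cartan : gen_cartan (fun i j => sroot j (scoroot i) : R)
}.

Section WeylGroup.
Context {R : realType} {V : vectType R} {I : finType} (D : rootDatum V I).

Definition reflfun (i : I) (v : V) : V := v - (sroot D i v : R) *: scoroot D i.

Fact reflfun_linear i : linear (reflfun i).
Proof.
move=> a u v; rewrite /reflfun linearP scalerDl opprD scalerBr -scalerA.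
by rewrite !addrA; congr (_ - _); rewrite addrAC.
Qed.

HB.instance Definition _ i :=
  GRing.isLinear.Build R V V _ (reflfun i) (reflfun_linear i).

Definition refl (i : I) : 'End(V) := linfun (reflfun i).

Lemma reflE i v : refl i v = v - (sroot D i v : R) *: scoroot D i.
Proof. by rewrite lfunE. Qed.

Lemma reflK i : (refl i \o refl i)%VF = \1%VF.
Proof.
apply/lfunP => v; rewrite comp_lfunE id_lfunE !reflE.
have [Dii _ _] := sroot_cartan D.
set x : R := sroot D i v.
have -> : sroot D i (v - x *: scoroot D i) = - x.
  rewrite linearB linearZ_LR; change (x - x * (sroot D i (scoroot D i) : R) = - x).
  by rewrite Dii mulr_natr mulr2n opprD addrA subrr add0r.
by rewrite scaleNr opprK subrK.
Qed.

Definition refl_word (s : seq I) : 'End(V) :=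
  foldr (fun i f => (refl i \o f)%VF) \1%VF s.

Lemma refl_word_cat s t :
  refl_word (s ++ t) = (refl_word s \o refl_word t)%VF.
Proof.
by elim: s => [|i s IH] /=; rewrite ?comp_lfun1l // IH comp_lfunA.
Qed.

Lemma refl_word_rev s : (refl_word s \o refl_word (rev s))%VF = \1%VF.
Proof.
elim: s => [|i s IH] /=; first by rewrite comp_lfun1l.
rewrite rev_cons -cats1 refl_word_cat /= comp_lfun1r -comp_lfunA.
by rewrite (comp_lfunA (refl_word s)) IH comp_lfun1l reflK.
Qed.

(* As the reflections are involutions, the subgroup of GL(V) that they
   generate is the set of their finite products. *)
Definition in_weyl : pred 'End(V) :=
  fun f => `[< exists s, f = refl_word s >].

Record weyl := Weyl { weyl_lfun : 'End(V); _ : in_weyl weyl_lfun }.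

HB.instance Definition _ := [isSub for weyl_lfun].
HB.instance Definition _ := [Choice of weyl by <:].

Fact in_weyl1 : in_weyl \1%VF.
Proof. by apply/asboolP; exists [::]. Qed.

Fact in_weylM (u v : weyl) : in_weyl (weyl_lfun u \o weyl_lfun v)%VF.
Proof.
have /asboolP[s ->] := valP u; have /asboolP[t ->] := valP v.
by apply/asboolP; exists (s ++ t); rewrite refl_word_cat.
Qed.

Fact weyl_inv_ex (u : weyl) : exists v : weyl,
  (weyl_lfun u \o weyl_lfun v = \1 /\ weyl_lfun v \o weyl_lfun u = \1)%VF.
Proof.
have /asboolP[s us] := valP u.
have rs : in_weyl (refl_word (rev s)) by apply/asboolP; exists (rev s).
exists (Weyl rs); rewrite /= us refl_word_rev; split=> //.
by rewrite -{2}(revK s) refl_word_rev.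
Qed.

Definition weyl1 : weyl := Weyl in_weyl1.
Definition weylM (u v : weyl) : weyl := Weyl (in_weylM u v).
Definition weylV (u : weyl) : weyl := sval (cid (weyl_inv_ex u)).

Fact weylMA : associative weylM.
Proof. by move=> u v w; apply: val_inj; rewrite /= comp_lfunA. Qed.
Fact weyl1M : left_id weyl1 weylM.
Proof. by move=> u; apply: val_inj; rewrite /= comp_lfun1l. Qed.
Fact weylM1 : right_id weyl1 weylM.
Proof. by move=> u; apply: val_inj; rewrite /= comp_lfun1r. Qed.
Fact weylVM : left_inverse weyl1 weylV weylM.
Proof.
by move=> u; apply: val_inj; rewrite /weylV /=; case: cid => v [].
Qed.
Fact weylMV : right_inverse weyl1 weylV weylM.
Proof.
by move=> u; apply: val_inj; rewrite /weylV /=; case: cid => v [].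
Qed.

HB.instance Definition _ :=
  isGroup.Build weyl weylMA weyl1M weylM1 weylVM weylMV.

Fact in_weyl_refl i : in_weyl (refl i).
Proof. by apply/asboolP; exists [:: i]; rewrite /= comp_lfun1r. Qed.

Definition srefl (i : I) : weyl := Weyl (in_weyl_refl i).

Definition weyl_word (s : seq I) : weyl := (\prod_(i <- s) srefl i)%g.

Lemma weyl_wordE s : weyl_lfun (weyl_word s) = refl_word s.
Proof.
rewrite /weyl_word; elim: s => [|i s IH]; first by rewrite big_nil.
by rewrite big_cons /= IH.
Qed.

Lemma weyl_word_ex (w : weyl) : exists s, weyl_word s = w.
Proof.
have /asboolP[s ws] := valP w; exists s.
by apply: val_inj; rewrite /= weyl_wordE.
Qed.

Fact weyl_length_ex (w : weyl) :
  exists n, `[< exists2 s, size s = n & weyl_word s = w >].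
Proof.
by have [s <-] := weyl_word_ex w; exists (size s); apply/asboolP; exists s.
Qed.

Definition weyl_length (w : weyl) : nat := ex_minn (weyl_length_ex w).

Definition reduced (s : seq I) := size s = weyl_length (weyl_word s).

Definition reduced_word (w : weyl) : seq I :=
  xget [::] [set s | weyl_word s = w /\ reduced s].

Definition wact (w : weyl) (v : V) : V := weyl_lfun w v.
Definition wact_dual (w : weyl) (a : 'Hom(V, R^o)) : 'Hom(V, R^o) :=
  (a \o weyl_lfun w^-1%g)%VF.

Definition real_root : set 'Hom(V, R^o) :=
  [set a | exists w i, a = wact_dual w (sroot D i)].
Definition pos_root : set 'Hom(V, R^o) :=
  [set a | real_root a /\ exists n : I -> nat, a = \sum_i sroot D i *+ n i].

(* The value 0 outside [real_root] is irrelevant. *)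
Definition coroot (a : 'Hom(V, R^o)) : V :=
  xget 0 [set v | exists w i,
    a = wact_dual w (sroot D i) /\ v = wact w (scoroot D i)].

Definition coroot_lattice : set V :=
  [set v | exists m : I -> int, v = \sum_i scoroot D i *~ m i].
Definition coroot_cone : set V :=
  [set v | exists n : I -> nat, v = \sum_i scoroot D i *+ n i].
End WeylGroup.

(* Discreteness refers to the topology of R^dim(V), transported to V by the
   coordinates in a basis. *)
Record lattice (R : realType) (V : vectType R) (I : finType)
    (D : rootDatum V I) := Lattice {
  lat :> zmodClosed V;
  lat_discrete : let Y := passmx.rVof (vbasis {:V}) @` [set y | y \in lat] in
    Y `<=` isolated Y;
  lat_coroot : forall v, coroot_lattice D v -> v \in lat;
  lat_root : forall a v, real_root D a -> v \in lat -> (a v : R) \is a Num.int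
}.

Section Coefficients.
Context {R : realType} {V : vectType R} {I : finType} {D : rootDatum V I}.
Variable Y : lattice D.

(* [inl i] stands for sigma_i and [inr i] for sigma'_i *)
Definition sigma_index (x : I + I) : I :=
  match x with inl i => i | inr i => i end.

Definition sigma_eq : rel (I + I) := fun x y =>
  let i := sigma_index x in let j := sigma_index y in
  (i == j) && `[< [set sroot D i y | y in [set y | y \in Y]]
                   = range (fun m : int => m%:~R : R) >]
  || (sroot D i (scoroot D j) == -1) && (sroot D j (scoroot D i) == -1).

Fact sigma_eq_sym : symmetric sigma_eq.
Proof.
move=> x y; rewrite /sigma_eq [X in _ || X]andbC eq_sym.
by case: eqVneq => [->|].
Qed.

(* The classes for the equivalence relation generated by [sigma_eq] *)
Definition sigma_class : finType := {x : I + I | roots sigma_eq x}.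

Definition sigma_classof (x : I + I) : sigma_class :=
  exist _ (fingraph.root sigma_eq x)
    (roots_root (sym_connect_sym sigma_eq_sym) x).

Definition Zsigma := laurent sigma_class.

Definition sigma (i : I) : Zsigma := indet (sigma_classof (inl i)).
Definition sigma' (i : I) : Zsigma := indet (sigma_classof (inr i)).

(* The values 0 outside [real_root D] are irrelevant. *)
Definition sigma_root (a : 'Hom(V, R^o)) : Zsigma :=
  xget 0 [set s | exists (w : weyl D) i, a = wact_dual w (sroot D i) /\ s = sigma i].
Definition sigma'_root (a : 'Hom(V, R^o)) : Zsigma :=
  xget 0 [set s | exists (w : weyl D) i, a = wact_dual w (sroot D i) /\ s = sigma' i].

Definition sigma_weyl (w : weyl D) : Zsigma :=
  \prod_(i <- reduced_word w) sigma i.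
End Coefficients.

Section Series.
Context {R : realType} {V : vectType R} {I : finType} {D : rootDatum V I}.
Variable Y : lattice D.
Local Notation Z := (Zsigma Y).

(* Everything takes place in the group algebra Z_sigma[V], which is an integral
   domain, and in its fraction field: Z_sigma[Y] is the subring of the elements
   supported in Y, and Frac(Z_sigma[Y]) the subfield of the fractions p / q with
   p and q in Z_sigma[Y]. *)
Definition galgV := vgalg Z V.
Definition galgY : set galgV := [set p | fsupp p `<=` [set y | y \in Y]].

Definition fracV := {fraction galgV}.

Definition expo (v : V) : fracV := FracField.tofrac (gmono 1 v : galgV).
Definition const_frac (a : Z) : fracV := FracField.tofrac (gmono a 0 : galgV).

Fact galg_act_subproof (w : weyl D) (p : galgV) :
  `[< finite_set (fsupp (fun v => p (wact w^-1%g v))) >].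
Proof.
apply/asboolP; have := finite_image (wact w) (finite_supp p).
apply: sub_finite_set => v /= pv; exists (wact w^-1%g v) => //.
have wV : (weyl_lfun w \o weyl_lfun w^-1%g)%VF = \1%VF.
  by rewrite -[LHS]/(weyl_lfun (w * w^-1)%g) mulgV.
by rewrite /wact -comp_lfunE wV id_lfunE.
Qed.

(* The action [e^v |-> e^(w v)] *)
Definition galg_act (w : weyl D) (p : galgV) : galgV :=
  GAlg (galg_act_subproof w p).
Definition frac_act (w : weyl D) (f : fracV) : fracV :=
  FracField.tofrac (galg_act w \n_(repr f))
    / FracField.tofrac (galg_act w \d_(repr f)).

(* Formal sums over V; those that belong to Z_sigma[[Y, -w Q^vee_+]] are singled
   out by [cone_series w]. *)
Definition formal := V -> Z.

Definition supp_in (w : weyl D) (ms : seq V) (F : formal) :=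
  forall y, F y != 0 -> y \in Y /\
    exists m q, [/\ m \in ms, coroot_cone D q & y = m - wact w q].

Definition cone_series (w : weyl D) : set formal :=
  [set F | exists2 ms, {subset ms <= Y} & supp_in w ms F].

(* The fraction [f = p / q] of Frac(Z_sigma[Y]) has the expansion [F] in
   Z_sigma[[Y, -w Q^vee_+]], that is, [q F = p] there. *)
Definition expansion (w : weyl D) (f : fracV) (F : formal) :=
  cone_series w F /\ exists p q : galgV, [/\ galgY p, galgY q, q != 0,
    f = FracField.tofrac p / FracField.tofrac q & conv q F = p].

(* Z_sigma(Y), inside Frac(Z_sigma[Y]) *)
Definition ratY : set fracV := [set f | forall w, exists F, expansion w f F].

(* Elements of the completion are families of expansions, one for each [w]. *)
Definition family := weyl D -> formal.

Definition cvg_family (f : nat -> fracV) (F : family) := forall w,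
  exists2 E : nat -> formal, forall n, expansion w (f n) (E n) &
  exists2 ms, {subset ms <= Y} &
    (forall n, supp_in w ms (E n)) /\
    (forall y, exists N, forall n, (N <= n)%N -> E n y = F w y).

(* Z_sigma((Y)): the limits of the convergent sequences of Z_sigma(Y) *)
Definition completion : set family :=
  [set F | exists2 f, forall n, ratY (f n) & cvg_family f F].

Definition fam1 : family := fun _ => mono 1 0.
Definition fam_mul (F H : family) : family := fun w => conv (F w) (H w).
Definition fam_act (u : weyl D) (F : family) : family :=
  fun w y => F (u^-1 * w)%g (wact u^-1%g y).

Definition fam_unit (F : family) :=
  completion F /\ exists2 H, completion H & fam_mul F H = fam1.
Definition fam_inv (F : family) : family :=
  xget F [set H | completion H /\ fam_mul F H = fam1].

(* [F] is the product of the [g a], [P a], as the limit of the finite partial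
   products along the directed set of the finite subsets of [P]. *)
Definition is_prod (T : choiceType) (P : set T) (g : T -> fracV) (F : family) :=
  forall w, exists2 E : {fset T} -> formal,
    forall S : {fset T}, [set` S] `<=` P -> expansion w (\prod_(a <- S) g a) (E S) &
  exists2 ms, {subset ms <= Y} &
    (forall S : {fset T}, [set` S] `<=` P -> supp_in w ms (E S)) /\
    (forall y, exists2 S0 : {fset T}, [set` S0] `<=` P &
       forall S : {fset T}, [set` S] `<=` P -> (S0 `<=` S)%fset -> E S y = F w y).

Definition bfun (t u z : fracV) : fracV :=
  ((t - t^-1) + (u - u^-1) * z) / (1 - z ^+ 2).
Definition cfun (t u z : fracV) : fracV := t - bfun t u z.

Definition b_root (a : 'Hom(V, R^o)) : fracV :=
  bfun (const_frac (sigma_root Y a)) (const_frac (sigma'_root Y a)) (expo (coroot D a)).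
Definition c_root (a : 'Hom(V, R^o)) : fracV :=
  cfun (const_frac (sigma_root Y a)) (const_frac (sigma'_root Y a)) (expo (coroot D a)).
Definition c'_root (a : 'Hom(V, R^o)) : fracV :=
  const_frac (sigma_root Y a) * c_root a.

(* An element [sum_w a_w [w]] of the twisted group algebra is represented by
   its coefficient function. *)
Definition twisted := weyl D -> fracV.

Definition tw1 : twisted := fun v => (v == 1%g)%:R.

(* The product determined by [w] f = (w f) [w] *)
Definition tw_mul (f g : twisted) : twisted := fun v =>
  \sum_(u \in [set: weyl D]) f u * frac_act u (g (u^-1 * v)%g).

Definition H_refl (i : I) : twisted := fun v =>
  c_root (sroot D i) *+ (v == srefl D i) + b_root (sroot D i) *+ (v == 1%g).

Definition H_weyl (w : weyl D) : twisted :=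
  foldr (fun i h => tw_mul (H_refl i) h) tw1 (reduced_word w).

Definition P_partial (N : nat) : twisted := fun v =>
  \sum_(w \in [set w : weyl D | (weyl_length w <= N)%N])
    const_frac (sigma_weyl Y w) * H_weyl w v.

(* [P_sigma v] is the coefficient of [v] in P_sigma, the limit of those of the
   partial sums. Limits, inverses and infinite products are unique when they
   exist; the default values used by [xget] are irrelevant. *)
Definition P_sigma (v : weyl D) : family :=
  xget fam1 (cvg_family (fun N => P_partial N v)).

Definition Gamma : family := P_sigma 1%g.

(* c'(-alpha^vee) is c' at the coroot of -alpha. *)
Definition Delta : family :=
  xget fam1 (is_prod (pos_root D) (fun a => c'_root (- a))).

Definition J_sigma (w : weyl D) : family := fam_act w Delta.

Definition m_sigma : family := fam_mul Gamma (fam_inv Delta).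
End Series.

(* Main.v *)
From HB Require Import structures.
Require Import Defs.
From Stdlib Require Import Setoid Morphisms.
From Stdlib Require Ncring Ncring_tac.
From mathcomp Require Import all_boot all_order all_algebra finmap.
From mathcomp Require Import fraction generic_quotient.
From mathcomp Require Import boolp classical_sets functions cardinality fsbigop.
From mathcomp Require Import reals.
From mathcomp Require Import zify ring lra.
Import Order.TTheory GRing.Theory Num.Theory.
Local Open Scope classical_set_scope.
Local Open Scope ring_scope.
Set Implicit Arguments.
Unset Strict Implicit.
Unset Printing Implicit Defensive.

(** Write [P] for [P_sigma], and [C_v] for its coefficient at [v], so that [Gamma] is
    [C_1]. The factorization holds because [P] is an eigenvector of the Hecke
    algebra on both sides. In the twisted group algebra
      [1 + sigma_i H_i = (1 + r_i) c'(- alpha_i^vee)].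
    Grouping the elements [w] and [r_i w] one can factor this out of [P] on the left,
    hence [P] is invariant under left multiplication by [r_i], so that [C_w] is the
    image of [Gamma] under [w] ([tP_left], [left_inv], [limit_act]). Grouping [w] and
    [w r_i] one can factor it out on the right, hence [C_1] and [C_(r_i)] are in
    the ratio of [c'(- alpha_i^vee)] to [c'(alpha_i^vee)] ([tP_right], [right_inv],
    [limit_right]). As [r_i] permutes the positive roots other than [alpha_i],
    the product [Delta] and its image under [r_i] are in the same ratio
    ([delta_srefl]). The factors [c'] are invertible, so the quotient
    [Gamma / Delta] is invariant under all the [r_i] ([quotient_inv]), and [C_w] is the
    product of this quotient and of the image of [Delta] under [w].

    The quotient is invertible because [Gamma] and [Delta] have constant term 1 in
    the fundamental chamber ([limit_const], [delta_const]); by invariance the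
    same is true of the quotient in every chamber. The inverse is a limit of finite
    geometric sums of the approximations ([tends_inv]), hence lies in the
    completion.

    Two facts support this argument. The first is that [H_w] does not depend on
    the reduced word. By [matsumoto] it suffices to have the braid relations,
    where only finitely many types of rank two occur ([cartan_small]). There,
    [H_i e^v = e^(r_i v) H_i^-1] for suitable weights [v], so that the difference of
    the two sides of a braid relation intertwines two exponentials which are
    independent enough to force it to be supported on one group element; it kills
    the constant 1, because [H_i] maps 1 to [sigma_i], and therefore vanishes
    ([intertwiner_eq0], [tH_braided]).

    The second is convergence. Expanding the product of the [H_i] along a reduced word
    replaces some of the factors [c r_i] by [b]. Seen from a given chamber, doing so
    at a positive root whose coroot has height [n] raises the order by [n], and
    shortens the product of the remaining reflections by less than [2 n]; doing so at a
    negative root lengthens this product. As the coefficient of [H_w] at [v]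
    collects the terms with product [v], its order grows with the length of [w]
    ([tHw_ord], [tP_tends]). For [Delta] only finitely many factors differ from
    1 up to a given order ([cm_exceptions]).

    The group theory that this needs (positivity of roots, exchange, the word
    problem) is derived from the action on roots alone, starting from
    [ascent_pos]. Expansions in a chamber are transported to the fundamental one, so
    that all of them live in a single ring of Novikov series, filtered by height
    ([series], [fil], [tends]). *)

(** * Novikov series *)

Section ConvSupport.
Context {G : zmodType} {A : comNzRingType}.
Implicit Types F H K : G -> A.

Lemma conv_eq F F' K K' y :
  (forall x, F x * K (y - x) = F' x * K' (y - x)) -> conv F K y = conv F' K' y.
Proof. by move=> E; apply: eq_fsbigr => x _. Qed.

Lemma conv_supp F K y : conv F K y <> 0 ->
  exists x, F x <> 0 /\ K (y - x) <> 0.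
Proof.
move=> H; apply: contrapT => N; apply: H; rewrite /conv fsbig1 // => x _.
have [->|/eqP Fx] := eqVneq (F x) 0; first by rewrite mul0r.
have [->|/eqP Kx] := eqVneq (K (y - x)) 0; first by rewrite mulr0.
by case: N; exists x.
Qed.

Lemma conv_mono F (a : A) (v y : G) : conv (mono a v) F y = a * F (y - v).
Proof.
by rewrite (convE _ _ (@supp_mono _ _ _ _)) big_seq_fset1 /mono eqxx mulr1n.
Qed.
End ConvSupport.

Section Novikov.
Variables (R : realDomainType) (G : zmodType) (A : comNzRingType).
Variable h : {additive G -> R}.
Implicit Types F H K : G -> A.

(** Local finiteness from above: this is what products of formal sums need, and it
    holds for sums supported in finitely many cones pointing downwards. *)
Definition locfin F :=
  forall c : R, finite_set [set x | F x <> 0 /\ (c <= h x)].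

Lemma locfin_bounded F : locfin F -> exists M, forall x, F x <> 0 -> h x <= M.
Proof.
move=> /(_ 0) /finite_fsetP[S FS].
exists (\sum_(x <- S) `|h x|) => x Fx.
have S0 : 0 <= \sum_(x <- S) `|h x| by apply: sumr_ge0.
have [hx|hx] := leP 0 (h x); last exact: le_trans (ltW hx) S0.
have xS : x \in S by have : [set` S] x by rewrite -FS.
rewrite (big_fsetD1 x) //=; apply: le_trans (ler_norm _) _.
by rewrite lerDl; apply: sumr_ge0.
Qed.

(** The truncation has finite support, which reduces the ring axioms to those of
    the group algebra. *)
Definition trunc (c : R) F : G -> A := fun x => if c <= h x then F x else 0.

Lemma finite_trunc c F : locfin F -> finite_set (fsupp (trunc c F)).
Proof.
move=> /(_ c); apply: sub_finite_set => x; rewrite /fsupp /trunc /=.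
by case: ifP.
Qed.

(** The coefficient at [y] of a product only depends on high enough terms. *)
Lemma conv_trunc c M F K y : (forall x, K x <> 0 -> h x <= M) ->
  c <= h y - M -> conv (trunc c F) K y = conv F K y.
Proof.
move=> KM cy; apply: conv_eq => x; rewrite /trunc; case: ifPn => // cx.
rewrite mul0r; have [->|/eqP Kx] := eqVneq (K (y - x)) 0; first by rewrite mulr0.
by move: (KM _ Kx) cx; rewrite raddfB /= -ltNge => *; exfalso; lra.
Qed.

Lemma conv_bounded M M' F K : (forall x, F x <> 0 -> h x <= M) ->
  (forall x, K x <> 0 -> h x <= M') ->
  forall x, conv F K x <> 0 -> h x <= M + M'.
Proof.
move=> FM KM y /conv_supp[x [/FM Fx /KM]]; rewrite raddfB /=; lra.
Qed.

Lemma locfin_conv F K : locfin F -> locfin K -> locfin (conv F K).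
Proof.
move=> fF fK c; have [M FM] := locfin_bounded fF; have [M' KM] := locfin_bounded fK.
apply: sub_finite_set (finite_image2 (fun x y => x + y) (fF (c - M')) (fK (c - M))).
move=> y [/conv_supp[x [Fx Kx]] cy]; exists x.
  by split=> //; move: (KM _ Kx); rewrite raddfB /=; lra.
exists (y - x); last by rewrite addrC subrK.
by split=> //; move: (FM _ Fx); rewrite raddfB /=; lra.
Qed.

Lemma conv_locfinA F H K : locfin F -> locfin H -> locfin K ->
  conv F (conv H K) = conv (conv F H) K.
Proof.
move=> fF fH fK; apply/funext => y.
have [MF bF] := locfin_bounded fF; have [MH bH] := locfin_bounded fH.
have [MK bK] := locfin_bounded fK.
pose c := Num.min (h y - MH - MK) (Num.min (h y - MF - MK) (h y - MF - MH)).
have [c1 c2 c3] : [/\ c <= h y - MH - MK, c <= h y - MF - MK & c <= h y - MF - MH].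
  by rewrite /c !ge_min !lexx !orbT.
(* Truncate [F] and [H] below [c], apply associativity for finite supports, and undo
   the truncation. *)
have bF' x : trunc c F x <> 0 -> h x <= MF by rewrite /trunc; case: ifP => // _ /bF.
rewrite -(@conv_trunc c (MH + MK) F); [|exact: conv_bounded bH bK|lra].
transitivity (conv (trunc c F) (conv (trunc c H) K) y).
  apply: conv_eq => x; have [->|/eqP Fx] := eqVneq (trunc c F x) 0.
    by rewrite !mul0r.
  rewrite (@conv_trunc c MK) //.
  by move: (bF' _ Fx); rewrite raddfB /=; lra.
rewrite convA; try exact: finite_trunc.
apply: conv_eq => x; have [->|/eqP Kx] := eqVneq (K (y - x)) 0.
  by rewrite !mulr0.
have hx : h y - MK <= h x by move: (bK _ Kx); rewrite raddfB /=; lra.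
congr (_ * _); rewrite convC (@conv_trunc c MF) // 1?convC ?(@conv_trunc c MH) //; lra.
Qed.

Lemma conv_locfinDl F H K : locfin F -> locfin H -> locfin K ->
  conv (fun x => F x + H x) K = (fun y => conv F K y + conv H K y).
Proof.
move=> fF fH fK; apply/funext => y; have [M bK] := locfin_bounded fK.
rewrite -(@conv_trunc (h y - M) M _ K y) // -(@conv_trunc (h y - M) M F K y) //.
rewrite -(@conv_trunc (h y - M) M H K y) //.
have -> : trunc (h y - M) (fun x => F x + H x) =
    (fun x => trunc (h y - M) F x + trunc (h y - M) H x).
  by apply/funext => x; rewrite /trunc; case: ifP; rewrite // addr0.
by rewrite convDl //; exact: finite_trunc.
Qed.

Lemma locfinD F H : locfin F -> locfin H -> locfin (fun x => F x + H x).
Proof.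
move=> fF fH c; apply: sub_finite_set (_ : finite_set
   ([set x | F x <> 0 /\ (c <= h x)] `|` [set x | H x <> 0 /\ (c <= h x)])).
  move=> x [FHx cx]; have [F0|/eqP Fx] := eqVneq (F x) 0; last by left.
  by right; split=> // H0; apply: FHx; rewrite F0 H0 addr0.
by rewrite finite_setU.
Qed.

Lemma locfinN F : locfin F -> locfin (fun x => - F x).
Proof.
move=> fF c; apply: sub_finite_set (fF c) => x [Fx cx]; split=> //.
by move=> F0; apply: Fx; rewrite F0 oppr0.
Qed.

Lemma locfin_finite F : finite_set (fsupp F) -> locfin F.
Proof. by move=> fF c; apply: sub_finite_set fF => x []. Qed.

(** The Novikov completion of A[G] along [h]. *)
Record nov := Nov { ncoef :> G -> A; _ : `[< locfin ncoef >] }.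

HB.instance Definition _ := [isSub for ncoef].
HB.instance Definition _ := [Choice of nov by <:].
Implicit Types X Z T : nov.

Lemma nov_locfin X : locfin X.
Proof. exact/asboolP/(valP X). Qed.

Lemma novP X Z : X =1 Z -> X = Z.
Proof. by move=> XZ; apply/val_inj/funext. Qed.

Definition nmono a x : nov := Nov (asboolT (locfin_finite (finite_supp_mono a x))).
Definition nopp X : nov := Nov (asboolT (locfinN (@nov_locfin X))).
Definition nadd X Z : nov :=
  Nov (asboolT (locfinD (@nov_locfin X) (@nov_locfin Z))).
Definition nmul X Z : nov :=
  Nov (asboolT (locfin_conv (@nov_locfin X) (@nov_locfin Z))).

Fact naddA : associative nadd.
Proof. by move=> X Z T; apply: novP => x /=; rewrite addrA. Qed.
Fact naddC : commutative nadd.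
Proof. by move=> X Z; apply: novP => x /=; rewrite addrC. Qed.
Fact nadd0 : left_id (nmono 0 0) nadd.
Proof. by move=> X; apply: novP => x /=; rewrite /mono mul0rn add0r. Qed.
Fact naddN : left_inverse (nmono 0 0) nopp nadd.
Proof. by move=> X; apply: novP => x /=; rewrite /mono mul0rn addNr. Qed.

HB.instance Definition _ := GRing.isZmodule.Build nov naddA naddC nadd0 naddN.

Fact nmulA : associative nmul.
Proof.
move=> X Z T; apply: novP => x /=; rewrite conv_locfinA //; exact: nov_locfin.
Qed.
Fact nmulC : commutative nmul.
Proof. by move=> X Z; apply: novP => x /=; rewrite convC. Qed.
Fact nmul1 : left_id (nmono 1 0) nmul.
Proof. by move=> X; apply: novP => x /=; rewrite conv1. Qed.
Fact nmulDl : left_distributive nmul +%R.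
Proof.
move=> X Z T; apply: novP => x /=.
by rewrite conv_locfinDl //; exact: nov_locfin.
Qed.
Fact nov_one_neq0 : nmono 1 0 != 0.
Proof.
apply/eqP => /(congr1 (fun X : nov => X 0)) /=; rewrite /mono eqxx => /eqP.
by rewrite oner_eq0.
Qed.

HB.instance Definition _ :=
  GRing.Zmodule_isComNzRing.Build nov nmulA nmulC nmul1 nmulDl nov_one_neq0.

Lemma ncoef0 x : (0 : nov) x = 0. Proof. by rewrite /= /mono mul0rn. Qed.
Lemma ncoefD X Z x : (X + Z) x = X x + Z x. Proof. by []. Qed.
Lemma ncoefN X x : (- X) x = - X x. Proof. by []. Qed.
Lemma ncoefM X Z x : (X * Z) x = conv X Z x. Proof. by []. Qed.

Lemma nmonoM (a b : A) (x y : G) : nmono a x * nmono b y = nmono (a * b) (x + y).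
Proof.
apply: novP => z; rewrite ncoefM conv_mono /= /mono mulrnAr.
by rewrite subr_eq (addrC y).
Qed.

Definition nov_of_galg (p : galg A G) : nov :=
  Nov (asboolT (locfin_finite (finite_supp p))).

End Novikov.

Section NovikovDomain.
Variables (R : realDomainType) (G : zmodType) (A : idomainType).
Variable h : {additive G -> R}.
Hypothesis galg_dom : forall p q : galg A G, p * q = 0 -> (p == 0) || (q == 0).

Lemma locfin_max (F : G -> A) x0 : locfin h F -> F x0 <> 0 ->
  exists2 m, F m <> 0 & forall x, F x <> 0 -> h x <= h m.
Proof.
move=> fF Fx0; have /finite_fsetP[S FS] := fF (h x0).
have x0S : x0 \in S by have : [set` S] x0 by rewrite -FS.
pose s0 : S := [` x0S]%fset.
have [m _ mP] := @Order.TotalTheory.arg_maxP _ _ S s0 xpredT (fun s => h (val s)) isT.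
have [Fm hm] : F (val m) <> 0 /\ h x0 <= h (val m).
  by have : [set` S] (val m) := fsvalP m; rewrite -FS.
exists (val m) => // x Fx; have [xx0|/ltW hx] := leP (h x0) (h x); last exact: le_trans hm.
have xS : x \in S by have : [set` S] x by rewrite -FS.
exact: (mP [` xS]%fset).
Qed.

Definition level (c : R) (F : G -> A) : G -> A := fun x => if h x == c then F x else 0.

Lemma finite_level c F : locfin h F -> finite_set (fsupp (level c F)).
Proof.
move=> /(_ c); apply: sub_finite_set => x; rewrite /fsupp /level /=.
by case: eqP => [->|].
Qed.

(** The terms of maximal height of a Novikov series form an element of the
    group algebra, so that it is enough that the group algebra is a domain. *)
Lemma nov_mul_eq0 (p : galg A G) (X : nov A h) :
  nov_of_galg h p * X = 0 -> p = 0 \/ X = 0.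
Proof.
move=> pX; apply: contrapT => /not_orP[p0 X0].
have [x0 px0] : exists x, p x <> 0.
  apply: contrapT => N; apply: p0; apply: galgP => x; rewrite gcoef0.
  by apply: contrapT => px; apply: N; exists x.
have [y0 Xy0] : exists x, X x <> 0.
  apply: contrapT => N; apply: X0; apply: novP => x; rewrite ncoef0.
  by apply: contrapT => px; apply: N; exists x.
have fp := locfin_finite h (finite_supp p).
have fX := @nov_locfin _ _ _ _ X.
have [m pm mP] := locfin_max fp px0.
have [n Xn nP] := locfin_max fX Xy0.
pose p1 : galg A G := GAlg (asboolT (finite_level (h m) fp)).
pose X1 : galg A G := GAlg (asboolT (finite_level (h n) fX)).
have : p1 * X1 = 0.
  apply: galgP => y; rewrite gcoef0 gcoefM.
  have [hy|hy] := eqVneq (h y) (h m + h n).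
    transitivity ((nov_of_galg h p * X) y); last by rewrite pX ncoef0.
    rewrite ncoefM; apply: conv_eq => x; rewrite /p1 /X1 /= /level.
    have [hx|hx] := eqVneq (h x) (h m).
      by rewrite raddfB /= hy hx addrAC subrr add0r eqxx.
    rewrite mul0r; have [->|/eqP px] := eqVneq (p x) 0; first by rewrite mul0r.
    have [->|/eqP Xx] := eqVneq (X (y - x)) 0; first by rewrite mulr0.
    move: (mP _ px) (nP _ Xx); rewrite raddfB /= hy => h1 h2.
    by case/eqP: hx; apply/eqP; rewrite eq_le h1 /=; lra.
  apply: contrapT => /conv_supp[x []]; rewrite /p1 /X1 /= /level.
  case: eqP => // hx _; case: eqP => // hyx _.
  by case/eqP: hy; rewrite -hx -hyx raddfB /= addrC subrK.
move=> /galg_dom /orP[] /eqP /(congr1 (fun p : galg A G => p _)).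
  by move=> /(_ m); rewrite gcoef0 /p1 /= /level eqxx.
by move=> /(_ n); rewrite gcoef0 /X1 /= /level eqxx.
Qed.
End NovikovDomain.

(** * The Weyl group acting on roots and coroots *)
Section WeylAction.
Context {R : realType} {V : vectType R} {I : finType} {D : rootDatum V I}.
Local Notation al := (sroot D).
Local Notation av := (scoroot D).
Local Notation W := (weyl D).
Implicit Types (u w x : W) (v : V) (a b : 'Hom(V, R^o)) (s : seq I).

(** The pairing with values in [R], rather than in the module [R^o]. *)
Definition ev a v : R := a v.

Lemma evD a (u v : V) : ev a (u + v) = ev a u + ev a v. Proof. by rewrite /ev linearD. Qed.
Lemma evN a v : ev a (- v) = - ev a v. Proof. by rewrite /ev linearN. Qed.
Lemma evB a (u v : V) : ev a (u - v) = ev a u - ev a v. Proof. by rewrite /ev linearB. Qed.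
Lemma evZ a k v : ev a (k *: v) = k * ev a v. Proof. by rewrite /ev linearZ. Qed.
Lemma evDl a b v : ev (a + b) v = ev a v + ev b v. Proof. by rewrite /ev lfunE. Qed.
Lemma evNl a v : ev (- a) v = - ev a v. Proof. by rewrite /ev lfunE. Qed.
Lemma evZl a k v : ev (k *: a) v = k * ev a v. Proof. by rewrite /ev lfunE. Qed.
Lemma ev0l v : ev 0 v = 0. Proof. by rewrite /ev lfunE. Qed.
Lemma ev0 a : ev a 0 = 0. Proof. by rewrite /ev linear0. Qed.
Lemma evMnl a n v : ev (a *+ n) v = ev a v *+ n.
Proof. by elim: n => [|n IH]; rewrite ?ev0l // !mulrS evDl IH. Qed.
Lemma evBl a b v : ev (a - b) v = ev a v - ev b v.
Proof. by rewrite evDl evNl. Qed.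
Lemma ev_suml (J : Type) (r : seq J) (F : J -> 'Hom(V, R^o)) v :
  ev (\sum_(j <- r) F j) v = \sum_(j <- r) ev (F j) v.
Proof.
by elim: r => [|j r IH]; rewrite ?big_nil ?ev0l // !big_cons evDl IH.
Qed.
Lemma ev_ext a b : ev a =1 ev b -> a = b.
Proof. by move=> ab; apply/lfunP => v; apply: ab. Qed.

Fact wact_linear w : linear (wact w). Proof. exact: linearP. Qed.
HB.instance Definition _ w := GRing.isLinear.Build R V V _ (wact w) (wact_linear w).

Lemma wact1 v : wact (1%g : W) v = v. Proof. by rewrite /wact id_lfunE. Qed.
Lemma wactM u w v : wact (u * w)%g v = wact u (wact w v).
Proof. by rewrite /wact comp_lfunE. Qed.
Lemma wactK w : cancel (wact w) (wact w^-1%g).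
Proof. by move=> v; rewrite -wactM mulVg wact1. Qed.
Lemma wactVK w : cancel (wact w^-1%g) (wact w).
Proof. by move=> v; rewrite -wactM mulgV wact1. Qed.
Lemma weyl_ext u w : wact u =1 wact w -> u = w.
Proof. by move=> uw; apply: val_inj; apply/lfunP => v; apply: uw. Qed.

Lemma ev_wact_dual w a v : ev (wact_dual w a) v = ev a (wact w^-1%g v).
Proof. by rewrite /ev /wact_dual comp_lfunE. Qed.
Lemma ev_wact w a v : ev (wact_dual w a) (wact w v) = ev a v.
Proof. by rewrite ev_wact_dual wactK. Qed.

Fact wact_dual_linear w : linear (wact_dual w).
Proof.
move=> k a b; apply: ev_ext => v.
by rewrite !(ev_wact_dual, evDl, evZl).
Qed.
HB.instance Definition _ w := GRing.isLinear.Build R 'Hom(V, R^o) 'Hom(V, R^o) _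
  (wact_dual w) (wact_dual_linear w).

Lemma wact_dual1 a : wact_dual (1%g : W) a = a.
Proof. by apply: ev_ext => v; rewrite ev_wact_dual invg1 wact1. Qed.
Lemma wact_dualM u w a : wact_dual (u * w)%g a = wact_dual u (wact_dual w a).
Proof. by apply: ev_ext => v; rewrite !ev_wact_dual invgM wactM. Qed.
Lemma wact_dualK w : cancel (wact_dual w) (wact_dual w^-1%g).
Proof. by move=> a; rewrite -wact_dualM mulVg wact_dual1. Qed.
Lemma wact_dualVK w : cancel (wact_dual w^-1%g) (wact_dual w).
Proof. by move=> a; rewrite -wact_dualM mulgV wact_dual1. Qed.

Lemma sreflE i v : wact (srefl D i) v = v - ev (al i) v *: av i.
Proof. by rewrite /wact /= reflE. Qed.
Lemma sreflK i : (srefl D i * srefl D i = 1)%g.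
Proof. by apply: val_inj; rewrite /= reflK. Qed.
Lemma sreflV i : (srefl D i)^-1%g = srefl D i.
Proof. by apply: (mulgI (srefl D i)); rewrite mulgV sreflK. Qed.
Lemma srefl_dualE i a : wact_dual (srefl D i) a = a - ev a (av i) *: al i.
Proof.
apply: ev_ext => v; rewrite ev_wact_dual sreflV sreflE evBl evB evZ evZl.
by rewrite mulrC.
Qed.

Lemma cartan_diag i : ev (al i) (av i) = 2.
Proof. by have [H _ _] := sroot_cartan D; exact: H. Qed.

Lemma srefl_coroot i : wact (srefl D i) (av i) = - av i.
Proof. by rewrite sreflE cartan_diag scaler_nat mulr2n opprD addrA subrr add0r. Qed.
Lemma srefl_root i : wact_dual (srefl D i) (al i) = - al i.
Proof. by rewrite srefl_dualE cartan_diag scaler_nat mulr2n opprD addrA subrr add0r. Qed.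

(** The opposite of a Cartan entry, a natural number off the diagonal only. *)
Definition cartan i j : nat := xget 0%N [set n : nat | ev (al i) (av j) = - n%:R].

Lemma cartanE i j : i <> j -> ev (al i) (av j) = - (cartan i j)%:R.
Proof.
move=> ij; rewrite /cartan; case: xgetP => // no.
have [_ H _] := sroot_cartan D; have [|n Hn] := H j i; first by move=> ji; apply: ij.
by case: (no n).
Qed.

Lemma cartan_eq0 i j : i <> j -> cartan i j = 0%N -> cartan j i = 0%N.
Proof.
move=> ij c0; have [_ _ H] := sroot_cartan D.
have := H j i; rewrite -/(ev _ _) -/(ev _ _) !cartanE ?c0; try by move=> E; apply: ij.
rewrite oppr0 => /(_ erefl) /eqP.
by rewrite oppr_eq0 pnatr_eq0 => /eqP.
Qed.

Lemma srefl_coroot_neq i j : i <> j ->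
  wact (srefl D i) (av j) = av j + av i *+ cartan i j.
Proof. by move=> ij; rewrite sreflE cartanE // scaleNr opprK scaler_nat. Qed.
Lemma srefl_root_neq i j : i <> j ->
  wact_dual (srefl D i) (al j) = al j + al i *+ cartan j i.
Proof.
by move=> ij; rewrite srefl_dualE cartanE ?scaleNr ?opprK ?scaler_nat //; apply: nesym.
Qed.

Lemma root_neq0 i : al i <> 0.
Proof. by move=> a0; have := cartan_diag i; rewrite a0 ev0l => /eqP; rewrite eq_sym pnatr_eq0. Qed.

(** * Words and length *)

Lemma weyl_word0 : weyl_word D [::] = 1%g. Proof. exact: big_nil. Qed.
Lemma weyl_word_cons i s : weyl_word D (i :: s) = (srefl D i * weyl_word D s)%g.
Proof. exact: big_cons. Qed.
Lemma weyl_word_cat s t : weyl_word D (s ++ t) = (weyl_word D s * weyl_word D t)%g.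
Proof. exact: big_cat. Qed.
Lemma weyl_word_rcons s i : weyl_word D (rcons s i) = (weyl_word D s * srefl D i)%g.
Proof. by rewrite -cats1 weyl_word_cat weyl_word_cons weyl_word0 mulg1. Qed.
Lemma weyl_word_rev s : weyl_word D (rev s) = (weyl_word D s)^-1%g.
Proof.
elim: s => [|i s IH]; first by rewrite weyl_word0 invg1.
by rewrite rev_cons weyl_word_rcons IH weyl_word_cons invgM sreflV.
Qed.

Local Notation len := (@weyl_length R V I D).

Lemma len_word s : (len (weyl_word D s) <= size s)%N.
Proof.
by rewrite /weyl_length; case: ex_minnP => n _; apply; apply/asboolP; exists s.
Qed.

Lemma len_wordP w : exists2 s, size s = len w & weyl_word D s = w.
Proof. by rewrite /weyl_length; case: ex_minnP => n /asboolP. Qed.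

Lemma len1 : len 1%g = 0%N.
Proof. by apply/eqP; rewrite -leqn0 -weyl_word0; exact: len_word. Qed.
Lemma len0 w : len w = 0%N -> w = 1%g.
Proof. by have [s <- <-] := len_wordP w; move/size0nil => ->; rewrite weyl_word0. Qed.
Lemma lenM u w : (len (u * w)%g <= len u + len w)%N.
Proof.
have [s <- <-] := len_wordP u; have [t <- <-] := len_wordP w.
by rewrite -weyl_word_cat -size_cat; exact: len_word.
Qed.
Lemma lenV w : len w^-1%g = len w.
Proof.
have H x : (len x^-1%g <= len x)%N.
  have [s <- <-] := len_wordP x.
  by rewrite -weyl_word_rev -(size_rev s); exact: len_word.
by apply/eqP; rewrite eqn_leq H -{1}(invgK w) H.
Qed.
Lemma len_srefl i : (len (srefl D i) <= 1)%N.
Proof. by have := len_word [:: i]; rewrite weyl_word_cons weyl_word0 mulg1. Qed.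
Lemma lenMr w i : (len (w * srefl D i)%g <= (len w).+1)%N.
Proof. by have := lenM w (srefl D i); have := len_srefl i; lia. Qed.
Lemma mulKr w i : (w * srefl D i * srefl D i = w)%g.
Proof. by rewrite -mulgA sreflK mulg1. Qed.
Lemma mulKl w i : (srefl D i * (srefl D i * w) = w)%g.
Proof. by rewrite mulgA sreflK mul1g. Qed.
Lemma len_leMr w i : (len w <= (len (w * srefl D i)%g).+1)%N.
Proof. by have := lenMr (w * srefl D i)%g i; rewrite mulKr. Qed.

(** * Dihedral words *)

Fixpoint alt (i j : I) (k : nat) : seq I :=
  if k is k'.+1 then i :: alt j i k' else [::].

Lemma size_alt i j k : size (alt i j k) = k.
Proof. by elim: k i j => //= k IH i j; rewrite IH. Qed.

Lemma alt_rcons i j k : alt i j k.+1 = rcons (alt i j k) (if odd k then j else i).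
Proof.
elim: k i j => // k IH i j.
by rewrite -[LHS]/(i :: alt j i k.+1) IH /=; case: (odd k).
Qed.

Lemma alt_cat i j k l : exists t, alt i j (k + l) = alt i j k ++ t /\ size t = l.
Proof.
elim: k i j => [|k IH] i j; first by exists (alt i j l); rewrite size_alt.
by have [t [E st]] := IH j i; exists t; rewrite addSn /= E.
Qed.

(** The order of [r_i r_j] in terms of the product of the off-diagonal entries
    of a Cartan matrix of rank two; the value 0 stands for an infinite order. *)
Definition cox_order (n : nat) : nat := nth 0%N [:: 2; 3; 4; 6]%N n.

(** The coordinates on [alpha_i, alpha_j] of the image of [alpha_i] under the
    product of the [k] last letters of ... r_i r_j, where [p] and [q] are the
    opposites of the two Cartan entries. *)
Fixpoint dih (p q : int) (k : nat) : int * int :=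
  if k is k'.+1 then
    let: (s, t) := dih p q k' in
    if odd k then (s, p * s - t) else (q * t - s, t)
  else (1, 0).

(** In infinite order, an inequality between the two coordinates that makes the next
    one nonnegative propagates; in finite order there are finitely many cases. *)
Lemma dih_ge0 (p q : nat) k : (p = 0%N <-> q = 0%N) ->
  (4 <= p * q)%N \/ (k < cox_order (p * q))%N ->
  0 <= (dih p q k).1 /\ 0 <= (dih p q k).2.
Proof.
move=> pq0 [pq|].
  suff [] : [/\ 0 <= (dih p q k).1, 0 <= (dih p q k).2 & if odd k
      then p%:Z * (dih p q k).1 <= 2 * (dih p q k).2
      else q%:Z * (dih p q k).2 <= 2 * (dih p q k).1] by [].
  elim: k => [|k [/=]]; first by split=> //=; lia.
  case: (dih p q k) => s t /=; case: (odd k) => /= s0 t0 st; split=> //; nia.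
case: (leqP 4 (p * q)) => [pq|pq k_lt].
  by rewrite /cox_order nth_default.
have [p3 q3] : (p <= 3)%N /\ (q <= 3)%N by split; nia.
move: pq pq0 k_lt p3 q3.
case: p => [|[|[|[|p]]]] //; case: q => [|[|[|[|q]]]] // _ [h1 h2];
  try (by have := h1 erefl); try (by have := h2 erefl);
  by case: k => [|[|[|[|[|[|k]]]]]].
Qed.

(** The value of [alpha_i] on [v] is a parameter, so that the reflections become
    affine maps of the two coordinates [x] and [y]. *)
Lemma alt_act (x y P Q : R) (i j : I) v : i <> j -> ev (al i) v = P ->
  wact (srefl D i) (v + x *: av i + y *: av j) =
  v + ((cartan i j)%:R * y - x - P) *: av i + y *: av j.
Proof.
move=> ij Pv; rewrite !linearD !linearZ_LR /= (srefl_coroot_neq ij) srefl_coroot.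
rewrite sreflE Pv scalerN scalerDr -(scaler_nat (cartan i j)) scalerA (mulrC y).
have -> : (cartan i j)%:R * y - x - P = - P - x + (cartan i j)%:R * y by ring.
by rewrite !scalerDl !scaleNr !addrA addrAC.
Qed.

(** The braid relation in the Weyl group: both sides act on a vector [v] by
    adding a combination of the two coroots that depends on [v] only through
    [alpha_i(v)] and [alpha_j(v)]. *)
Lemma weyl_braid i j : i <> j -> (cartan i j * cartan j i < 4)%N ->
  let m := cox_order (cartan i j * cartan j i) in
  weyl_word D (alt i j m) = weyl_word D (alt j i m).
Proof.
move=> ij; have ji := nesym ij.
have E0 v : v = v + (0 : R) *: av i + (0 : R) *: av j by rewrite !scale0r !addr0.
have Si v (x y : R) := @alt_act x y _ 0 i j v ij erefl.
have Sj v (x y : R) : wact (srefl D j) (v + x *: av i + y *: av j) =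
  v + x *: av i + ((cartan j i)%:R * x - y - ev (al j) v) *: av j.
  by rewrite -addrA (addrC (_ *: av i)) addrA (@alt_act _ _ _ 0 _ _ _ ji erefl) addrAC.
have := cartan_eq0 ij; have := cartan_eq0 ji.
move: Si Sj; move: (cartan i j) (cartan j i) => p q Si Sj q0 p0 pq.
have [p3 q3] : (p <= 3)%N /\ (q <= 3)%N.
  by split; [have := q0; case: q {Sj q0 p0} pq; nia|have := p0; case: p {Si q0 p0} pq; nia].
apply: weyl_ext => v.
move: pq q0 p0 p3 q3 Si Sj.
case: p => [|[|[|[|p]]]] //; case: q => [|[|[|[|q]]]] // _ h1 h2;
  try (by have := h1 erefl); try (by have := h2 erefl);
  move=> _ _ Si Sj; rewrite /cox_order /=;
  rewrite !(weyl_word_cons, weyl_word0, mulg1) !wactM (E0 v) !(Si, Sj);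
  congr (_ + _ *: _ + _ *: _); ring.
Qed.

End WeylAction.

(** * Positivity of roots *)
Section Cones.
Variable I : finType.

Definition ncone (U : nmodType) (e : I -> U) : set U :=
  [set x | exists n : I -> nat, x = \sum_i e i *+ n i].

Lemma ncone0 (U : nmodType) (e : I -> U) : ncone e 0.
Proof. by exists (fun _ => 0%N); rewrite big1 // => i _; rewrite mulr0n. Qed.
Lemma nconeD (U : nmodType) (e : I -> U) x y : ncone e x -> ncone e y -> ncone e (x + y).
Proof.
move=> [n ->] [m ->]; exists (fun i => (n i + m i)%N).
by rewrite -big_split; apply: eq_bigr => i _; rewrite mulrnDr.
Qed.
Lemma nconeMn (U : nmodType) (e : I -> U) x k : ncone e x -> ncone e (x *+ k).
Proof.
by move=> ex; elim: k => [|k IH]; rewrite ?mulrS; [exact: ncone0|exact: nconeD].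
Qed.
Lemma ncone_gen (U : nmodType) (e : I -> U) i : ncone e (e i).
Proof.
exists (fun j => (j == i) : nat); rewrite (bigD1 i) //= eqxx mulr1n big1 ?addr0 // => j.
by move=> /negbTE ->.
Qed.
Section Free.
Variables (R : realType) (U : vectType R) (e : I -> U).
Hypothesis free_e : free (codom e).

Definition fcoord (i : I) (x : U) : R := coord (codom_tuple e) (enum_rank i) x.

Lemma fcoordD i x y : fcoord i (x + y) = fcoord i x + fcoord i y.
Proof. by rewrite /fcoord linearD. Qed.
Lemma fcoordN i x : fcoord i (- x) = - fcoord i x.
Proof. by rewrite /fcoord linearN. Qed.
Lemma fcoordB i x y : fcoord i (x - y) = fcoord i x - fcoord i y.
Proof. by rewrite fcoordD fcoordN. Qed.
Lemma fcoordZ i k x : fcoord i (k *: x) = k * fcoord i x.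
Proof. by rewrite /fcoord linearZ. Qed.
Lemma fcoordMn i n x : fcoord i (x *+ n) = fcoord i x *+ n.
Proof. by rewrite /fcoord linearMn. Qed.
Lemma fcoord_sum i (J : Type) (r : seq J) (F : J -> U) :
  fcoord i (\sum_(j <- r) F j) = \sum_(j <- r) fcoord i (F j).
Proof. by rewrite /fcoord linear_sum. Qed.

Lemma fcoord_gen i j : fcoord i (e j) = (j == i)%:R.
Proof.
have -> : e j = (codom_tuple e)`_(enum_rank j).
  rewrite /= codomE (nth_map j) ?size_enum_ord ?nth_enum_rank //.
  by rewrite -cardE ltn_ord.
by rewrite /fcoord coord_free // (inj_eq enum_rank_inj) eq_sym.
Qed.

Lemma fcoord_ncone i (n : I -> nat) : fcoord i (\sum_j e j *+ n j) = (n i)%:R.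
Proof.
rewrite fcoord_sum (bigD1 i) //= fcoordMn fcoord_gen eqxx big1 ?addr0 // => j ji.
by rewrite fcoordMn fcoord_gen (negbTE ji) mul0rn.
Qed.

Lemma ncone_fcoord_ge0 i x : ncone e x -> 0 <= fcoord i x.
Proof. by move=> [n ->]; rewrite fcoord_ncone ler0n. Qed.

Lemma ncone_eq0 x : ncone e x -> ncone e (- x) -> x = 0.
Proof.
move=> ex eNx; have [n xn] := ex; rewrite xn big1 // => i _.
have := ncone_fcoord_ge0 i ex; have := ncone_fcoord_ge0 i eNx.
rewrite fcoordN xn fcoord_ncone oppr_ge0 lern0 => /eqP ->.
by rewrite mulr0n.
Qed.
End Free.
End Cones.

Section Roots.
Context {R : realType} {V : vectType R} {I : finType} {D : rootDatum V I}.
Local Notation al := (sroot D).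
Local Notation av := (scoroot D).
Local Notation W := (weyl D).
Local Notation len := (@weyl_length R V I D).
Local Notation rs := (srefl D).
Local Notation word := (weyl_word D).
Implicit Types (u w x : W) (v : V) (a b : 'Hom(V, R^o)) (s : seq I).
Local Notation cart := (@cartan R V I D).

(** Stated for an abstract pair of reflections, since it serves for roots and for
    coroots, with the two Cartan entries exchanged. *)
Lemma dih_ncone (U : zmodType) (e : I -> U) (f : I -> {additive U -> U}) (p q : nat) i j k :
  (p = 0%N <-> q = 0%N) -> (4 <= p * q)%N \/ (k < cox_order (p * q))%N ->
  f i (e i) = - e i -> f j (e j) = - e j ->
  f i (e j) = e j + e i *+ q -> f j (e i) = e i + e j *+ p ->
  exists m n, foldr (fun l => f l) (e i) (rev (alt j i k)) = e i *+ m + e j *+ n.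
Proof.
move=> pq0 pqk fii fjj fij fji.
have H l : foldr (fun l => f l) (e i) (rev (alt j i l)) =
    e i *~ (dih p q l).1 + e j *~ (dih p q l).2.
  elim: l => [|l IH]; first by rewrite /= mulr1z mulr0z addr0.
  rewrite alt_rcons rev_rcons /= IH; case: (dih p q l) => s t /=.
  case: (odd l) => /=; rewrite raddfD !raddfMz /=.
    rewrite fii fij mulrzDl mulNrz pmulrn mulrzBr mulrzA.
    by rewrite addrCA addrA addrAC -!addrA addrC -addrA addrC -addrA.
  rewrite fjj fji mulrzDl mulNrz pmulrn mulrzBr mulrzA.
  by rewrite -addrA.
have [m0 n0] := dih_ge0 pq0 pqk.
exists `|(dih p q k).1|%N, `|(dih p q k).2|%N.
by rewrite H !pmulrn !gez0_abs.
Qed.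

Lemma wact_dual_word s a : wact_dual (word s) a = foldr (fun l => wact_dual (rs l)) a s.
Proof.
elim: s => [|i s IH]; first by rewrite weyl_word0 wact_dual1.
by rewrite weyl_word_cons wact_dualM IH.
Qed.
Lemma wact_word s v : wact (word s) v = foldr (fun l => wact (rs l)) v s.
Proof.
elim: s => [|i s IH]; first by rewrite weyl_word0 wact1.
by rewrite weyl_word_cons wactM IH.
Qed.

Lemma cartan_eq0P i j : i <> j -> (cart i j = 0%N <-> cart j i = 0%N).
Proof. by move=> ij; split; apply: cartan_eq0; [|apply: nesym]. Qed.

(** The rank two case of [ascent_pos]: an alternating word in [i] and [j] shorter than
    the order of [r_i r_j], and which ends with [j], lengthens on the right by [r_i]. *)
Lemma alt_root_pos i j k : i <> j ->
  (4 <= cart i j * cart j i)%N \/ (k < cox_order (cart i j * cart j i))%N ->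
  exists m n m' n',
  wact_dual (word (rev (alt j i k))) (al i) = al i *+ m + al j *+ n /\
  wact (word (rev (alt j i k))) (av i) = av i *+ m' + av j *+ n'.
Proof.
move=> ij pqk; have ji := nesym ij.
have [m [n E]] := @dih_ncone _ al (fun l => wact_dual (rs l)) _ _ i j k
  (cartan_eq0P ij) pqk (srefl_root i) (srefl_root j) (srefl_root_neq ij)
  (srefl_root_neq ji).
rewrite mulnC in pqk.
have [m' [n' E']] := @dih_ncone _ av (fun l => wact (rs l)) _ _ i j k
  (cartan_eq0P ji) pqk (srefl_coroot i) (srefl_coroot j) (srefl_coroot_neq ij)
  (srefl_coroot_neq ji).
by exists m, n, m', n'; rewrite wact_dual_word wact_word E E'.
Qed.

(** By the braid relation an alternating word of full length that ends with [j] has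
    the same product as one that ends with [i], and this letter cancels. *)
Lemma alt_long_descent i j k x : i <> j -> (cart i j * cart j i < 4)%N ->
  (cox_order (cart i j * cart j i) <= k)%N ->
  (len (x * word (rev (alt j i k)) * rs i)%g <= len x + k.-1)%N.
Proof.
move=> ij pq; set m := cox_order _ => mk.
have m0 : (0 < m)%N.
  by rewrite /m; case: (_ * _)%N pq => [|[|[|[|n]]]].
have [t [E st]] := alt_cat j i m (k - m); rewrite subnKC // in E.
rewrite E rev_cat weyl_word_cat (weyl_word_rev (alt j i m)).
rewrite -(weyl_braid ij pq) -/m -weyl_word_rev.
case: m m0 mk st {E} => // m _ mk st; rewrite /= rev_cons weyl_word_rcons.
rewrite -!mulgA sreflK mulg1 -weyl_word_cat.
apply: leq_trans (lenM _ _) _; rewrite leq_add2l; apply: leq_trans (len_word _) _.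
by rewrite size_cat !size_rev st size_alt; lia.
Qed.

Lemma exists_max_nat (P : nat -> Prop) n (B : nat) : P n -> (forall k, P k -> (k <= B)%N) ->
  exists2 k, P k & ~ P k.+1.
Proof.
move=> Pn Pb; have exP : exists k, `[< P k >] by exists n; apply/asboolP.
have Pb' k : `[< P k >] -> (k <= B)%N by move=> /asboolP /Pb.
have [i /asboolP Pi imax] := @ex_maxnP (fun k => `[< P k >]) B exP Pb'.
by exists i => // Pi1; have := imax i.+1; rewrite asboolT // ltnn => /(_ isT).
Qed.

(** By induction on the length. If [w <> 1], let [j] be a letter that shortens it, and
    split off from the right of [w] the longest possible alternating word in [i]
    and [j]. The rest [v] is shorter than [w] and lengthens by both [r_i] and
    [r_j], so it keeps both simple roots positive; the alternating word sends
    [alpha_i] to a nonnegative combination of the two. *)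
Theorem ascent_pos w i : ~ (len (w * rs i)%g < len w)%N ->
  ncone al (wact_dual w (al i)) /\ ncone av (wact w (av i)).
Proof.
have [n] := ubnP (len w); elim: n w i => // n IH w i wn wi.
have [w0|] := eqVneq (len w) 0%N.
  by rewrite (len0 w0) wact_dual1 wact1; split; apply: ncone_gen.
have [s ss sw] := len_wordP w; rewrite -ss.
case: (lastP s) sw ss => // s' j sw ss _.
have wj : w = (word s' * rs j)%g by rewrite -sw weyl_word_rcons.
have lw' : (len (word s') < len w)%N.
  by have := len_word s'; move: ss; rewrite size_rcons => <-; rewrite ltnS.
have lw'' : len w = (len (word s')).+1.
  by have := lenMr (word s') j; rewrite -wj; lia.
have ij : i <> j by move=> ij; apply: wi; rewrite wj ij mulKr -wj.
have [||k [v wv lv] kmax] := @exists_max_nat (fun k => exists2 v : W,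
  w = (v * word (rev (alt j i k)))%g & (len w = len v + k)%N) 1%N (len w).
- exists (word s'); last by rewrite addn1.
  by rewrite /= /rev /= weyl_word_cons weyl_word0 mulg1 -wj.
- by move=> k [v _ ->]; rewrite leq_addl.
have k0 : (0 < k)%N.
  case: (k) kmax => // -[]; exists (word s'); last by rewrite addn1.
  by rewrite /= /rev /= weyl_word_cons weyl_word0 mulg1 -wj.
have next : ~ (len (v * rs (if odd k then i else j))%g < len v)%N.
  set y := if _ then _ else _ => vy; apply: kmax; exists (v * rs y)%g.
    by rewrite alt_rcons rev_rcons weyl_word_cons mulgA mulKr.
  by have := len_leMr v y; lia.
have prev : ~ (len (v * rs (if odd k then j else i))%g < len v)%N.
  set y := if _ then _ else _ => vy; move: wv; rewrite -(prednK k0) alt_rcons rev_rcons.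
  have -> : (if odd k.-1 then i else j) = y.
    by rewrite /y -{2}(prednK k0) /=; case: (odd _).
  rewrite weyl_word_cons mulgA => wv.
  have := lenM (v * rs y)%g (word (rev (alt j i k.-1))); rewrite -wv lv.
  by have := @len_word _ _ _ D (rev (alt j i k.-1)); rewrite size_rev size_alt; lia.
have vi : ~ (len (v * rs i)%g < len v)%N by case: (odd k) next prev.
have vj : ~ (len (v * rs j)%g < len v)%N by case: (odd k) next prev.
have vn : (len v < n)%N by lia.
have [vi1 vi2] := IH _ _ vn vi; have [vj1 vj2] := IH _ _ vn vj.
(* A word of full length would let [r_i] shorten [w]. *)
have pqk : (4 <= cart i j * cart j i)%N \/ (k < cox_order (cart i j * cart j i))%N.
  have [pq|pq] := leqP 4 (cart i j * cart j i); [by left|right].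
  rewrite ltnNge; apply/negP => mk; apply: wi.
  have := alt_long_descent v ij pq mk; rewrite -wv lv; lia.
have [m [m1 [m2 [m3 [E E']]]]] := alt_root_pos ij pqk.
rewrite wv wact_dualM wactM E E' !raddfD !raddfMn /=.
by split; apply: nconeD; apply: nconeMn.
Qed.

Lemma descent_neg w i : (len (w * rs i)%g < len w)%N ->
  ncone al (- wact_dual w (al i)) /\ ncone av (- wact w (av i)).
Proof.
move=> wi; have [|H1 H2] := @ascent_pos (w * rs i)%g i; first by rewrite mulKr; lia.
move: H1 H2; rewrite wact_dualM wactM srefl_root srefl_coroot.
by rewrite !raddfN.
Qed.
End Roots.

(** * Real roots, coroots and reflections *)
Section RealRoots.
Context {R : realType} {V : vectType R} {I : finType} {D : rootDatum V I}.
Local Notation al := (sroot D).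
Local Notation av := (scoroot D).
Local Notation W := (weyl D).
Local Notation len := (@weyl_length R V I D).
Local Notation rs := (srefl D).
Local Notation word := (weyl_word D).
Implicit Types (u w x : W) (v : V) (a b : 'Hom(V, R^o)) (s : seq I).

Lemma ascent_descent w i : (len (w * rs i)%g < len w)%N \/ ~ (len (w * rs i)%g < len w)%N.
Proof. by case: ltnP; [left|right]. Qed.

Lemma root_act_neq0 w i : wact_dual w (al i) <> 0.
Proof.
move=> w0; apply: (@root_neq0 _ _ _ D i).
by rewrite -(wact_dualK w (al i)) w0 raddf0.
Qed.

Lemma neg_descent w i : ncone al (- wact_dual w (al i)) -> (len (w * rs i)%g < len w)%N.
Proof.
move=> neg; have [//|/ascent_pos[pos _]] := ascent_descent w i.
by have := ncone_eq0 (sroot_free D) pos neg => /root_act_neq0.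
Qed.

Lemma pos_ascent w i : ncone al (wact_dual w (al i)) -> (len w < len (w * rs i)%g)%N.
Proof.
move=> pos; have : (len (w * rs i * rs i)%g < len (w * rs i)%g)%N.
  by apply: neg_descent; rewrite wact_dualM srefl_root raddfN opprK.
by rewrite mulKr.
Qed.

Lemma root_sign a : real_root D a -> ncone al a \/ ncone al (- a).
Proof.
move=> [w [i ->]]; have [/descent_neg[]|/ascent_pos[]] := ascent_descent w i.
  by right.
by left.
Qed.

Lemma real_root_neq0 a : real_root D a -> a <> 0.
Proof. by move=> [w [i ->]]; exact: root_act_neq0. Qed.

Lemma real_root_act w a : real_root D a -> real_root D (wact_dual w a).
Proof. by move=> [u [i ->]]; exists (w * u)%g, i; rewrite wact_dualM. Qed.
Lemma real_rootN a : real_root D a -> real_root D (- a).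
Proof.
move=> [u [i ->]]; exists (u * rs i)%g, i.
by rewrite wact_dualM srefl_root raddfN.
Qed.
Lemma real_root_simple i : real_root D (al i).
Proof. by exists 1%g, i; rewrite wact_dual1. Qed.

Lemma conj_srefl u i v : wact (u * rs i * u^-1)%g v =
  v - ev (wact_dual u (al i)) v *: wact u (av i).
Proof.
rewrite !wactM sreflE linearB linearZ_LR /= wactVK.
by rewrite ev_wact_dual.
Qed.

Lemma conj_srefl_dual u i a : wact_dual (u * rs i * u^-1)%g a =
  a - ev a (wact u (av i)) *: wact_dual u (al i).
Proof.
apply: ev_ext => v; rewrite ev_wact_dual !invgM invgK sreflV mulgA conj_srefl.
by rewrite evBl evZl evB evZ mulrC.
Qed.

Lemma fix_roots_eq1 w : (forall k, wact_dual w (al k) = al k) -> w = 1%g.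
Proof.
move=> wk; have [s ss sw] := len_wordP w.
case: (lastP s) ss sw => [/esym/len0 //|s' k] ss sw.
have : (len (w * rs k)%g < len w)%N.
  rewrite -ss -sw weyl_word_rcons mulKr size_rcons ltnS; exact: len_word.
move=> /descent_neg[]; rewrite wk => neg _.
by have /root_neq0 := ncone_eq0 (sroot_free D) (ncone_gen al k) neg.
Qed.

Lemma sub_scaled (U : lmodType R) (x y : U) (p q : R) :
  x - p *: y - q *: y = x - (p + q) *: y.
Proof. by rewrite scalerDl opprD addrA. Qed.

(** A root determines its reflection. If [u alpha_i = alpha_j] then
    [t = u r_i u^-1 r_j] moves every simple root by a multiple of [alpha_j] only,
    and [t^-1] by the opposite multiple; as [t alpha_k] and [t^-1 alpha_k] are
    roots with coefficient 1 on [alpha_k], they are positive and the multiple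
    vanishes. *)
Lemma conj_simple u i j : wact_dual u (al i) = al j ->
  (u * rs i * u^-1 = rs j)%g.
Proof.
move=> uij; set g := wact u (av i).
have evg : ev (al j) g = 2 by rewrite -uij ev_wact cartan_diag.
have sE a : wact_dual (u * rs i * u^-1)%g a = a - ev a g *: al j.
  by rewrite conj_srefl_dual uij.
set t := (u * rs i * u^-1 * rs j)%g.
have tE a : wact_dual t a = a + (ev a (av j) - ev a g) *: al j.
  rewrite wact_dualM srefl_dualE sE evBl evZl evg sub_scaled -scaleNr.
  apply: (congr1 (fun c => a + c *: al j)); move: (ev a (av j)) (ev a g) => p q; ring.
have tVE a : wact_dual t^-1%g a = a - (ev a (av j) - ev a g) *: al j.
  rewrite /t invgM sreflV wact_dualM !invgM invgK mulgA sreflV sE srefl_dualE.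
  rewrite evBl evZl cartan_diag sub_scaled.
  apply: (congr1 (fun c => a - c *: al j)); move: (ev a (av j)) (ev a g) => p q; ring.
have t1 : t = 1%g.
  apply: fix_roots_eq1 => k.
  have [->|/eqP kj] := eqVneq k j.
    by rewrite tE evg cartan_diag subrr scale0r addr0.
  set c := ev (al k) (av j) - ev (al k) g.
  have Pos (d : R) w : wact_dual w (al k) = al k + d *: al j -> 0 <= d.
    move=> E; have [] := root_sign (real_root_act w (real_root_simple k)); rewrite E => pos.
      have := ncone_fcoord_ge0 (sroot_free D) j pos.
      rewrite fcoordD fcoordZ !fcoord_gen ?eqxx ?mulr1; try exact: (sroot_free D).
      by case: eqP => // _; rewrite add0r.
    have := ncone_fcoord_ge0 (sroot_free D) k pos.
    rewrite fcoordN fcoordD fcoordZ !fcoord_gen ?eqxx; try exact: (sroot_free D).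
    by rewrite eq_sym; case: eqP => // _; rewrite mulr0 addr0 oppr_ge0 ler10.
  have c0 : 0 <= c by apply: (Pos _ t); rewrite tE.
  have cN0 : 0 <= - c by apply: (Pos _ t^-1%g); rewrite tVE scaleNr.
  by rewrite tE -/c (_ : c = 0) ?scale0r ?addr0 //; lra.
by apply: (mulIg (rs j)); rewrite -/t t1 sreflK.
Qed.

(** Both coroots define the same reflection. *)
Lemma conj_simple_coroot u i j : wact_dual u (al i) = al j -> wact u (av i) = av j.
Proof.
move=> uij; have := conj_srefl u i (av j).
rewrite (conj_simple uij) uij cartan_diag srefl_coroot.
move=> /(congr1 (fun v => 2^-1 *: (av j - v))).
rewrite opprK subKr scalerA mulVf ?pnatr_eq0 // scale1r -mulr2n -scaler_nat.
by rewrite scalerA mulVf ?pnatr_eq0 // scale1r.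
Qed.

Lemma coroot_act_simple w i : coroot D (wact_dual w (al i)) = wact w (av i).
Proof.
rewrite /coroot; case: xgetP => [_ -> [w' [j [E ->]]]|/(_ (wact w (av i)))]; last first.
  by case; exists w, i.
have : wact_dual (w^-1 * w')%g (al j) = al i by rewrite wact_dualM -E wact_dualK.
by move=> /conj_simple_coroot <-; rewrite wactM wactVK.
Qed.

Lemma coroot_simple i : coroot D (al i) = av i.
Proof. by rewrite -[al i](wact_dual1 (D := D)) coroot_act_simple wact1. Qed.

Lemma coroot_act w a : real_root D a -> coroot D (wact_dual w a) = wact w (coroot D a).
Proof. by move=> [u [i ->]]; rewrite -wact_dualM !coroot_act_simple wactM. Qed.

Lemma corootN a : real_root D a -> coroot D (- a) = - coroot D a.
Proof.
move=> [u [i ->]]; rewrite -raddfN /= -srefl_root -wact_dualM !coroot_act_simple.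
by rewrite wactM srefl_coroot raddfN.
Qed.

Lemma ev_coroot a : real_root D a -> ev a (coroot D a) = 2.
Proof. by move=> [u [i ->]]; rewrite coroot_act_simple ev_wact cartan_diag. Qed.

Lemma coroot_pos a : real_root D a -> ncone al a -> ncone av (coroot D a).
Proof.
move=> [w [i ->]] pos; rewrite coroot_act_simple.
have [/descent_neg[neg _]|/ascent_pos[] //] := ascent_descent w i.
by have /root_act_neq0 := ncone_eq0 (sroot_free D) pos neg.
Qed.

Lemma real_root_coord a i : real_root D a -> exists m : int, fcoord al i a = m%:~R.
Proof.
move=> /root_sign[[n ->]|[n /(canRL opprK) ->]].
  by exists (n i)%:Z; rewrite fcoord_ncone //; exact: (sroot_free D).
by exists (- (n i)%:Z); rewrite fcoordN fcoord_ncone ?mulrNz //; exact: (sroot_free D).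
Qed.

(** [r_i] changes the coefficient of [alpha_i] only, so that [a] has no other; since
    the coordinates of roots are integers and [a] is itself the image of a
    simple root, the coefficient is 1. *)
Lemma srefl_neg_simple a i : real_root D a -> ncone al a ->
  ncone al (- wact_dual (rs i) a) -> a = al i.
Proof.
move=> ra pos neg; have [n an] := pos.
have nk k : k != i -> n k = 0%N.
  move=> ki; have := ncone_fcoord_ge0 (sroot_free D) k neg.
  rewrite srefl_dualE opprB fcoordB fcoordZ fcoord_gen; last exact: (sroot_free D).
  rewrite eq_sym (negbTE ki) mulr0 add0r an fcoord_ncone; last exact: (sroot_free D).
  by rewrite oppr_ge0 lern0 => /eqP.
have ai : a = al i *+ n i.
  by rewrite an (bigD1 i) //= big1 ?addr0 // => k /nk ->; rewrite mulr0n.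
have [u [j au]] := ra.
have [m mE] := real_root_coord j (real_root_act u^-1%g (real_root_simple i)).
have : fcoord al j (wact_dual u^-1%g a) = 1.
  by rewrite au wact_dualK fcoord_gen ?eqxx //; exact: (sroot_free D).
rewrite ai raddfMn /= fcoordMn mE pmulrn -mulrzA => /eqP; rewrite (eqr_int _ _ 1).
move=> /eqP /(congr1 absz); rewrite abszM /= => /eqP.
by rewrite muln_eq1 => /andP[_ /eqP ->].
Qed.

Lemma srefl_pos a i : real_root D a -> ncone al a -> a <> al i ->
  ncone al (wact_dual (rs i) a).
Proof.
move=> ra pos ai; have [//|neg] := root_sign (real_root_act (rs i) ra).
by case: ai; exact: srefl_neg_simple neg.
Qed.

(** Apply the letters of the word one by one: the root becomes negative exactly when it
    is the simple root of the next letter, and the reflection deletes this letter. *)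
Lemma exchange s u i : ncone al (wact_dual u (al i)) ->
  ncone al (- wact_dual (word s)^-1%g (wact_dual u (al i))) ->
  exists2 s', (size s' < size s)%N & word s' = (u * rs i * u^-1 * word s)%g.
Proof.
elim: s u => [|k s IH] u pos.
  rewrite weyl_word0 invg1 wact_dual1 => neg.
  by have /root_act_neq0 := ncone_eq0 (sroot_free D) pos neg.
rewrite weyl_word_cons invgM wact_dualM sreflV => neg.
have [ak|/eqP ak] := eqVneq (wact_dual u (al i)) (al k).
  by exists s => //; rewrite (conj_simple ak) mulKl.
have rra : real_root D (wact_dual u (al i)) by exists u, i.
have pos' := srefl_pos rra pos ak; rewrite -wact_dualM in pos' neg.
have [s' ss' E] := IH _ pos' neg; exists (k :: s') => //.
by rewrite weyl_word_cons E invgM sreflV !mulgA sreflK mul1g.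
Qed.

Lemma strong_exchange x u i : ncone al (wact_dual u (al i)) ->
  ncone al (- wact_dual x^-1%g (wact_dual u (al i))) ->
  (len (u * rs i * u^-1 * x)%g < len x)%N.
Proof.
have [s <- <-] := len_wordP x => pos neg.
have [s' ss' <-] := exchange pos neg.
exact: leq_ltn_trans (len_word _) ss'.
Qed.

(** The height with respect to the simple coroots. *)
Definition cht (v : V) : R := \sum_i fcoord av i v.

Lemma chtD (u v : V) : cht (u + v) = cht u + cht v.
Proof. by rewrite /cht -big_split; apply: eq_bigr => i _; rewrite fcoordD. Qed.
Lemma chtZ k v : cht (k *: v) = k * cht v.
Proof. by rewrite /cht mulr_sumr; apply: eq_bigr => i _; rewrite fcoordZ. Qed.
Lemma chtN v : cht (- v) = - cht v.
Proof. by rewrite -scaleN1r chtZ mulN1r. Qed.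
Lemma cht_ncone (n : I -> nat) : cht (\sum_j av j *+ n j) = (\sum_j n j)%:R.
Proof.
rewrite natr_sum; apply: eq_bigr => i _.
by rewrite fcoord_ncone //; exact: (scoroot_free D).
Qed.
Lemma cht_gen i : cht (av i) = 1.
Proof.
have free_av := scoroot_free D.
rewrite /cht (bigD1 i) //= fcoord_gen // eqxx big1 ?addr0 // => j ji.
by rewrite fcoord_gen // eq_sym (negbTE ji).
Qed.
Lemma cht_pos v : ncone av v -> exists n : nat, cht v = n%:R.
Proof. by move=> [n ->]; exists (\sum_i n i)%N; rewrite cht_ncone. Qed.

(** Some simple reflection lowers the height of [a^vee], because [a(a^vee) > 0] and
    [a] is a nonnegative combination of simple roots. *)
Lemma root_depth (n : nat) a : real_root D a -> ncone al a -> cht (coroot D a) = n%:R ->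
  exists s i, (size s < n)%N /\ a = wact_dual (word s) (al i).
Proof.
elim/ltn_ind: n a => n IH a ra pos an.
have [[k ak]|nk] := pselect (exists k, a = al k).
  exists [::], k; rewrite weyl_word0 wact_dual1; split=> //=.
  move: an; rewrite ak coroot_simple cht_gen; case: n {IH} => // /eqP.
  by rewrite oner_eq0.
have [k ak] : exists k, 0 < ev (al k) (coroot D a).
  apply: contrapT => /forallNP N; have := ev_coroot ra; have [m am] := pos; rewrite {1}am.
  move=> /eqP; rewrite ev_suml eq_le => /andP[_]; rewrite leNgt => /negP; apply.
  apply: le_lt_trans (ltr0n _ 2); apply: sumr_le0 => i _.
  by rewrite evMnl; apply: mulrn_wle0; rewrite leNgt; apply/negP; exact: N.
have ra' := real_root_act (rs k) ra.
have pos' : ncone al (wact_dual (rs k) a).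
  by apply: srefl_pos => // E; apply: nk; exists k.
have [m mE] := cht_pos (coroot_pos ra' pos').
have mn : (m < n)%N.
  rewrite -(ltr_nat R) -mE -an coroot_act // sreflE chtD chtN chtZ cht_gen mulr1.
  by lra.
have [s [i [sm E]]] := IH m mn _ ra' pos' mE.
exists (k :: s), i; split; first by rewrite /=; lia.
by rewrite weyl_word_cons wact_dualM -E -{1}(sreflV k) wact_dualK.
Qed.

(** Conjugate a simple reflection by the word of [root_depth]. *)
Lemma len_reflection (n : nat) u i : ncone al (wact_dual u (al i)) ->
  cht (wact u (av i)) = n%:R -> (len (u * rs i * u^-1)%g < n.*2)%N.
Proof.
move=> pos; rewrite -coroot_act_simple => an.
have [|s [j [sn E]]] := root_depth _ pos an; first by exists u, i.
have /conj_simple : wact_dual ((word s)^-1 * u)%g (al i) = al j.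
  by rewrite wact_dualM E wact_dualK.
rewrite invgM invgK => sj.
have -> : (u * rs i * u^-1 = word s * rs j * (word s)^-1)%g.
  by rewrite -sj !mulgA mulgV mul1g mulgK.
have := lenM (word s * rs j)%g (word s)^-1%g; have := lenMr (word s) j.
have := len_word (D := D) s; rewrite lenV -addnn; lia.
Qed.

Lemma left_descent i w : (len (rs i * w)%g < len w)%N ->
  ncone al (- wact_dual w^-1%g (al i)).
Proof.
rewrite -(lenV w) -lenV invgM sreflV => /descent_neg[].
by [].
Qed.
Lemma neg_left_descent i w : ncone al (- wact_dual w^-1%g (al i)) ->
  (len (rs i * w)%g < len w)%N.
Proof. by move=> /neg_descent; rewrite -lenV invgM invgK sreflV -(lenV w). Qed.
Lemma pos_left_ascent i w : ncone al (wact_dual w^-1%g (al i)) ->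
  (len w < len (rs i * w)%g)%N.
Proof. by move=> /pos_ascent; rewrite lenV -[X in (_ < X)%N]lenV invgM invgK sreflV. Qed.
Lemma left_ascent i w : (len w <= len (rs i * w)%g)%N ->
  ncone al (wact_dual w^-1%g (al i)).
Proof.
move=> le; have [//|neg] := root_sign (real_root_act w^-1%g (real_root_simple i)).
by have := neg_left_descent neg; rewrite ltnNge le.
Qed.
End RealRoots.

(** * Reduced words and the parameters sigma *)
Section Matsumoto.
Context {R : realType} {V : vectType R} {I : finType} {D : rootDatum V I}.
Local Notation al := (sroot D).
Local Notation W := (weyl D).
Local Notation len := (@weyl_length R V I D).
Local Notation rs := (srefl D).
Local Notation word := (weyl_word D).
Implicit Types (u w x : W) (v : V) (a b : 'Hom(V, R^o)) (s t : seq I).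
Local Notation cart := (@cartan R V I D).
Local Notation cox i j := (cox_order (cart i j * cart j i)).

Lemma rev_alt (i j : I) k : rev (alt i j k) = if odd k then alt i j k else alt j i k.
Proof.
elim: k => // k IH; rewrite [in LHS]alt_rcons rev_rcons IH /=.
by case: (odd k).
Qed.

Lemma alt_next_pos i j k : i <> j ->
  (4 <= cart i j * cart j i)%N \/ (k < cox i j)%N ->
  exists m n, wact_dual (word (alt i j k)) (al (if odd k then j else i)) =
    al i *+ m + al j *+ n.
Proof.
move=> ij pqk; have := rev_alt j i k; have := rev_alt i j k.
case: (odd k) => E E'.
  rewrite mulnC in pqk.
  have [m [n [_ [_ [H _]]]]] := alt_root_pos (nesym ij) pqk.
  by exists n, m; rewrite -E H addrC.
have [m [n [_ [_ [H _]]]]] := alt_root_pos ij pqk.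
by exists m, n; rewrite -E' H.
Qed.

(** As long as the alternating word is short, the next root is a nonnegative
    combination of [alpha_i] and [alpha_j], both of which [w^-1] makes negative;
    so the rest of [w] still shortens by the next letter. *)
Lemma dihedral_strip w i j k : i <> j ->
  (len (rs i * w)%g < len w)%N -> (len (rs j * w)%g < len w)%N ->
  (4 <= cart i j * cart j i)%N \/ (k <= cox i j)%N ->
  exists2 x, w = (word (alt i j k) * x)%g & len w = (k + len x)%N.
Proof.
move=> ij /left_descent wi /left_descent wj.
elim: k => [|k IH] pqk; first by exists w; rewrite ?weyl_word0 ?mul1g.
have [|x wx lx] := IH; first by case: pqk => H; [left|right; lia].
have [m [n E]] := alt_next_pos ij pqk.
set y := if odd k then j else i in E.
have xy : (len (rs y * x)%g < len x)%N.
  apply: neg_left_descent.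
  have -> : x^-1%g = (w^-1 * word (alt i j k))%g by rewrite wx invgM mulgVK.
  rewrite wact_dualM E raddfD !raddfMn /= opprD -!mulNrn.
  by apply: nconeD; apply: nconeMn.
exists (rs y * x)%g.
  by rewrite alt_rcons weyl_word_rcons -/y -mulgA mulKl.
have : (len x <= (len (rs y * x)%g).+1)%N.
  rewrite -(lenV x) -(lenV (rs y * x)%g) invgM sreflV; exact: len_leMr.
by rewrite lx; lia.
Qed.

Lemma two_descents_finite w i j : i <> j ->
  (len (rs i * w)%g < len w)%N -> (len (rs j * w)%g < len w)%N ->
  (cart i j * cart j i < 4)%N.
Proof.
move=> ij wi wj; rewrite ltnNge; apply/negP => pq.
have [|x _] := @dihedral_strip w i j (len w).+1 ij wi wj; first by left.
by lia.
Qed.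

(** The braid relations, for the pairs [i, j] such that [r_i r_j] has finite order. *)
Definition braided (M : pzRingType) (f : I -> M) := forall i j, i <> j ->
  (cart i j * cart j i < 4)%N ->
  \prod_(l <- alt i j (cox i j)) f l = \prod_(l <- alt j i (cox i j)) f l.

Lemma reduced_tail i s : reduced D (i :: s) -> reduced D s.
Proof.
rewrite /reduced weyl_word_cons /= => E; apply/eqP; rewrite eqn_leq len_word andbT.
by have := lenM (rs i) (word s); have := len_srefl (D := D) i; rewrite -E; lia.
Qed.

Lemma reduced_head i s : reduced D (i :: s) ->
  (len (rs i * word (i :: s))%g < len (word (i :: s)))%N.
Proof.
rewrite /reduced => <-; rewrite weyl_word_cons mulKl /= ltnS; exact: len_word.
Qed.

(** If the first letters [i] and [j] differ, the element shortens by both, hence it has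
    two reduced words that start with the two full alternating words in [i] and
    [j] and agree afterwards; compare each given word with one of these by
    induction, and use the braid relation. *)
Theorem matsumoto (M : pzRingType) (f : I -> M) s t : braided f ->
  reduced D s -> reduced D t -> word s = word t ->
  \prod_(l <- s) f l = \prod_(l <- t) f l.
Proof.
move=> fbraid; have [n] := ubnP (size s); elim: n s t => // n IH s t sn rds rdt st.
have sst : size s = size t by rewrite rds rdt st.
case: s t sn rds rdt st sst => [|i s] [|j t] // sn rds rdt st sst.
have [ij|/eqP ij] := eqVneq i j.
  rewrite -ij !big_cons in st rdt *; congr (_ * _).
  apply: IH; [by []|exact: reduced_tail rds|exact: reduced_tail rdt|].
  by move: st; rewrite !weyl_word_cons => /mulgI.
have wi := reduced_head rds; have wj := reduced_head rdt; rewrite -st in wj.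
have pq := two_descents_finite ij wi wj.
have m0 : (0 < cox i j)%N by case: (_ * _)%N pq => [|[|[|[|m]]]].
have [|x wx lx] := dihedral_strip (k := cox i j) ij wi wj; first by right.
have [xs sxs xsx] := len_wordP x.
have red_ij i' j' l w : alt i' j' (cox i j) = i' :: alt j' i' (cox i j).-1 ->
    reduced D (i' :: l) -> (size l < n)%N -> word (i' :: l) = word (i :: s) ->
    word (alt i' j' (cox i j)) = word (alt i j (cox i j)) ->
    \prod_(h <- i' :: l) f h = \prod_(h <- alt i' j' (cox i j)) f h * \prod_(h <- xs) f h.
  move=> E rdl ln ww EE; rewrite big_cons -big_cat /= E /= big_cons; congr (_ * _).
  have wl : word l = word (alt j' i' (cox i j).-1 ++ xs).
    apply: (mulgI (rs i')); rewrite -weyl_word_cons ww wx -EE E.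
    by rewrite !weyl_word_cons weyl_word_cat xsx mulgA.
  apply: IH => //; first exact: reduced_tail rdl.
  rewrite /reduced -wl -(reduced_tail rdl) size_cat size_alt sxs.
  by move: (rdl); rewrite /reduced ww lx /=; lia.
have altS i' j' : alt i' j' (cox i j) = i' :: alt j' i' (cox i j).-1.
  by rewrite -{1}(prednK m0).
rewrite (red_ij i j s 1%g) // (red_ij j i t 1%g) //; last exact/esym/weyl_braid.
  by rewrite fbraid.
by move: sn; rewrite sst.
Qed.

(** [u r_i = r_j u] gives two reduced words of the same element, and all letters but
    one cancel in a commutative ring. This makes the parameters of a root well
    defined. *)
Lemma braided_root_inv (A : idomainType) (f : I -> A) u i j : braided f ->
  (forall k, f k != 0) -> wact_dual u (al i) = al j -> f i = f j.
Proof.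
move=> bf f0 uij; have [s su sE] := len_wordP u.
have H : (len u < len (u * rs i)%g)%N.
  by apply: pos_ascent; rewrite uij; exact: ncone_gen.
have lu : len (u * rs i)%g = (len u).+1 by have := lenMr u i; lia.
have ru : (u * rs i = rs j * u)%g by rewrite -(conj_simple uij) mulgVK.
have : \prod_(l <- rcons s i) f l = \prod_(l <- j :: s) f l.
  by apply: matsumoto; rewrite // /reduced ?weyl_word_rcons ?weyl_word_cons ?size_rcons
    /= ?sE ?su -?ru ?lu.
rewrite big_cons -cats1 big_cat big_cons big_nil /= mulr1 mulrC.
by apply: mulIf; rewrite prodf_seq_neq0; apply/allP => k _; exact: f0.
Qed.
End Matsumoto.

Section SigmaParameters.
Context {R : realType} {V : vectType R} {I : finType} {D : rootDatum V I}.
Variable Y : lattice D.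
Local Notation al := (sroot D).
Local Notation av := (scoroot D).
Local Notation cart := (@cartan R V I D).

Lemma sigma_class_eq x y : sigma_eq Y x y -> sigma_classof Y x = sigma_classof Y y.
Proof.
move=> xy; apply: val_inj => /=; apply/eqP.
by rewrite (root_connect (sym_connect_sym (sigma_eq_sym Y))) connect1.
Qed.

Lemma indet_unit (J : finType) (j : J) : (indet j : laurent J) \is a GRing.unit.
Proof.
apply/unitrPr; exists (gmono 1 (- [ffun k => (k == j)%:Z])).
apply: galgP => x; rewrite gcoefM conv_mono /= mul1r /mono subr_eq addNr.
by [].
Qed.

Lemma sigma_unit i : sigma Y i \is a GRing.unit. Proof. exact: indet_unit. Qed.
Lemma sigma'_unit i : sigma' Y i \is a GRing.unit. Proof. exact: indet_unit. Qed.
Lemma sigma_neq0 i : sigma Y i != 0.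
Proof. by apply: contraTneq (sigma_unit i) => ->; rewrite unitr0. Qed.
Lemma sigma'_neq0 i : sigma' Y i != 0.
Proof. by apply: contraTneq (sigma'_unit i) => ->; rewrite unitr0. Qed.

Lemma sigma_A2 i j : i <> j -> cart i j = 1%N -> cart j i = 1%N ->
  [/\ sigma Y i = sigma Y j, sigma Y i = sigma' Y i & sigma' Y i = sigma' Y j].
Proof.
move=> ij cij cji.
have E1 : sroot D i (scoroot D j) == -1 by have := cartanE (D := D) ij; rewrite cij => /eqP.
have E2 : sroot D j (scoroot D i) == -1.
  by have := cartanE (D := D) (nesym ij); rewrite cji => /eqP.
have H (x y : I + I) : (sigma_index x == i) -> (sigma_index y == j) -> sigma_eq Y x y.
  by move=> /eqP xi /eqP yj; rewrite /sigma_eq xi yj E1 E2 orbT.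
rewrite /sigma /sigma'; split.
- by rewrite (@sigma_class_eq (inl i) (inl j)) // H /=.
- rewrite (@sigma_class_eq (inl i) (inl j)) ?H //=.
  by rewrite (@sigma_class_eq (inr i) (inl j)) ?H //=.
- by rewrite (@sigma_class_eq (inr i) (inr j)) // H /=.
Qed.

(** The value -1 forces [alpha_i(Y)] to be all of Z. *)
Lemma sigma_eq_odd i v : v \in Y -> ev (al i) v = -1 -> sigma Y i = sigma' Y i.
Proof.
move=> vY ev1; rewrite /sigma /sigma'; congr indet; apply: sigma_class_eq.
rewrite /sigma_eq /= eqxx /=; apply/orP; left; apply/asboolP/seteqP; split => x.
  move=> [y /= yY <-].
  have [z zE] := intrP (lat_root (real_root_simple i) yY).
  by exists z.
move=> [z _ <-]; exists (- (v *~ z)) => /=; first by rewrite rpredN rpredMz.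
by rewrite -/(ev _ _) evN -scaler_int evZ ev1 mulrN1 opprK.
Qed.

Lemma av_Y i : av i \in Y.
Proof.
apply: lat_coroot; exists (fun j => (j == i)%:Z).
by rewrite (bigD1 i) //= eqxx mulr1z big1 ?addr0 // => j /negbTE ->; rewrite mulr0z.
Qed.

Lemma cartan_sigma i j : i <> j -> cart i j = 1%N -> sigma Y i = sigma' Y i.
Proof. by move=> ij c1; apply: (sigma_eq_odd (av_Y j)); rewrite cartanE // c1. Qed.
Lemma cartan_sigma3 i j : i <> j -> cart i j = 3%N -> sigma Y i = sigma' Y i.
Proof.
(* [alpha_i] takes the values 2 and -3 on the two coroots. *)
move=> ij c3; apply: (@sigma_eq_odd i (av i + av j)).
  by rewrite rpredD ?av_Y.
by rewrite evD cartan_diag cartanE // c3; lra.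
Qed.

Lemma cartan_small i j : i <> j -> (cart i j * cart j i < 4)%N ->
  [\/ cart i j = 0%N /\ cart j i = 0%N, cart i j = 1%N /\ cart j i = 1%N,
      (cart i j = 1%N /\ cart j i = 2%N) \/ (cart i j = 2%N /\ cart j i = 1%N)
    | (cart i j = 1%N /\ cart j i = 3%N) \/ (cart i j = 3%N /\ cart j i = 1%N)].
Proof.
move=> ij; have := cartan_eq0P (D := D) ij; case: (cart i j) (cart j i) => [|[|[|[|p]]]].
- by move=> q [/(_ erefl) -> _ _]; constructor 1.
- move=> [|[|[|[|q]]]] // [h1 h2] _; first (by have := h2 erefl);
    by [constructor 2|constructor 3; left|constructor 4; left].
- move=> [|[|q]] [h1 h2] //; first (by have := h2 erefl); first by constructor 3; right.
  by lia.
- move=> [|[|q]] [h1 h2] //; first (by have := h2 erefl); first by constructor 4; right.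
  by lia.
- move=> [|q] [h1 h2]; first (by have := h2 erefl); by lia.
Qed.

Lemma sigma_braided_gen (s : I -> Zsigma Y) :
  (forall i j, i <> j -> cart i j = 1%N -> cart j i = 1%N -> s i = s j) -> braided (D := D) s.
Proof.
move=> s11 i j ij /(cartan_small ij)[[p q]|[p q]|[[p q]|[p q]]|[[p q]|[p q]]];
  rewrite p q /cox_order /= !big_cons !big_nil; try ring.
by rewrite (s11 i j).
Qed.

Lemma sigma_braided : braided (D := D) (sigma Y).
Proof. by apply: sigma_braided_gen => i j ij p q; have [] := sigma_A2 ij p q. Qed.
Lemma sigma'_braided : braided (D := D) (sigma' Y).
Proof. by apply: sigma_braided_gen => i j ij p q; have [] := sigma_A2 ij p q. Qed.

Lemma sigma_root_act (w : weyl D) i : sigma_root Y (wact_dual w (al i)) = sigma Y i.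
Proof.
rewrite /sigma_root; case: xgetP => [_ -> [w' [j [E ->]]]|/(_ (sigma Y i))]; last first.
  by case; exists w, i.
apply: (braided_root_inv (u := (w^-1 * w')%g)); first exact: sigma_braided.
  exact: sigma_neq0.
by rewrite wact_dualM -E wact_dualK.
Qed.

Lemma sigma'_root_act (w : weyl D) i : sigma'_root Y (wact_dual w (al i)) = sigma' Y i.
Proof.
rewrite /sigma'_root; case: xgetP => [_ -> [w' [j [E ->]]]|/(_ (sigma' Y i))]; last first.
  by case; exists w, i.
apply: (braided_root_inv (u := (w^-1 * w')%g)); first exact: sigma'_braided.
  exact: sigma'_neq0.
by rewrite wact_dualM -E wact_dualK.
Qed.

Lemma wact_Y (w : weyl D) v : v \in Y -> wact w v \in Y.
Proof.
move=> vY; have [s <-] := weyl_word_ex w; elim: s => [|i s IH].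
  by rewrite weyl_word0 wact1.
rewrite weyl_word_cons wactM sreflE rpredB //.
have [z] := intrP (lat_root (real_root_simple i) IH).
by rewrite -/(ev _ _) => ->; rewrite scaler_int rpredMz ?av_Y.
Qed.
End SigmaParameters.

(** * The field of fractions and its expansions *)
Local Open Scope quotient_scope.
Lemma tofrac_repr (A : idomainType) (f : {fraction A}) :
  f = FracField.tofrac \n_(repr f) / FracField.tofrac \d_(repr f).
Proof.
set x := repr f; have d0 : \d_x != 0 := denom_ratioP x.
apply: (canRL (mulfK _)); first by rewrite tofrac_eq0.
rewrite -{1}[f]reprK -/x; unlock FracField.tofrac; rewrite -[LHS]FracField.pi_mul.
apply/eqmodP => /=.
rewrite FracField.equivfE /FracField.mulf !numden_Ratio ?mulr1 ?oner_neq0 //.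
by rewrite mulrC.
Qed.
Local Close Scope quotient_scope.

Lemma gmonoM (A : comNzRingType) (G : zmodType) (a b : A) (x y : G) :
  gmono a x * gmono b y = gmono (a * b) (x + y).
Proof.
apply: galgP => z; rewrite gcoefM conv_mono /= /mono mulrnAr.
by rewrite subr_eq (addrC y).
Qed.

Lemma tofrac_div_eq (A : idomainType) (p q p' q' : A) : q != 0 -> q' != 0 ->
  FracField.tofrac p / FracField.tofrac q = FracField.tofrac p' / FracField.tofrac q' ->
  p * q' = p' * q.
Proof.
move=> q0 q'0 /eqP; rewrite eqr_div ?tofrac_eq0 // -!tofracM tofrac_eq.
by move/eqP.
Qed.

Section FractionAction.
Context {R : realType} {V : vectType R} {I : finType} {D : rootDatum V I}.
Variable Y : lattice D.
Local Notation W := (weyl D).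
Local Notation Z := (Zsigma Y).
Local Notation K := (fracV Y).
Local Notation frac := (@FracField.tofrac (galgV Y)).
Implicit Types (u w : W) (p q : galgV Y) (f g : K) (v : V).

Lemma galg_actE w p v : galg_act w p v = p (wact w^-1%g v).
Proof. by []. Qed.

Lemma galg_act_mono w a v : galg_act w (gmono a v : galgV Y) = gmono a (wact w v).
Proof.
apply: galgP => x; rewrite galg_actE /= /mono.
by rewrite -(can2_eq (wactVK w) (wactK w)).
Qed.

Fact galg_act_zmod w : zmod_morphism (@galg_act R V I D Y w).
Proof. by move=> p q; apply: galgP. Qed.
Fact galg_act_monoid w : monoid_morphism (@galg_act R V I D Y w).
Proof.
split=> [|p q]; first by rewrite [LHS]galg_act_mono raddf0.
apply: galgP => x; rewrite galg_actE !gcoefM /conv.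
rewrite (@reindex_fsbigT _ _ _ _ _ (wact w^-1%g)); last first.
  by exists (wact w) => y; rewrite ?wactK ?wactVK.
by apply: eq_fsbigr => y _; rewrite -raddfB.
Qed.
HB.instance Definition _ w := GRing.isZmodMorphism.Build (galgV Y) (galgV Y)
  (@galg_act R V I D Y w) (galg_act_zmod w).
HB.instance Definition _ w := GRing.isMonoidMorphism.Build (galgV Y) (galgV Y)
  (@galg_act R V I D Y w) (galg_act_monoid w).

Lemma galg_actM u w p : galg_act (u * w)%g p = galg_act u (galg_act w p).
Proof. by apply: galgP => x; rewrite !galg_actE invgM wactM. Qed.
Lemma galg_act1 p : galg_act 1%g p = p.
Proof. by apply: galgP => x; rewrite galg_actE invg1 wact1. Qed.
Lemma galg_act_eq0 w p : (galg_act w p == 0) = (p == 0).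
Proof.
apply/eqP/eqP => [p0|->]; last exact: raddf0.
by rewrite -(galg_act1 p) -(mulVg w) galg_actM p0 raddf0.
Qed.

(** The action is defined through the representatives of a fraction; here any
    numerator and denominator will do. *)
Lemma frac_act_div w p q : q != 0 ->
  frac_act w (frac p / frac q) = frac (galg_act w p) / frac (galg_act w q).
Proof.
move=> q0; rewrite /frac_act; set f := frac p / frac q.
have d0 : \d_(repr f) != 0 := denom_ratioP (repr f).
have := tofrac_repr f; rewrite {1}/f => /(tofrac_div_eq q0 d0) /(congr1 (galg_act w)).
rewrite !rmorphM /= => E.
by apply/eqP; rewrite eqr_div ?tofrac_eq0 ?galg_act_eq0 // -!tofracM E.
Qed.

Lemma fracP f : exists p q, q != 0 /\ f = frac p / frac q.
Proof.
by exists \n_(repr f), \d_(repr f); split; [exact: denom_ratioP|exact: tofrac_repr].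
Qed.

Lemma frac_act_tofrac w p : frac_act w (frac p) = frac (galg_act w p).
Proof.
have := @frac_act_div w p 1 (oner_neq0 _).
by rewrite !rmorph1 !divr1.
Qed.

Fact frac_act_zmod w : zmod_morphism (@frac_act R V I D Y w).
Proof.
move=> f g; have [p [q [q0 ->]]] := fracP f; have [p' [q' [q'0 ->]]] := fracP g.
have E (a b c d : galgV Y) : b != 0 -> d != 0 ->
    frac a / frac b - frac c / frac d = frac (a * d - c * b) / frac (b * d).
  move=> b0 d0; rewrite -mulNr -rmorphN addf_div ?tofrac_eq0 //.
  by rewrite -!rmorphM -rmorphD mulNr.
rewrite E // !frac_act_div ?mulf_neq0 // E ?galg_act_eq0 //.
by congr (frac _ / frac _); rewrite ?(rmorphB (@galg_act R V I D Y w)) !(rmorphM (@galg_act R V I D Y w)).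
Qed.
Fact frac_act_monoid w : monoid_morphism (@frac_act R V I D Y w).
Proof.
split=> [|f g]; first by rewrite -[X in frac_act w X](rmorph1 frac) frac_act_tofrac !rmorph1.
have [p [q [q0 ->]]] := fracP f; have [p' [q' [q'0 ->]]] := fracP g.
have E (a b c d : galgV Y) :
    (frac a / frac b) * (frac c / frac d) = frac (a * c) / frac (b * d).
  by rewrite mulf_div !rmorphM.
by rewrite E !frac_act_div ?mulf_neq0 // E !(rmorphM (@galg_act R V I D Y w)).
Qed.
HB.instance Definition _ w := GRing.isZmodMorphism.Build K K
  (@frac_act R V I D Y w) (frac_act_zmod w).
HB.instance Definition _ w := GRing.isMonoidMorphism.Build K K
  (@frac_act R V I D Y w) (frac_act_monoid w).

Lemma frac_actM u w f : frac_act (u * w)%g f = frac_act u (frac_act w f).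
Proof.
have [p [q [q0 ->]]] := fracP f.
by rewrite !frac_act_div ?galg_act_eq0 // !galg_actM.
Qed.
Lemma frac_act1 f : frac_act 1%g f = f.
Proof.
by have [p [q [q0 ->]]] := fracP f; rewrite !frac_act_div // !galg_act1.
Qed.
Lemma frac_actVK w : cancel (@frac_act R V I D Y w^-1%g) (frac_act w).
Proof. by move=> f; rewrite -frac_actM mulgV frac_act1. Qed.

Fact const_frac_zmod : zmod_morphism (const_frac (Y := Y)).
Proof.
move=> a b; rewrite /const_frac -rmorphB; congr frac; apply: galgP => x /=.
by rewrite /mono mulrnBl.
Qed.
Fact const_frac_monoid : monoid_morphism (const_frac (Y := Y)).
Proof.
split=> [|a b]; first exact: tofrac1.
by rewrite /const_frac -rmorphM; congr frac; rewrite [RHS]gmonoM addr0.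
Qed.
HB.instance Definition _ := GRing.isZmodMorphism.Build Z K
  (const_frac (Y := Y)) const_frac_zmod.
HB.instance Definition _ := GRing.isMonoidMorphism.Build Z K
  (const_frac (Y := Y)) const_frac_monoid.

Lemma frac_act_const w a : frac_act w (const_frac (Y := Y) a) = const_frac a.
Proof. by rewrite /const_frac frac_act_tofrac galg_act_mono raddf0. Qed.
Lemma const_frac_eq0 a : (const_frac (Y := Y) a == 0) = (a == 0).
Proof.
rewrite /const_frac tofrac_eq0; apply/eqP/eqP => [|->].
  move=> /(congr1 (fun p : galgV Y => p 0)); rewrite gcoef0 /= /mono eqxx.
  by [].
exact: galgP.
Qed.

Lemma expoD (u v : V) : expo Y (u + v) = expo Y u * expo Y v.
Proof. by rewrite /expo -rmorphM; congr frac; rewrite [RHS]gmonoM mulr1. Qed.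
Lemma expo0 : expo Y 0 = 1. Proof. exact: tofrac1. Qed.
Lemma expoN v : expo Y (- v) = (expo Y v)^-1.
Proof.
have H : expo Y v * expo Y (- v) = 1 by rewrite -expoD subrr expo0.
have v0 : expo Y v != 0.
  by apply/eqP => E; move: H; rewrite E mul0r => /eqP; rewrite eq_sym oner_eq0.
by apply: (mulfI v0); rewrite H mulfV.
Qed.
Lemma expo_neq0 v : expo Y v != 0.
Proof.
have H : expo Y v * expo Y (- v) = 1 by rewrite -expoD subrr expo0.
by apply/eqP => E; move: H; rewrite E mul0r => /eqP; rewrite eq_sym oner_eq0.
Qed.
Lemma expoMn v n : expo Y (v *+ n) = expo Y v ^+ n.
Proof. by elim: n => [|n IH]; rewrite ?expo0 // mulrS expoD IH exprS. Qed.
Lemma expo_inj : injective (expo Y).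
Proof.
move=> u v /eqP; rewrite /expo tofrac_eq => /eqP.
move=> /(congr1 (fun p : galgV Y => p u)); rewrite /= /mono eqxx.
by case: eqP => // _ /eqP; rewrite oner_eq0.
Qed.
Lemma frac_act_expo w v : frac_act w (expo Y v) = expo Y (wact w v).
Proof. by rewrite /expo frac_act_tofrac galg_act_mono. Qed.
End FractionAction.

Section Expansions.
Context {R : realType} {V : vectType R} {I : finType} {D : rootDatum V I}.
Variable Y : lattice D.
Local Notation av := (scoroot D).
Local Notation W := (weyl D).
Local Notation Z := (Zsigma Y).
Local Notation K := (fracV Y).
Implicit Types (u w : W) (p q : galgV Y) (f g : K) (v x y : V) (k l : nat).

Fact cht_zmod : zmod_morphism (@cht R V I D).
Proof. by move=> x y; rewrite chtD chtN. Qed.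
HB.instance Definition _ := GRing.isZmodMorphism.Build V R (@cht R V I D) cht_zmod.

(** The series of all chambers live in this ring, after transport to the fundamental
    chamber; it contains the series supported in finitely many translates of the
    opposite of the monoid of coroots. *)
Definition series := nov Z (@cht R V I D : {additive V -> R}).
HB.instance Definition _ := GRing.ComNzRing.on series.
Implicit Types X T : series.

Definition iota p : series := nov_of_galg _ (p : galg Z V).

Lemma iotaM p q : iota (p * q) = iota p * iota q. Proof. exact: novP. Qed.
Lemma iotaD p q : iota (p + q) = iota p + iota q. Proof. exact: novP. Qed.
Lemma iota1 : iota 1 = 1. Proof. exact: novP. Qed.
Lemma iota0 : iota 0 = 0. Proof. exact: novP. Qed.

Definition cone_ge k : set V :=
  [set v | exists n : I -> nat, v = \sum_i av i *+ n i /\ (k <= \sum_i n i)%N].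

Lemma cone_ge_le k l v : (k <= l)%N -> cone_ge l v -> cone_ge k v.
Proof. by move=> kl [n [-> ln]]; exists n; split=> //; lia. Qed.
Lemma cone_geD k l x y : cone_ge k x -> cone_ge l y -> cone_ge (k + l) (x + y).
Proof.
move=> [n [-> kn]] [m [-> lm]]; exists (fun i => (n i + m i)%N); split.
  by rewrite -big_split; apply: eq_bigr => i _; rewrite mulrnDr.
by rewrite big_split leq_add.
Qed.
Lemma cone_ge0 : cone_ge 0 0.
Proof. by exists (fun _ => 0%N); rewrite big1. Qed.
Lemma cone_ge_cht k v : cone_ge k v -> (k%:R <= cht (D := D) v).
Proof. by move=> [n [-> kn]]; rewrite cht_ncone ler_nat. Qed.
Lemma cone_ge_coroot k v : ncone av v -> cht (D := D) v = k%:R -> cone_ge k v.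
Proof.
move=> [n ->]; rewrite cht_ncone => /eqP; rewrite eqr_nat => /eqP <-.
by exists n.
Qed.
Lemma cone_ge_Y k v : cone_ge k v -> v \in Y.
Proof.
by move=> [n [-> _]]; apply: rpred_sum => i _; rewrite rpredMn // av_Y.
Qed.

(** The filtration that defines convergence in the fundamental chamber, where series
    are made of terms [e^(- q)] with [q] in the monoid of coroots. *)
Definition fil k : set series := [set X | forall y, X y <> 0 -> cone_ge k (- y)].

Lemma fil_le k l X : (k <= l)%N -> fil l X -> fil k X.
Proof. by move=> kl lX y /lX; exact: cone_ge_le. Qed.
Lemma fil0 k : fil k 0.
Proof. by move=> y; rewrite ncoef0. Qed.
Lemma filD k X T : fil k X -> fil k T -> fil k (X + T).
Proof.
move=> kX kT y; rewrite ncoefD => XT.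
have [X0|/eqP/kX //] := eqVneq (X y) 0.
by apply: kT => T0; apply: XT; rewrite X0 T0 addr0.
Qed.
Lemma filN k X : fil k X -> fil k (- X).
Proof. by move=> kX y; rewrite ncoefN => Xy; apply: kX => X0; apply: Xy; rewrite X0 oppr0. Qed.
Lemma filB k X T : fil k X -> fil k T -> fil k (X - T).
Proof. by move=> kX kT; apply: filD => //; apply: filN. Qed.
Lemma filM k l X T : fil k X -> fil l T -> fil (k + l) (X * T).
Proof.
move=> kX lT y; rewrite ncoefM => /conv_supp[x [/kX Xx /lT Ty]].
have := cone_geD Xx Ty; rewrite -opprD; congr (cone_ge _ (- _)).
by rewrite addrC subrK.
Qed.
Lemma filMl k X T : fil k X -> fil 0 T -> fil k (X * T).
Proof. by rewrite -{2}(addn0 k); exact: filM. Qed.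
Lemma fil_mono k a v : cone_ge k v -> fil k (nmono _ a (- v)).
Proof.
move=> kv y; rewrite /= /mono; case: eqP => [->|]; first by rewrite opprK.
by rewrite mulr0n.
Qed.
Lemma fil_const a : fil 0 (nmono _ a 0).
Proof. by rewrite -oppr0; apply: fil_mono; exact: cone_ge0. Qed.
Lemma fil1 : fil 0 1. Proof. exact: fil_const. Qed.
Lemma fil_sum k (J : Type) (r : seq J) (P : pred J) (F : J -> series) :
  (forall j, P j -> fil k (F j)) -> fil k (\sum_(j <- r | P j) F j).
Proof. by move=> H; apply: big_ind => //; [exact: fil0|exact: filD]. Qed.
Lemma filX k X n : fil k X -> fil (n * k) (X ^+ n).
Proof.
by move=> kX; elim: n => [|n IH]; rewrite ?exprS ?mulSn; [exact: fil1|exact: filM].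
Qed.
Lemma filX0 X n : fil 0 X -> fil 0 (X ^+ n).
Proof. by move=> /(@filX 0 _ n); rewrite muln0. Qed.

Lemma nat_bound (c : R) : exists k : nat, c < k%:R.
Proof.
exists (Num.bound `|c|); apply: le_lt_trans (ler_norm c) _.
by apply: archi_boundP; exact: normr_ge0.
Qed.

Lemma fil_high k X y : fil k X -> - cht (D := D) y < k%:R -> X y = 0.
Proof.
move=> kX hy; apply: contrapT => /kX /cone_ge_cht; rewrite chtN leNgt.
by rewrite hy.
Qed.

Lemma fil_eq0 X : (forall k, fil k X) -> X = 0.
Proof.
move=> H; apply: novP => y; rewrite ncoef0.
have [k ky] := nat_bound (- cht (D := D) y).
exact: fil_high (H k) ky.
Qed.
End Expansions.

(** * Limits of series and expansions *)
Section SeriesLimits.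
Context {R : realType} {V : vectType R} {I : finType} {D : rootDatum V I}.
Variable Y : lattice D.
Local Notation av := (scoroot D).
Local Notation W := (weyl D).
Local Notation Z := (Zsigma Y).
Local Notation K := (fracV Y).
Local Notation S := (series Y).
Local Notation frac := (@FracField.tofrac (galgV Y)).
Local Notation ht := (@cht R V I D).
Implicit Types (u w : W) (p q : galgV Y) (f g : K) (v x y : V) (k l : nat) (X T : S).

Lemma finite_cone (c : R) : finite_set [set v | cone_ge (D := D) 0 v /\ ht v <= c].
Proof.
have [N cN] := nat_bound c.
pose F (n : {ffun I -> 'I_N}) := \sum_i av i *+ n i.
apply: sub_finite_set (_ : finite_set (F @` [set: {ffun I -> 'I_N}])); last first.
  by apply: finite_image; exact: finite_finset.
move=> v [[n [-> _]]]; rewrite cht_ncone => nc.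
have nN i : (n i < N)%N.
  rewrite -(ltr_nat R); apply: le_lt_trans cN; apply: le_trans nc.
  by rewrite ler_nat (bigD1 i) //= leq_addr.
exists [ffun i => Ordinal (nN i)] => //.
by apply: eq_bigr => i _; rewrite ffunE.
Qed.

Lemma locfin_cones (ms : seq V) (F : V -> Z) :
  (forall y, F y <> 0 -> exists m (q : V), [/\ m \in ms, cone_ge (D := D) 0 q & y = m - q]) ->
  locfin (@cht R V I D : {additive V -> R}) F.
Proof.
move=> HF c; apply: sub_finite_set (_ : finite_set
  (\bigcup_(m in [set m | m \in ms]) [set m - v | v in
     [set v | cone_ge (D := D) 0 v /\ ht v <= ht m - c]])).
  move=> y [/HF[m [q [mm qq ->]]]]; rewrite raddfB /= => cy.
  by exists m => //; exists q => //; split=> //; lra.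
apply: bigcup_finite; first exact: finite_seq.
by move=> m _; apply: finite_image; exact: finite_cone.
Qed.

(** The coefficient at [y] is constant from a stage on that depends on the height of
    [y] only; the limit reads it off at that stage. *)
Lemma fil_complete (E : nat -> S) : (forall n, fil 0 (E n)) ->
  (forall k, exists N, forall n, (N <= n)%N -> fil k (E n - E N)) ->
  exists2 X : S, fil 0 X &
    forall k, exists N, forall n, (N <= n)%N -> fil k (E n - X).
Proof.
move=> E0 /choice[N NP]; have [h hP] := choice (fun y => nat_bound (- ht y)).
pose F (y : V) : Z := E (N (h y)) y.
have F0 y : F y <> 0 -> cone_ge (D := D) 0 (- y) by move=> /E0.
have fF : locfin (@cht R V I D : {additive V -> R}) F.
  apply: (@locfin_cones [:: 0]) => y /F0 yc; exists 0, (- y).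
  by rewrite inE eqxx sub0r opprK.
pose X : S := Nov (asboolT fF).
exists X => // k; exists (N k) => n nk y.
rewrite ncoefD ncoefN /= => Ey.
pose n' := maxn (N k) (N (h y)).
have En' : E n' y = F y.
  apply/eqP; rewrite -subr_eq0; apply/eqP.
  have := fil_high (NP (h y) n' (leq_maxr _ _)) (hP y).
  by rewrite ncoefD ncoefN.
have : fil k (E n - E n').
  have -> : E n - E n' = (E n - E (N k)) - (E n' - E (N k)) by rewrite opprB addrA subrK.
  by apply: filB; apply: NP => //; exact: leq_maxl.
by apply; rewrite ncoefD ncoefN En'.
Qed.

Lemma geometric (X : S) n : (1 - X) * \sum_(i < n) X ^+ i = 1 - X ^+ n.
Proof. by rewrite -[X in X - _ ^+ _](expr1n _ n) subrXX; congr (_ * _);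
  apply: eq_bigr => i _; rewrite expr1n mul1r. Qed.

(** The geometric sums are a Cauchy sequence. *)
Lemma geometric_limit X : fil 1 X -> exists2 T, fil 0 T & (1 - X) * T = 1 /\
  forall n, fil n (\sum_(i < n) X ^+ i - T).
Proof.
move=> X1; have X0 : fil 0 X by apply: fil_le X1.
have d m n : fil m (\sum_(i < m + n) X ^+ i - \sum_(i < m) X ^+ i).
  rewrite big_split_ord /= addrAC subrr add0r; apply: fil_sum => i _.
  apply: (@fil_le _ _ _ _ _ _ (m + i)%N); first exact: leq_addr.
  by have := filX (n := (m + i)%N) X1; rewrite muln1.
have [n|k|T T0 TP] := @fil_complete (fun n => \sum_(i < n) X ^+ i).
- by apply: fil_sum => i _; exact: filX0.
- by exists k => n kn; have := d k (n - k)%N; rewrite subnKC.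
have TP' n : fil n (\sum_(i < n) X ^+ i - T).
  have [N NP] := TP n; have := filB (NP _ (leq_addl n N)) (d n N).
  by rewrite opprB addrCA (addrAC _ (- T)) subrr add0r.
exists T => //; split=> //.
apply/eqP; rewrite -subr_eq0; apply/eqP/fil_eq0 => k.
have -> : (1 - X) * T - 1 = - ((1 - X) * (\sum_(i < k) X ^+ i - T) + X ^+ k).
  rewrite mulrBr geometric; ring.
apply: filN; apply: filD; last by have := filX (n := k) X1; rewrite muln1.
rewrite mulrC; apply: filMl; [exact: TP'|apply: filB => //; exact: fil1].
Qed.

Lemma geometric_inverse (A : comNzRingType) (x c c' t : A) : c * c' = 1 ->
  (1 - (- (c' * (x - c)))) * t = 1 -> x * (c' * t) = 1.
Proof.
move=> cc'; rewrite opprK mulrBr (mulrC c' c) cc' addrC subrK => <-.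
by rewrite mulrA (mulrC x).
Qed.

(** Divide by the constant term and apply [geometric_limit]. *)
Lemma series_inv X (a : Z) : a \is a GRing.unit -> fil 1 (X - nmono _ a 0) ->
  exists2 T, fil 0 T & X * T = 1.
Proof.
move=> ua Xa; pose c : S := nmono _ a 0; pose c' : S := nmono _ a^-1 0.
have cc' : c * c' = 1 by rewrite [LHS]nmonoM addr0 divrr.
have c'0 : fil 0 c' by exact: fil_const.
move: Xa; rewrite -/c; move: c c' cc' c'0 => c c' cc' c'0 Xa.
have x1 : fil 1 (- (c' * (X - c))).
  by apply: filN; rewrite mulrC; apply: filMl.
have [T T0 [TP _]] := geometric_limit x1.
exists (c' * T); first by rewrite mulrC; apply: filMl.
exact: geometric_inverse cc' TP.
Qed.

(** Expansion in the fundamental chamber; the expansion of [f] in the chamber [t] is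
    that of its image under [t^-1]. *)
Definition expands f X := exists p q,
  [/\ galgY p, galgY q, q != 0, f = frac p / frac q & iota q * X = iota p].

Lemma iota_mul_eq0 p X : iota p * X = 0 -> p = 0 \/ X = 0.
Proof. by apply: nov_mul_eq0 => a b; exact: vgalg_domain. Qed.

Lemma galgY_mono a v : v \in Y -> galgY (gmono a v : galgV Y).
Proof.
move=> vY y; rewrite /fsupp /= /mono; case: eqP => [->//|_].
by rewrite mulr0n.
Qed.
Lemma galgYM p q : galgY p -> galgY q -> galgY (p * q).
Proof.
move=> pY qY y; rewrite /fsupp /= => /conv_supp[x [/pY xY /qY yY]].
by rewrite -(subrK x y) /= rpredD.
Qed.
Lemma galgYD p q : galgY p -> galgY q -> galgY (p + q).
Proof.
move=> pY qY y; rewrite /fsupp /= => pq.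
have [p0|/eqP/pY //] := eqVneq (p y) 0.
by apply: qY => q0; apply: pq; rewrite p0 q0 addr0.
Qed.
Lemma galgY1 : galgY (1 : galgV Y).
Proof. by apply: galgY_mono; rewrite rpred0. Qed.
Lemma galgY_act w p : galgY p -> galgY (galg_act w p).
Proof. by move=> pY y /pY /= yY; rewrite -(wactVK w y) wact_Y. Qed.

Lemma expands_tofrac p : galgY p -> expands (frac p) (iota p).
Proof.
move=> pY; exists p, 1; split=> //; [exact: galgY1|exact: oner_neq0| |].
  by rewrite rmorph1 divr1.
by rewrite iota1 mul1r.
Qed.
Lemma iota_mono a v : iota (gmono a v : galgV Y) = nmono _ a v.
Proof. exact: novP. Qed.
Lemma expands_const a : expands (const_frac (Y := Y) a) (nmono _ a 0).
Proof. by rewrite -iota_mono; apply: expands_tofrac; apply: galgY_mono; rewrite rpred0. Qed.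
Lemma expands_expo v : v \in Y -> expands (expo Y v) (nmono _ 1 v).
Proof. by move=> vY; rewrite -iota_mono; apply: expands_tofrac; apply: galgY_mono. Qed.
Lemma expands0 : expands 0 0.
Proof. by rewrite -(rmorph0 (const_frac (Y := Y))); exact: expands_const. Qed.
Lemma expands1 : expands 1 1.
Proof. by rewrite -(rmorph1 (const_frac (Y := Y))); exact: expands_const. Qed.

Lemma expandsD f g X T : expands f X -> expands g T -> expands (f + g) (X + T).
Proof.
move=> [p [q [pY qY q0 -> E]]] [p' [q' [pY' qY' q0' -> E']]].
exists (p * q' + p' * q), (q * q'); split.
- by apply: galgYD; apply: galgYM.
- exact: galgYM.
- exact: mulf_neq0.
- by rewrite addf_div ?tofrac_eq0 // -!rmorphM -rmorphD.
- by rewrite iotaD !iotaM mulrDr -E -E'; ring.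
Qed.
Lemma expandsM f g X T : expands f X -> expands g T -> expands (f * g) (X * T).
Proof.
move=> [p [q [pY qY q0 -> E]]] [p' [q' [pY' qY' q0' -> E']]].
exists (p * p'), (q * q'); split.
- exact: galgYM.
- exact: galgYM.
- exact: mulf_neq0.
- by rewrite mulf_div -!rmorphM.
- by rewrite !iotaM -E -E'; ring.
Qed.
Lemma expandsN f X : expands f X -> expands (- f) (- X).
Proof.
move=> fX; rewrite -mulN1r -[- X]mulN1r; apply: expandsM => //.
rewrite -(rmorphN1 (const_frac (Y := Y))).
have -> : -1 = nmono _ (-1) 0 :> S.
  by apply: novP => y; rewrite ncoefN /= /mono mulNrn.
exact: expands_const.
Qed.
Lemma expandsB f g X T : expands f X -> expands g T -> expands (f - g) (X - T).
Proof. by move=> fX gT; apply: expandsD => //; exact: expandsN. Qed.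
Lemma expandsX f X n : expands f X -> expands (f ^+ n) (X ^+ n).
Proof.
by move=> fX; elim: n => [|n IH]; rewrite ?exprS; [exact: expands1|exact: expandsM].
Qed.
Lemma expands_sum (J : Type) (r : seq J) (f : J -> K) (X : J -> S) :
  (forall j, expands (f j) (X j)) -> expands (\sum_(j <- r) f j) (\sum_(j <- r) X j).
Proof.
move=> H; elim: r => [|j r IH]; rewrite ?big_nil ?big_cons; first exact: expands0.
exact: expandsD.
Qed.

(** The denominators do not divide zero in the ring of series. *)
Lemma expands_uniq f X T : expands f X -> expands f T -> X = T.
Proof.
move=> [p [q [pY qY q0 -> E]]] [p' [q' [pY' qY' q0' ff E']]].
have := tofrac_div_eq q0 q0' ff => pq.
have : iota (q * q') * (X - T) = 0.
  have e1 : iota q * iota q' * X = iota (p * q') by rewrite mulrAC E iotaM.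
  have e2 : iota q * iota q' * T = iota (p' * q).
    by rewrite -mulrA E' [LHS]mulrC iotaM.
  by rewrite iotaM mulrBr e1 e2 pq subrr.
move=> /iota_mul_eq0[/eqP|/eqP]; last by rewrite subr_eq0 => /eqP.
by rewrite mulf_eq0 (negbTE q0) (negbTE q0').
Qed.

Lemma expandsV f X T : expands f X -> X * T = 1 -> expands f^-1 T.
Proof.
move=> [p [q [pY qY q0 -> E]]] XT.
have p0 : p != 0.
  apply/eqP => p0; move: E; rewrite p0 iota0 => /iota_mul_eq0[/eqP|X0].
    by rewrite (negbTE q0).
  by move: XT; rewrite X0 mul0r => /eqP; rewrite eq_sym oner_eq0.
exists q, p; split=> //; first by rewrite invf_div.
by rewrite -E -mulrA XT mulr1.
Qed.

(** The order in the fundamental chamber; that of the image under [t^-1] is the order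
    in the chamber [t]. *)
Definition ord k f := exists2 X, expands f X & fil k X.

Lemma ord_le k l f : (k <= l)%N -> ord l f -> ord k f.
Proof. by move=> kl [X fX lX]; exists X => //; exact: fil_le lX. Qed.
Lemma ord0 k : ord k 0.
Proof. by exists 0; [exact: expands0|exact: fil0]. Qed.
Lemma ord1 : ord 0 1.
Proof. by exists 1; [exact: expands1|exact: fil1]. Qed.
Lemma ordD k f g : ord k f -> ord k g -> ord k (f + g).
Proof. by move=> [X fX kX] [T gT kT]; exists (X + T); [exact: expandsD|exact: filD]. Qed.
Lemma ordN k f : ord k f -> ord k (- f).
Proof. by move=> [X fX kX]; exists (- X); [exact: expandsN|exact: filN]. Qed.
Lemma ordB k f g : ord k f -> ord k g -> ord k (f - g).
Proof. by move=> kf kg; apply: ordD => //; exact: ordN. Qed.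
Lemma ordM k l f g : ord k f -> ord l g -> ord (k + l) (f * g).
Proof. by move=> [X fX kX] [T gT kT]; exists (X * T); [exact: expandsM|exact: filM]. Qed.
Lemma ordMl k f g : ord k f -> ord 0 g -> ord k (f * g).
Proof. by rewrite -{2}(addn0 k); exact: ordM. Qed.
Lemma ordMr k f g : ord 0 f -> ord k g -> ord k (f * g).
Proof. by move=> f0 kg; rewrite mulrC; exact: ordMl. Qed.
Lemma ord_const a : ord 0 (const_frac (Y := Y) a).
Proof. by exists (nmono _ a 0); [exact: expands_const|exact: fil_const]. Qed.
Lemma ord_expo k v : cone_ge (D := D) k v -> ord k (expo Y (- v)).
Proof.
move=> kv; exists (nmono _ 1 (- v)); last exact: fil_mono.
by apply: expands_expo; rewrite rpredN (cone_ge_Y Y kv).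
Qed.
Lemma ord_sum k (J : Type) (r : seq J) (P : pred J) (f : J -> K) :
  (forall j, P j -> ord k (f j)) -> ord k (\sum_(j <- r | P j) f j).
Proof. by move=> H; apply: big_ind => //; [exact: ord0|exact: ordD]. Qed.
Lemma ord_prod (J : Type) (r : seq J) (P : pred J) (f : J -> K) :
  (forall j, P j -> ord 0 (f j)) -> ord 0 (\prod_(j <- r | P j) f j).
Proof. by move=> H; apply: big_ind => //; [exact: ord1|exact: (@ordM 0 0)]. Qed.

Lemma ordV f a : a \is a GRing.unit -> ord 1 (f - const_frac (Y := Y) a) ->
  ord 0 f^-1 /\ f != 0.
Proof.
move=> ua [X fX X1].
have fX' : expands f (X + nmono _ a 0).
  by rewrite -[f](subrK (const_frac (Y := Y) a)); apply: expandsD => //; exact: expands_const.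
have [|T T0 XT] := @series_inv (X + nmono _ a 0) a ua; first by rewrite addrK.
split; first by exists T => //; exact: expandsV XT.
apply/eqP => f0; move: fX' XT; rewrite f0 => /expands_uniq /(_ expands0) ->.
by rewrite mul0r => /eqP; rewrite eq_sym oner_eq0.
Qed.
End SeriesLimits.

(** * Convergence in all chambers *)
Section Families.
Context {R : realType} {V : vectType R} {I : finType} {D : rootDatum V I}.
Variable Y : lattice D.
Local Notation W := (weyl D).
Local Notation K := (fracV Y).
Local Notation S := (series Y).
Local Notation ht := (@cht R V I D).
Implicit Types (u w t : W) (p q : galgV Y) (f g : nat -> K) (v x y : V) (k l : nat).
Implicit Types (X T : W -> S).

Definition approx t k (a : K) (x : S) :=
  exists2 E, expands (frac_act t^-1%g a) E & fil k (E - x).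

Lemma approx_fil0 t k a (x : S) E : fil 0 x -> expands (frac_act t^-1%g a) E ->
  fil k (E - x) -> fil 0 E.
Proof.
move=> x0 aE kE; rewrite -[E](subrK x); apply: filD => //.
exact: fil_le kE.
Qed.

(** Convergence in each chamber; [X t] is the limit in the chamber [t], transported to
    the fundamental one. The first two conditions confine all the supports to a
    common cone. *)
Definition tends f X := forall t, [/\ fil 0 (X t), forall n, approx t 0 (f n) (X t)
  & forall k, exists N, forall n, (N <= n)%N -> approx t k (f n) (X t)].

Lemma approx_uniq t k a (x y : S) : approx t k a x -> approx t k a y -> fil k (x - y).
Proof.
move=> [E aE kE] [E' aE' kE']; rewrite (expands_uniq aE' aE) in kE'.
have := filB kE' kE; congr fil.
by rewrite opprB addrCA (addrAC _ (- y)) subrr add0r.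
Qed.

Lemma tends_uniq f X T : tends f X -> tends f T -> X = T.
Proof.
move=> fX fT; apply/funext => t; apply/eqP; rewrite -subr_eq0; apply/eqP/fil_eq0 => k.
have [_ _ /(_ k)[N NP]] := fX t; have [_ _ /(_ k)[N' NP']] := fT t.
apply: (@approx_uniq t k (f (maxn N N'))); first exact/NP/leq_maxl.
exact/NP'/leq_maxr.
Qed.

Lemma tends_near f g X : tends f X -> (forall t n, ord 0 (frac_act t^-1%g (g n - f n))) ->
  (forall t k, exists N, forall n, (N <= n)%N -> ord k (frac_act t^-1%g (g n - f n))) ->
  tends g X.
Proof.
move=> fX g0 gN t; have [X0 f0 fN] := fX t.
have H k n : approx t k (f n) (X t) -> ord k (frac_act t^-1%g (g n - f n)) ->
    approx t k (g n) (X t).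
  move=> [E aE kE] [E' aE' kE']; exists (E' + E).
    by rewrite -[g n](subrK (f n)) rmorphD; exact: expandsD.
  by rewrite -addrA; exact: filD.
split=> // [n|k]; first exact: H.
have [N NP] := fN k; have [N' NP'] := gN t k; exists (maxn N N') => n.
by rewrite geq_max => /andP[nN nN']; apply: H; [exact: NP|exact: NP'].
Qed.

Lemma tends_complete f : (forall t n, ord 0 (frac_act t^-1%g (f n))) ->
  (forall t k, exists N, forall n, (N <= n)%N -> ord k (frac_act t^-1%g (f n - f N))) ->
  exists X, tends f X.
Proof.
move=> f0 fN; suff /choice[X XP] : forall t, exists x : S, [/\ fil 0 x,
    forall n, approx t 0 (f n) x
    & forall k, exists N, forall n, (N <= n)%N -> approx t k (f n) x].
  by exists X.
move=> t.
have /choice[E EP] : forall n, exists E : S,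
    expands (frac_act t^-1%g (f n)) E /\ fil 0 E.
  by move=> n; have [E h1 h2] := f0 t n; exists E.
have [n|k|x x0 xP] := @fil_complete _ _ _ _ _ E; first by case: (EP n).
  have [N NP] := fN t k; exists N => n /NP[E' h1 h2].
  rewrite (_ : E n - E N = E') //; apply: (expands_uniq _ h1).
  by rewrite rmorphB; apply: expandsB; [case: (EP n)|case: (EP N)].
exists x; split=> // [n|k].
  by have [h1 h2] := EP n; exists (E n) => //; exact: filB.
have [N NP] := xP k; exists N => n nN; have [h1 h2] := EP n.
by exists (E n) => //; exact: NP.
Qed.

Lemma sub_mul_split (A : comNzRingType) (e x e' y : A) :
  e * e' - x * y = (e - x) * e' + (e' - y) * x.
Proof. by rewrite !mulrBl addrA (mulrC e' x) subrK (mulrC y). Qed.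

Lemma approxM t k a b (x y : S) : fil 0 x -> fil 0 y -> approx t k a x -> approx t k b y ->
  approx t k (a * b) (x * y).
Proof.
move=> x0 y0 [E aE kE] [E' bE' kE']; exists (E * E').
  by rewrite rmorphM; exact: expandsM.
rewrite sub_mul_split; apply: filD; apply: filMl => //.
exact: approx_fil0 bE' kE'.
Qed.

Lemma tendsM f g X T : tends f X -> tends g T ->
  tends (fun n => f n * g n) (fun t => X t * T t).
Proof.
move=> fX gT t; have [X0 f0 fN] := fX t; have [T0 g0 gN] := gT t; split.
- by move: (filM X0 T0).
- by move=> n; exact: approxM.
move=> k; have [N NP] := fN k; have [N' NP'] := gN k; exists (maxn N N') => n.
by rewrite geq_max => /andP[nN nN']; apply: approxM => //; [exact: NP|exact: NP'].
Qed.

(** Acting by [u] permutes the chambers. *)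
Lemma tends_act u f X : tends f X ->
  tends (fun n => frac_act u (f n)) (fun t => X (u^-1 * t)%g).
Proof.
move=> fX t; have [X0 f0 fN] := fX (u^-1 * t)%g.
have H k n : approx (u^-1 * t)%g k (f n) (X (u^-1 * t)%g) ->
    approx t k (frac_act u (f n)) (X (u^-1 * t)%g).
  by move=> [E aE kE]; exists E => //; move: aE; rewrite invgM invgK frac_actM.
split=> // [n|k]; first exact: H.
by have [N NP] := fN k; exists N => n /NP; exact: H.
Qed.

Lemma tends_cst (a : K) : (forall t, ord 0 (frac_act t^-1%g a)) ->
  exists X, tends (fun _ => a) X.
Proof.
move=> a0; apply: tends_complete => // t k; exists 0%N => n _.
by rewrite subrr rmorph0; exact: ord0.
Qed.

Lemma tends1 : tends (fun _ => 1) (fun _ => 1).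
Proof.
have H t k : approx t k (1 : K) 1.
  by exists 1; rewrite ?rmorph1 ?subrr; [exact: expands1|exact: fil0].
by move=> t; split=> // [|k]; [exact: fil1|exists 0%N].
Qed.

Lemma filX_sub k (x y : S) n : fil 0 x -> fil 0 y -> fil k (x - y) -> fil k (x ^+ n - y ^+ n).
Proof.
move=> x0 y0 kxy; rewrite subrXX; apply: filMl => //; apply: fil_sum => i _.
by rewrite -[0%N]addn0; apply: filM; exact: filX0.
Qed.

(** Neumann series: the inverse is the limit of geometric sums in the [f n], which only
    involve ring operations, so that they expand in all chambers. The [f n]
    themselves may fail to be invertible there. *)
Lemma tends_inv f X : tends f X -> (forall t, fil 1 (1 - X t)) ->
  exists g T, tends g T /\ forall t, X t * T t = 1.
Proof.
move=> fX X1.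
have /choice[T TP] : forall t, exists T : S, [/\ fil 0 T, (1 - (1 - X t)) * T = 1 &
    forall n, fil n (\sum_(i < n) (1 - X t) ^+ i - T)].
  by move=> t; have [T T0 [h1 h2]] := geometric_limit (X1 t); exists T.
exists (fun n => \sum_(i < n) (1 - f n) ^+ i), T; split; last first.
  by move=> t; have [_ + _] := TP t; rewrite subKr.
move=> t; have [T0 _ TN] := TP t; have [X0 f0 fN] := fX t.
have X10 : fil 0 (1 - X t) by exact: fil_le (X1 t).
have G k n : approx t k (f n) (X t) -> exists2 E,
    expands (frac_act t^-1%g (\sum_(i < n) (1 - f n) ^+ i)) E &
    fil k (E - \sum_(i < n) (1 - X t) ^+ i).
  move=> [E aE kE]; exists (\sum_(i < n) (1 - E) ^+ i).
    rewrite rmorph_sum /=; apply: expands_sum => i.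
    rewrite rmorphXn rmorphB rmorph1; apply: expandsX; apply: expandsB => //.
    exact: expands1.
  rewrite -sumrB; apply: fil_sum => i _; apply: filX_sub => //.
    by apply: filB; [exact: fil1|exact: approx_fil0 aE kE].
  by rewrite opprB addrC subrKA -opprB; exact: filN.
split=> // [n|k].
  have [E h1 h2] := G 0%N n (f0 n); exists E => //.
  rewrite -[E - _](subrKA (\sum_(i < n) (1 - X t) ^+ i)); apply: filD => //.
  exact: fil_le (TN n).
have [N NP] := fN k; exists (maxn k N) => n; rewrite geq_max => /andP[kn Nn].
have [E h1 h2] := G k n (NP _ Nn); exists E => //.
rewrite -[E - _](subrKA (\sum_(i < n) (1 - X t) ^+ i)); apply: filD => //.
exact: fil_le (TN n).
Qed.

(** * Families of expansions *)

(** Back from the fundamental chamber to the chamber [t]. *)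
Definition family_of X : Defs.family Y := fun t y => X t (wact t^-1%g y).

Lemma family_ofM X T : fam_mul (family_of X) (family_of T) = family_of (fun t => X t * T t).
Proof.
apply/funext => t; apply/funext => y; rewrite /fam_mul /family_of ncoefM /conv.
rewrite [RHS](@reindex_fsbigT _ _ _ _ _ (wact t^-1%g)); last first.
  by exists (wact t) => z; rewrite ?wactK ?wactVK.
by apply: eq_fsbigr => z _; rewrite -raddfB.
Qed.

Lemma family_of_act u X : fam_act u (family_of X) = family_of (fun t => X (u^-1 * t)%g).
Proof.
apply/funext => t; apply/funext => y; rewrite /fam_act /family_of.
by rewrite invgM invgK wactM wactVK.
Qed.

Lemma family_of1 : family_of (fun _ => 1) = fam1 Y.
Proof.
apply/funext => t; apply/funext => y; rewrite /family_of /fam1 /= /mono.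
by rewrite (can2_eq (wactVK t) (wactK t)) raddf0.
Qed.

Lemma fil0_supp t (x : S) : fil 0 x ->
  supp_in t [:: 0] (fun y => x (wact t^-1%g y)).
Proof.
move=> x0 y /eqP /x0 xy; rewrite -raddfN in xy.
have yE : y = - wact t (- wact t^-1%g y) by rewrite (raddfN (wact t)) /= opprK wactVK.
split; first by rewrite yE rpredN wact_Y // -raddfN (cone_ge_Y Y xy).
exists 0, (wact t^-1%g (- y)); split; rewrite ?inE ?eqxx //.
  by have [n [-> _]] := xy; exists n.
by rewrite (wactVK t) sub0r opprK.
Qed.

Lemma expands_expansion t (a : K) (x : S) : expands (frac_act t^-1%g a) x -> fil 0 x ->
  expansion t a (fun y => x (wact t^-1%g y)).
Proof.
move=> [p [q [pY qY q0 E xE]]] x0; split.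
  by exists [:: 0]; [move=> y; rewrite inE => /eqP ->; exact: rpred0|exact: fil0_supp].
exists (galg_act t p), (galg_act t q); split.
- exact: galgY_act.
- exact: galgY_act.
- by rewrite galg_act_eq0.
- by rewrite -frac_act_div // -E frac_actVK.
apply/funext => y; rewrite galg_actE.
have -> : p (wact t^-1%g y) = (iota q * x) (wact t^-1%g y) by rewrite xE.
rewrite ncoefM.
rewrite /conv [RHS](@reindex_fsbigT _ _ _ _ _ (wact t^-1%g)); last first.
  by exists (wact t) => z; rewrite ?wactK ?wactVK.
by apply: eq_fsbigr => z _; rewrite -raddfB.
Qed.

(** Finitely many translated cones contain finitely many points above a given height.
    Hence the uniqueness of expansions in [nov] holds for arbitrary expansions. *)
Lemma cone_series_locfin t (F : formal Y) : cone_series t F ->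
  locfin (ht : {additive V -> R}) (fun y => F (wact t y)).
Proof.
move=> [ms _ Fms]; apply: (@locfin_cones _ _ _ _ _ [seq wact t^-1%g m | m <- ms]) => y.
move=> /eqP /Fms[_ [m [q [mm [n qn] yE]]]]; exists (wact t^-1%g m), q; split.
- exact: map_f.
- by exists n.
- by rewrite -[y](wactK t) yE raddfB /= wactK.
Qed.

Definition nov_of_cone t (F : formal Y) (H : cone_series t F) : S :=
  Nov (asboolT (cone_series_locfin H)).

Lemma expansion_uniq t (a : K) (F G : formal Y) : expansion t a F -> expansion t a G -> F = G.
Proof.
have H (F' : formal Y) (aF : expansion t a F') :
    expands (frac_act t^-1%g a) (nov_of_cone aF.1).
  case: aF => cF [p [q [pY qY q0 E FE]]] /=.
  exists (galg_act t^-1%g p), (galg_act t^-1%g q); split.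
  - exact: galgY_act.
  - exact: galgY_act.
  - by rewrite galg_act_eq0.
  - by rewrite E frac_act_div.
  apply: novP => y; rewrite ncoefM /= invgK -FE /conv.
  rewrite [RHS](@reindex_fsbigT _ _ _ _ _ (wact t)); last first.
    by exists (wact t^-1%g) => z; rewrite ?wactK ?wactVK.
  by apply: eq_fsbigr => z _; rewrite raddfB.
move=> aF aG; have := expands_uniq (H _ aF) (H _ aG).
move=> E; apply/funext => y; rewrite -(wactVK t y).
exact: (congr1 (fun x : S => x (wact t^-1%g y)) E).
Qed.

Lemma tends_cvg f X : tends f X -> cvg_family f (family_of X).
Proof.
move=> fX t; have [X0 f0 fN] := fX t.
have /choice[E EP] : forall n, exists E : S, expands (frac_act t^-1%g (f n)) E /\ fil 0 E.
  move=> n; have [E aE kE] := f0 n; exists E; split=> //.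
  exact: approx_fil0 aE kE.
exists (fun n y => E n (wact t^-1%g y)).
  by move=> n; have [h1 h2] := EP n; exact: expands_expansion.
exists [:: 0]; first by move=> y; rewrite inE => /eqP ->; exact: rpred0.
split=> [n|y]; first by have [_ h2] := EP n; exact: fil0_supp.
have [k ky] := nat_bound (- ht (wact t^-1%g y)).
have [N NP] := fN k; exists N => n /NP[E' h1 h2].
have [h3 _] := EP n; rewrite /family_of; apply/eqP; rewrite -subr_eq0.
have := fil_high h2 ky; rewrite (expands_uniq h1 h3) ncoefD ncoefN => ->.
by [].
Qed.

Lemma cvg_family_uniq f (F G : Defs.family Y) : cvg_family f F -> cvg_family f G -> F = G.
Proof.
move=> fF fG; apply/funext => t; apply/funext => y.
have [E EP [ms _ [_ /(_ y)[N NP]]]] := fF t.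
have [E' EP' [ms' _ [_ /(_ y)[N' NP']]]] := fG t.
rewrite -(NP (maxn N N')) ?leq_maxl // -(NP' (maxn N N')) ?leq_maxr //.
by rewrite (expansion_uniq (EP _) (EP' _)).
Qed.

Lemma tends_ratY f X n : tends f X -> ratY (f n).
Proof.
move=> fX t; have [X0 f0 _] := fX t; have [E aE kE] := f0 n.
exists (fun y => E (wact t^-1%g y)); apply: expands_expansion => //.
exact: approx_fil0 aE kE.
Qed.

Lemma tends_completion f X : tends f X -> completion (family_of X).
Proof.
by move=> fX; exists f; [move=> n; exact: tends_ratY fX|exact: tends_cvg].
Qed.

Lemma completion_cone (F : Defs.family Y) t : completion F -> cone_series t (F t).
Proof.
move=> [f _ /(_ t)[E _ [ms msY [Ems EN]]]]; exists ms => // y.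
have [N NP] := EN y; rewrite -(NP N (leqnn N)); exact: Ems.
Qed.

Lemma completion_family (F : Defs.family Y) : completion F -> exists X, F = family_of X.
Proof.
move=> cF; exists (fun t => nov_of_cone (completion_cone t cF)).
apply/funext => t; apply/funext => y.
by rewrite /family_of /= wactVK.
Qed.

Lemma family_of_inj : injective family_of.
Proof.
move=> X T XT; apply/funext => t; apply: novP => y.
by have := congr1 (fun F : Defs.family Y => F t (wact t y)) XT; rewrite /family_of wactK.
Qed.

Lemma fam_inv_family X T : completion (family_of T) ->
  (forall t, X t * T t = 1) -> fam_inv (family_of X) = family_of T.
Proof.
move=> cT XT; have XT1 : fam_mul (family_of X) (family_of T) = fam1 Y.
  by rewrite family_ofM -family_of1; congr family_of; apply/funext.
rewrite /fam_inv; case: xgetP => [H -> [/completion_family[T' ->]]|/(_ (family_of T))[]//].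
rewrite family_ofM -family_of1 => /family_of_inj XT'; congr family_of.
apply/funext => t; have {XT'} := congr1 (fun X => X t) XT' => XT'.
by rewrite -[T' t]mul1r -(XT t) mulrAC XT' mul1r.
Qed.

Lemma fam_unit_family f g X T : tends f X -> tends g T -> (forall t, X t * T t = 1) ->
  fam_unit (family_of X).
Proof.
move=> fX gT XT; split; first exact: tends_completion fX.
exists (family_of T); first exact: tends_completion gT.
by rewrite family_ofM -family_of1; congr family_of; apply/funext.
Qed.
End Families.

(** * The twisted group algebra *)
Section TwistedRing.
Context {R : realType} {V : vectType R} {I : finType} {D : rootDatum V I}.
Variable Y : lattice D.
Local Notation W := (weyl D).
Local Notation K := (fracV Y).
Implicit Types (u w v : W) (x : K) (f g h : twisted Y).

Definition tsupp f : set W := [set u | f u <> 0].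

Lemma supp_fsetW (A : set W) : finite_set A -> exists S : {fset W}, A `<=` [set` S].
Proof. by move=> /finite_fsetP[S ->]; exists S. Qed.

Lemma tw_mulE (S : {fset W}) f g v : tsupp f `<=` [set` S] ->
  tw_mul f g v = \sum_(u <- S) f u * frac_act u (g (u^-1 * v)%g).
Proof.
move=> fS; apply: fsbigTE => u uS.
have [->|/eqP fu] := eqVneq (f u) 0; first by rewrite mul0r.
by move: (fS u fu) => /= uS'; rewrite uS' in uS.
Qed.

Lemma fsbig_single (F : W -> K) u : (forall w, w <> u -> F w = 0) ->
  \sum_(w \in [set: W]) F w = F u.
Proof.
move=> H; rewrite (@fsbigTE _ _ _ _ [fset u]%fset) ?big_seq_fset1 // => w.
by rewrite inE => /eqP /H.
Qed.

Lemma finite_tsuppD f g : finite_set (tsupp f) -> finite_set (tsupp g) ->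
  finite_set (tsupp (fun u => f u + g u)).
Proof.
move=> ff fg; apply: (@sub_finite_set _ _ (tsupp f `|` tsupp g)); last first.
  by rewrite finite_setU.
move=> u fgu; apply: contrapT => /not_orP[/contrapT f0 /contrapT g0].
by apply: fgu; rewrite f0 g0 addr0.
Qed.
Lemma finite_tsuppN f : finite_set (tsupp f) -> finite_set (tsupp (fun u => - f u)).
Proof. by apply: sub_finite_set => u fu f0; apply: fu; rewrite f0 oppr0. Qed.
Lemma finite_tsupp_at x u : finite_set (tsupp (fun w => x *+ (w == u))).
Proof.
apply: (@sub_finite_set _ _ [set` [fset u]%fset]) => // w.
have [-> _|wu] := eqVneq w u; first exact: fset11.
by rewrite /tsupp /= (negbTE wu) mulr0n.
Qed.

Lemma finite_tsuppM f g : finite_set (tsupp f) -> finite_set (tsupp g) ->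
  finite_set (tsupp (tw_mul f g)).
Proof.
move=> /supp_fsetW[S fS] /supp_fsetW[T gT].
apply: (@sub_finite_set _ _ [set` [fset (u * w)%g | u in S, w in T]%fset]) => //.
move=> v; rewrite /tsupp /= (tw_mulE _ _ fS) => vn0.
apply: contrapT => vST; apply: vn0; rewrite big_seq big1 // => u uS.
have [->|/eqP gu] := eqVneq (g (u^-1 * v)%g) 0; first by rewrite raddf0 mulr0.
exfalso; apply: vST; apply/imfset2P; exists u => //; exists (u^-1 * v)%g.
  exact: gT.
by rewrite mulVKg.
Qed.

Lemma frac_act_tw_mul u f g v : finite_set (tsupp f) ->
  frac_act u (tw_mul f g v) =
  \sum_(w \in [set: W]) frac_act u (f w) * frac_act (u * w)%g (g (w^-1 * v)%g).
Proof.
move=> /supp_fsetW[S fS]; rewrite (tw_mulE _ _ fS) rmorph_sum /= (@fsbigTE _ _ _ _ S).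
  by apply: eq_bigr => w _; rewrite rmorphM frac_actM.
move=> w wS; have [->|/eqP fw] := eqVneq (f w) 0; first by rewrite raddf0 mul0r.
by move: (fS w fw) => /= wS'; rewrite wS' in wS.
Qed.

Lemma tw_mulA f g h : finite_set (tsupp f) -> finite_set (tsupp g) ->
  tw_mul f (tw_mul g h) = tw_mul (tw_mul f g) h.
Proof.
move=> ff fg; have [S fS] := supp_fsetW ff; have [T gT] := supp_fsetW fg.
have [U fgU] := supp_fsetW (finite_tsuppM ff fg).
apply/funext => v.
pose X := (U `|` [fset (u * w)%g | u in S, w in T])%fset.
have fgX : tsupp (tw_mul f g) `<=` [set` X] by move=> u /fgU /= uU; rewrite !inE uU.
rewrite (tw_mulE _ _ fgX) (tw_mulE _ _ fS).
under [RHS]eq_bigr do rewrite (tw_mulE _ _ fS) mulr_suml.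
rewrite exchange_big /= big_seq [RHS]big_seq; apply: eq_bigr => u uS.
under [RHS]eq_bigr do rewrite -mulrA.
rewrite -mulr_sumr; congr (_ * _).
rewrite frac_act_tw_mul //.
transitivity (\sum_(w \in [set: W])
   frac_act u (g (u^-1 * w)%g) * frac_act w (h (w^-1 * v)%g)).
  rewrite [RHS](@reindex_fsbigT _ _ _ _ _ (fun w => u * w)%g); last first.
    by exists (fun w => u^-1 * w)%g => w; rewrite ?mulKg ?mulVKg.
  by apply: eq_fsbigr => w _; rewrite mulKg invgM mulgA.
apply: fsbigTE => w wX.
have [->|/eqP gw] := eqVneq (g (u^-1 * w)%g) 0; first by rewrite raddf0 mul0r.
case/negP: wX; rewrite inE; apply/orP; right.
by apply/imfset2P; exists u => //; exists (u^-1 * w)%g; [exact: gT|rewrite mulVKg].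
Qed.

(** The elements of finite support form a ring, which is not the case for [twisted]. *)
Record tgalg := TGalg { tcoef :> W -> K; _ : `[< finite_set (tsupp tcoef) >] }.

HB.instance Definition _ := [isSub for tcoef].
HB.instance Definition _ := [Choice of tgalg by <:].
Implicit Types p q r : tgalg.

Lemma finite_tcoef p : finite_set (tsupp p).
Proof. exact/asboolP/(valP p). Qed.
Lemma tgalgP p q : p =1 q -> p = q.
Proof. by move=> pq; apply/val_inj/funext. Qed.

Definition tmono x u : tgalg := TGalg (asboolT (finite_tsupp_at x u)).
Definition tadd p q : tgalg := TGalg (asboolT (finite_tsuppD (finite_tcoef p) (finite_tcoef q))).
Definition topp p : tgalg := TGalg (asboolT (finite_tsuppN (finite_tcoef p))).
Definition tmul p q : tgalg := TGalg (asboolT (finite_tsuppM (finite_tcoef p) (finite_tcoef q))).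

Fact taddA : associative tadd.
Proof. by move=> p q r; apply: tgalgP => u /=; rewrite addrA. Qed.
Fact taddC : commutative tadd.
Proof. by move=> p q; apply: tgalgP => u /=; rewrite addrC. Qed.
Fact tadd0 : left_id (tmono 0 1%g) tadd.
Proof. by move=> p; apply: tgalgP => u /=; rewrite mul0rn add0r. Qed.
Fact taddN : left_inverse (tmono 0 1%g) topp tadd.
Proof. by move=> p; apply: tgalgP => u /=; rewrite mul0rn addNr. Qed.
HB.instance Definition _ := GRing.isZmodule.Build tgalg taddA taddC tadd0 taddN.

Lemma tmono_mulE x u f v : tw_mul (tmono x u) f v = x * frac_act u (f (u^-1 * v)%g).
Proof.
rewrite /tw_mul (fsbig_single (u := u)) /= ?eqxx // => w /eqP /negbTE ->.
by rewrite mulr0n mul0r.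
Qed.
Lemma mul_tmonoE x u f v : tw_mul f (tmono x u) v =
  f (v * u^-1)%g * frac_act (v * u^-1)%g x.
Proof.
rewrite /tw_mul (fsbig_single (u := (v * u^-1)%g)) /=.
  by rewrite invgM invgK mulgVK eqxx.
move=> w wu; case: eqP => [wv|_]; last by rewrite mulr0n raddf0 mulr0.
by case: wu; rewrite -wv invgM invgK mulVKg.
Qed.

Fact tmulA : associative tmul.
Proof. by move=> p q r; apply: tgalgP => u /=; rewrite tw_mulA //; exact: finite_tcoef. Qed.
Fact tmul1l : left_id (tmono 1 1%g) tmul.
Proof. by move=> p; apply: tgalgP => u; rewrite [LHS]tmono_mulE invg1 !mul1g frac_act1 mul1r. Qed.
Fact tmul1r : right_id (tmono 1 1%g) tmul.
Proof. by move=> p; apply: tgalgP => u; rewrite [LHS]mul_tmonoE invg1 mulg1 rmorph1 mulr1. Qed.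
Fact tmulDl : left_distributive tmul +%R.
Proof.
move=> p q r; apply: tgalgP => u.
have [S pS] := supp_fsetW (finite_tcoef p); have [T qT] := supp_fsetW (finite_tcoef q).
have pST : tsupp p `<=` [set` (S `|` T)%fset] by move=> w /pS /= wS; rewrite inE wS.
have qST : tsupp q `<=` [set` (S `|` T)%fset] by move=> w /qT /= wT; rewrite inE wT orbT.
have pqST : tsupp (p + q) `<=` [set` (S `|` T)%fset].
  move=> w; rewrite /tsupp /= => pq; have [p0|/eqP/pST //] := eqVneq (p w) 0.
  by apply: qST => q0; apply: pq; rewrite p0 q0 addr0.
rewrite /= (tw_mulE _ _ pST) (tw_mulE _ _ qST) (tw_mulE _ _ pqST) -big_split.
by apply: eq_bigr => w _; rewrite mulrDl.
Qed.
Fact tmulDr : right_distributive tmul +%R.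
Proof.
move=> p q r; apply: tgalgP => u.
have [S pS] := supp_fsetW (finite_tcoef p).
rewrite /= !(tw_mulE _ _ pS) -big_split.
by apply: eq_bigr => w _; rewrite raddfD mulrDr.
Qed.
Fact tone_neq0 : tmono 1 1%g != 0.
Proof.
apply/eqP => /(congr1 (fun p : tgalg => p 1%g)) /=; rewrite eqxx => /eqP.
by rewrite oner_eq0.
Qed.
HB.instance Definition _ :=
  GRing.Zmodule_isNzRing.Build tgalg tmulA tmul1l tmul1r tmulDl tmulDr tone_neq0.

Lemma tcoefD p q u : (p + q) u = p u + q u. Proof. by []. Qed.
Lemma tcoefB p q u : (p - q) u = p u - q u. Proof. by []. Qed.
Lemma tcoef0 u : (0 : tgalg) u = 0. Proof. by rewrite /= mul0rn. Qed.
Lemma tcoef1 u : (1 : tgalg) u = (u == 1%g)%:R. Proof. by []. Qed.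
Lemma tcoef_mono x u w : tmono x u w = x *+ (w == u). Proof. by []. Qed.
Lemma tcoef_sum (J : Type) (r : seq J) (P : pred J) (F : J -> tgalg) u :
  (\sum_(j <- r | P j) F j) u = \sum_(j <- r | P j) F j u.
Proof. by elim/big_rec2: _ => [|j y1 y2 _ <-]; rewrite ?tcoef0. Qed.
Lemma tcoef_monoM x u p v : (tmono x u * p) v = x * frac_act u (p (u^-1 * v)%g).
Proof. exact: tmono_mulE. Qed.
Lemma tcoefM_mono x u p v : (p * tmono x u) v = p (v * u^-1)%g * frac_act (v * u^-1)%g x.
Proof. exact: mul_tmonoE. Qed.

Definition tscal x : tgalg := tmono x 1%g.
Definition tdelta u : tgalg := tmono 1 u.

Lemma tscalM_coef x p v : (tscal x * p) v = x * p v.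
Proof. by rewrite tcoef_monoM frac_act1 invg1 mul1g. Qed.
Lemma tdeltaM_coef u p v : (tdelta u * p) v = frac_act u (p (u^-1 * v)%g).
Proof. by rewrite tcoef_monoM mul1r. Qed.
Lemma tMscal_coef x p v : (p * tscal x) v = p v * frac_act v x.
Proof. by rewrite tcoefM_mono invg1 mulg1. Qed.
Lemma tMdelta_coef u p v : (p * tdelta u) v = p (v * u^-1)%g.
Proof. by rewrite tcoefM_mono rmorph1 mulr1. Qed.

Fact tscal_zmod : zmod_morphism tscal.
Proof. by move=> x y; apply: tgalgP => u /=; rewrite mulrnBl. Qed.
Fact tscal_monoid : monoid_morphism tscal.
Proof.
split=> // x y; apply: tgalgP => u; rewrite tscalM_coef !tcoef_mono.
by rewrite mulrnAr.
Qed.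
HB.instance Definition _ := GRing.isZmodMorphism.Build K tgalg tscal tscal_zmod.
HB.instance Definition _ := GRing.isMonoidMorphism.Build K tgalg tscal tscal_monoid.

Lemma tdelta_scal u x : tdelta u * tscal x = tscal (frac_act u x) * tdelta u.
Proof.
apply: tgalgP => v; rewrite tdeltaM_coef tscalM_coef !tcoef_mono.
rewrite rmorphMn mulrnAr mulr1; congr (_ *+ nat_of_bool _); apply/eqP/eqP => [E|->]; last by rewrite mulVg.
by apply: (mulgI u^-1%g); rewrite E mulVg.
Qed.
Lemma tdeltaM u w : tdelta u * tdelta w = tdelta (u * w)%g.
Proof.
apply: tgalgP => v; rewrite tdeltaM_coef !tcoef_mono rmorphMn rmorph1.
congr (_ *+ nat_of_bool _); apply/eqP/eqP => [<-|->]; first by rewrite mulVKg.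
by rewrite mulKg.
Qed.

(** The action of the twisted group algebra on K. *)
Definition tapp p x : K := \sum_(u \in [set: W]) p u * frac_act u x.

Lemma tappE (S : {fset W}) p x : tsupp p `<=` [set` S] ->
  tapp p x = \sum_(u <- S) p u * frac_act u x.
Proof.
move=> pS; apply: fsbigTE => u uS.
have [->|/eqP pu] := eqVneq (p u) 0; first by rewrite mul0r.
by move: (pS u pu) => /= uS'; rewrite uS' in uS.
Qed.

Lemma tapp_mono x u y : tapp (tmono x u) y = x * frac_act u y.
Proof.
rewrite /tapp (fsbig_single (u := u)) /= ?eqxx // => w /eqP /negbTE ->.
by rewrite mulr0n mul0r.
Qed.

Lemma tappD p q x : tapp (p + q) x = tapp p x + tapp q x.
Proof.
have [S pS] := supp_fsetW (finite_tcoef p); have [T qT] := supp_fsetW (finite_tcoef q).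
have pST : tsupp p `<=` [set` (S `|` T)%fset] by move=> w /pS /= wS; rewrite inE wS.
have qST : tsupp q `<=` [set` (S `|` T)%fset] by move=> w /qT /= wT; rewrite inE wT orbT.
have pqST : tsupp (p + q) `<=` [set` (S `|` T)%fset].
  move=> w; rewrite /tsupp /= => pq; have [p0|/eqP/pST //] := eqVneq (p w) 0.
  by apply: qST => q0; apply: pq; rewrite p0 q0 addr0.
rewrite (tappE _ pST) (tappE _ qST) (tappE _ pqST) -big_split.
by apply: eq_bigr => w _; rewrite mulrDl.
Qed.

Lemma tapp_monoM x u p y : tapp (tmono x u * p) y = x * frac_act u (tapp p y).
Proof.
have [S pS] := supp_fsetW (finite_tcoef p).
have qS : tsupp (tmono x u * p) `<=` [set` [fset (u * w)%g | w in S]%fset].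
  move=> v; rewrite /tsupp /= tmono_mulE => H; apply/imfsetP.
  exists (u^-1 * v)%g; last by rewrite mulVKg.
  by apply: pS => p0; apply: H; rewrite p0 raddf0 mulr0.
rewrite (tappE _ qS) (tappE _ pS) big_imfset /=; last by move=> w w' _ _ /mulgI.
rewrite rmorph_sum mulr_sumr; apply: eq_bigr => w _.
by rewrite tmono_mulE mulKg rmorphM frac_actM mulrA.
Qed.
End TwistedRing.

(** * Two generators of a Hecke algebra *)
Section TwoGenerators.
Variable A : pzRingType.

(** Equations in a noncommutative ring are solved below by normalization; this makes
    [A] known to the procedure. *)
Definition nc_sub (x y : A) := x - y.
#[local] Instance nc_ops : @Ncring.Ring_ops A 0 1 +%R *%R nc_sub -%R eq := {}.
#[local] Instance nc_ring : Ncring.Ring (Ro := nc_ops).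
Proof.
split.
- exact: eq_equivalence.
- by move=> ? ? -> ? ? ->.
- by move=> ? ? -> ? ? ->.
- by move=> ? ? -> ? ? ->.
- by move=> ? ? ->.
- by move=> x; change (0 + x = x); rewrite add0r.
- by move=> x y; change (x + y = y + x); rewrite addrC.
- by move=> x y z; change (x + (y + z) = x + y + z); rewrite addrA.
- by move=> x; change (1 * x = x); rewrite mul1r.
- by move=> x; change (x * 1 = x); rewrite mulr1.
- by move=> x y z; change (x * (y * z) = x * y * z); rewrite mulrA.
- by move=> x y z; change ((x + y) * z = x * z + y * z); rewrite mulrDl.
- by move=> x y z; change (z * (x + y) = z * x + z * y); rewrite mulrDr.
- by move=> x y; change (x - y = x + - y).
- by move=> x; change (x - x = 0); rewrite subrr.
Qed.

Ltac ncring := Ncring_tac.non_commutative_ring.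

(** [x] and [y] stand for [H_i] and [H_j], with inverses [X] and [Y]. *)
Variables (x y X Y a b : A).
Hypotheses (xX : x * X = 1) (Xx : X * x = 1) (yY : y * Y = 1) (Yy : Y * y = 1).
Hypotheses (xa : x = X + a) (yb : y = Y + b).
Hypotheses (ac : forall w, a * w = w * a) (bc : forall w, b * w = w * b).

Let z := x * y + Y * X.

(** Here [g + g^-1] plays the role of a trace. For [g = x y] and [g = y x] it differs by
    commutators with the central elements [a] and [b]. *)
Lemma hecke_trace : z = y * x + X * Y.
Proof.
have e1 := bc X. have e2 := ac Y; have e3 := ac b.
have -> : y * x + X * Y = z + (b * X - X * b) - (a * Y - Y * a) - (a * b - b * a).
  by rewrite /z xa yb; ncring.
by rewrite e1 e2 e3 !subrr addr0 !subr0.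
Qed.

(** Powers obey the recurrence [g^(n+2) = (g + g^-1) g^(n+1) - g^n], where by
    [hecke_trace] the coefficient is the same for the four elements. *)
Lemma hecke_pow k : (x * y) ^+ k - (y * x) ^+ k = (X * Y) ^+ k - (Y * X) ^+ k.
Proof.
have zz := hecke_trace.
have uu : (x * y) * (Y * X) = 1 by rewrite mulrA -(mulrA x) yY mulr1.
have uu' : (Y * X) * (x * y) = 1 by rewrite mulrA -(mulrA Y) Xx mulr1.
have vv : (y * x) * (X * Y) = 1 by rewrite mulrA -(mulrA y) xX mulr1.
have vv' : (X * Y) * (y * x) = 1 by rewrite mulrA -(mulrA X) Yy mulr1.
have rec (t g h : A) n : t = g + h -> h * g = 1 -> g ^+ n.+2 = t * g ^+ n.+1 - g ^+ n.
  by move=> -> hg; rewrite mulrDl -exprS (exprS g n) (mulrA h) hg mul1r addrK.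
have [t [zu zu' zv zv']] : exists t, [/\ t = x * y + Y * X, t = Y * X + x * y,
    t = y * x + X * Y & t = X * Y + y * x].
  by exists z; split; [|rewrite addrC|rewrite zz|rewrite zz addrC].
have H n : (x * y) ^+ n - (y * x) ^+ n = (X * Y) ^+ n - (Y * X) ^+ n /\
   (x * y) ^+ n.+1 - (y * x) ^+ n.+1 = (X * Y) ^+ n.+1 - (Y * X) ^+ n.+1.
  elim: n => [|n [IH1 IH2]]; first split.
  - by rewrite !expr0.
  - rewrite !expr1; have -> : x * y = t - Y * X by rewrite zu addrK.
    by have -> : X * Y = t - y * x by [rewrite zv' addrK]; ncring.
  split=> //; rewrite (rec t (x * y) (Y * X)) // (rec t (y * x) (X * Y)) //.
  rewrite (rec t (X * Y) (y * x)) // (rec t (Y * X) (x * y)) //.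
  have sub2 (p q r s : A) : (t * p - q) - (t * r - s) = t * (p - r) - (q - s) by ncring.
  by rewrite !sub2 IH1 IH2.
by case: (H k).
Qed.

Lemma hecke_pow3 : a = b -> x * y * x - y * x * y = X * Y * X - Y * X * Y.
Proof.
move=> ab; have zz := hecke_trace.
have e1 : x * y * x = z * x - Y by rewrite /z mulrDl -(mulrA Y) Xx mulr1 addrK.
have e2 : y * x * y = z * y - X by rewrite zz mulrDl -(mulrA X) Yy mulr1 addrK.
have e3 : X * Y * X = z * X - y by rewrite zz mulrDl -(mulrA y) xX mulr1 addrC addKr.
have e4 : Y * X * Y = z * Y - x by rewrite /z mulrDl -(mulrA x) yY mulr1 addrC addKr.
rewrite e1 e2 e3 e4; move: (z) => t.
by rewrite xa yb ab; ncring.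
Qed.

(** The next four lemmas treat the orders 2, 3, 4 and 6. The elements [e0, e1, ...] are
    the exponentials of the successive weights of a string: a relation
    [x e = e' X] reflects the weight, and [c] is its defect when the string
    crosses 0 from a coroot to its opposite. *)
Lemma hecke_braid2 (e f c : A) : (forall w, c * w = w * c) ->
  x * e = f * X - c -> y * e = e * y -> y * f = f * y ->
  (x * y - y * x) * e = f * (x * y - y * x).
Proof.
move=> cc r1 r2 r3; rewrite mulrBl -(mulrA x) r2 mulrA r1 -(mulrA y) r1 mulrBr mulrA r3.
rewrite -(cc y) xa.
have -> : (f * X - c) * y - (f * y * X - c * y) = f * (X * y - y * X) by ncring.
congr (_ * _); rewrite mulrDl mulrDr ac; ncring.
Qed.

Lemma hecke_braid3 (e0 e1 e2 : A) : a = b ->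
  x * e0 = e1 * X -> y * e1 = e2 * Y -> x * e2 = e2 * x -> y * e0 = e0 * y ->
  (x * y * x - y * x * y) * e0 = e2 * (x * y * x - y * x * y).
Proof.
move=> ab r1 r2 r3 r4; rewrite mulrBl.
have -> : x * y * x * e0 = e2 * x * Y * X.
  by rewrite -mulrA r1 mulrA -(mulrA x) r2 mulrA r3.
have -> : y * x * y * e0 = e2 * Y * X * y.
  by rewrite -mulrA r4 mulrA -(mulrA y) r1 mulrA r2.
rewrite hecke_pow3 // xa yb ab.
have -> : e2 * (X + b) * Y * X - e2 * Y * X * (Y + b) =
  e2 * (X * Y * X - Y * X * Y) + e2 * (b * (Y * X) - Y * X * b) by ncring.
by rewrite bc subrr mulr0 addr0.
Qed.

Lemma hecke_braid4 (e0 e1 e2 e3 c : A) : (forall w, c * w = w * c) ->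
  x * e0 = e1 * X -> y * e1 = e2 * Y - c -> x * e2 = e3 * X -> y * e3 = e3 * y ->
  y * e0 = e0 * y ->
  ((x * y) ^+ 2 - (y * x) ^+ 2) * e0 = e3 * ((x * y) ^+ 2 - (y * x) ^+ 2).
Proof.
move=> cc r1 r2 r3 r4 r5; rewrite mulrBl.
have -> : (x * y) ^+ 2 * e0 = e3 * (X * Y * X * y) - c * y.
  have -> : (x * y) ^+ 2 * e0 = x * (y * (x * (y * e0))) by rewrite expr2; ncring.
  rewrite r5; have -> : x * (y * (x * (e0 * y))) = x * (y * (x * e0 * y)) by ncring.
  rewrite r1; have -> : y * (e1 * X * y) = y * e1 * X * y by ncring.
  rewrite r2; have -> : x * ((e2 * Y - c) * X * y) = x * e2 * Y * X * y - x * c * X * y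
    by ncring.
  rewrite r3 -(cc x); have -> : c * x * X * y = c * (x * X) * y by ncring.
  rewrite xX; ncring.
have -> : (y * x) ^+ 2 * e0 = e3 * (y * X * Y * X) - c * y.
  have -> : (y * x) ^+ 2 * e0 = y * (x * (y * (x * e0))) by rewrite expr2; ncring.
  rewrite r1 (mulrA y e1) r2.
  have -> : y * (x * ((e2 * Y - c) * X)) = y * (x * e2) * Y * X - y * (x * c) * X
    by ncring.
  rewrite r3; have -> : y * (e3 * X) * Y * X - y * (x * c) * X =
    y * e3 * X * Y * X - y * (x * c) * X by ncring.
  rewrite r4 -(cc x); have -> : y * (c * x) * X = y * c * (x * X) by ncring.
  rewrite xX -(cc y); ncring.
rewrite hecke_pow !expr2.
have -> : e3 * (X * Y * X * y) - c * y - (e3 * (y * X * Y * X) - c * y) =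
  e3 * (X * Y * X * y - y * X * Y * X) by ncring.
congr (_ * _); rewrite yb.
have -> : X * Y * X * (Y + b) - (Y + b) * X * Y * X =
  X * Y * (X * Y) - Y * X * (Y * X) - (b * (X * Y * X) - X * Y * X * b) by ncring.
by rewrite bc subrr subr0.
Qed.

Lemma hecke_braid6 (e0 e1 e2 e3 e4 e5 c : A) : (forall w, c * w = w * c) ->
  x * e0 = e0 * x -> y * e0 = e1 * Y -> x * e1 = e2 * X -> y * e2 = e3 * Y - c ->
  x * e3 = e4 * X -> y * e4 = e5 * Y -> x * e5 = e5 * x ->
  ((x * y) ^+ 3 - (y * x) ^+ 3) * e0 = e5 * ((x * y) ^+ 3 - (y * x) ^+ 3).
Proof.
move=> cc r0 r1 r2 r3 r4 r5 r6; rewrite mulrBl.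
have -> : (x * y) ^+ 3 * e0 = e5 * x * Y * X * Y * X * Y - c * x.
  have -> : (x * y) ^+ 3 * e0 = x * y * x * y * x * (y * e0) by rewrite !exprS; ncring.
  rewrite r1.
  have -> : x * y * x * y * x * (e1 * Y) = x * y * x * y * (x * e1) * Y by ncring.
  rewrite r2.
  have -> : x * y * x * y * (e2 * X) * Y = x * y * x * (y * e2) * X * Y by ncring.
  rewrite r3.
  have -> : x * y * x * (e3 * Y - c) * X * Y =
    x * y * (x * e3) * Y * X * Y - x * y * (x * c) * X * Y by ncring.
  rewrite r4 -(cc x).
  have -> : x * y * (e4 * X) * Y * X * Y - x * y * (c * x) * X * Y =
    x * (y * e4) * X * Y * X * Y - x * (y * c) * (x * X) * Y by ncring.
  rewrite r5 xX -(cc y).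
  have -> : x * (e5 * Y) * X * Y * X * Y - x * (c * y) * 1 * Y =
    x * e5 * Y * X * Y * X * Y - x * c * (y * Y) by ncring.
  rewrite r6 yY -(cc x); ncring.
have -> : (y * x) ^+ 3 * e0 = e5 * Y * X * Y * X * Y * x - c * x.
  have -> : (y * x) ^+ 3 * e0 = y * x * y * x * y * (x * e0) by rewrite !exprS; ncring.
  rewrite r0.
  have -> : y * x * y * x * y * (e0 * x) = y * x * y * x * (y * e0) * x by ncring.
  rewrite r1.
  have -> : y * x * y * x * (e1 * Y) * x = y * x * y * (x * e1) * Y * x by ncring.
  rewrite r2.
  have -> : y * x * y * (e2 * X) * Y * x = y * x * (y * e2) * X * Y * x by ncring.
  rewrite r3.
  have -> : y * x * (e3 * Y - c) * X * Y * x =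
    y * (x * e3) * Y * X * Y * x - y * (x * c) * X * Y * x by ncring.
  rewrite r4 -(cc x).
  have -> : y * (e4 * X) * Y * X * Y * x - y * (c * x) * X * Y * x =
    y * e4 * X * Y * X * Y * x - y * c * (x * X) * Y * x by ncring.
  rewrite r5 xX -(cc y).
  have -> : e5 * Y * X * Y * X * Y * x - c * y * 1 * Y * x =
    e5 * Y * X * Y * X * Y * x - c * (y * Y) * x by ncring.
  rewrite yY; ncring.
have -> : e5 * x * Y * X * Y * X * Y - c * x - (e5 * Y * X * Y * X * Y * x - c * x) =
  e5 * (x * (Y * X * Y * X * Y) - Y * X * Y * X * Y * x) by ncring.
rewrite hecke_pow !exprS expr0; congr (_ * _); rewrite xa.
have -> : (X + a) * (Y * X * Y * X * Y) - Y * X * Y * X * Y * (X + a) =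
  X * Y * (X * Y * (X * Y * 1)) - Y * X * (Y * X * (Y * X * 1)) +
  (a * (Y * X * Y * X * Y) - Y * X * Y * X * Y * a) by ncring.
by rewrite ac subrr addr0.
Qed.

(** For an even order the difference [T] of the two sides of the braid relation
    satisfies [T x = - x^-1 T], which propagates [T e = f T] along weight
    strings of length one. *)
Lemma hecke_defect_comm k (e e' f f' : A) : let T := (x * y) ^+ k - (y * x) ^+ k in
  T * e = f * T -> x * e = e' * X -> x * f' = f * X -> T * e' = f' * T.
Proof.
move=> T Tef re rf.
have Tx : T * x = - (X * T).
  have H : x * (y * x) ^+ k = (x * y) ^+ k * x.
    elim: k {T Tef} => [|k IH]; first by rewrite !expr0 mulr1 mul1r.
    by rewrite exprS mulrA (mulrA x) -(mulrA _ x) IH exprS !mulrA.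
  rewrite /T; move: ((x * y) ^+ k) ((y * x) ^+ k) H => N M H.
  have E1 : N * x = X * M + a * M by rewrite -H -mulrDl -xa.
  have E2 : M * x = X * N + a * M.
    have MX : M * X = X * N.
      by rewrite -[M]mul1r -Xx -(mulrA X) H -!mulrA xX mulr1.
    by rewrite ac -MX -mulrDr -xa.
  by rewrite mulrBl E1 E2; ncring.
have e'E : e' = x * e * x by rewrite re -mulrA Xx mulr1.
have f'E : f' = X * f * X by rewrite -mulrA -rf mulrA Xx mul1r.
rewrite e'E f'E !mulrA Tx mulNr -(mulrA X) Tef.
have -> : - (X * (f * T)) * x = - (X * f * (T * x)) by ncring.
by rewrite Tx; ncring.
Qed.
End TwoGenerators.

(** [C d + B] is the shape of [H_i], with [d] for the reflection. *)
Lemma hecke_quadratic (A : pzRingType) (C B C' B' d a : A) :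
  d * C = C' * d -> d * B = B' * d -> d * d = 1 ->
  C * B' + B * C = a * C -> C * C' + B * B = a * B + 1 ->
  (C * d + B) * (C * d + B) = a * (C * d + B) + 1.
Proof.
move=> dC dB dd e1 e2.
have -> : (C * d + B) * (C * d + B) = C * (d * C) * d + C * (d * B) + B * C * d + B * B.
  by rewrite !mulrDl !mulrDr !mulrA !addrA.
rewrite dC dB.
have -> : C * (C' * d) * d + C * (B' * d) + B * C * d + B * B =
  C * C' * (d * d) + (C * B' + B * C) * d + B * B.
  by rewrite mulrDl !mulrA !addrA.
by rewrite dd mulr1 e1 addrAC e2 mulrDr mulrA [LHS]addrC !addrA.
Qed.

(** * The operators H_i *)
Section RankOneFunctions.
Variable F : fieldType.
Implicit Types t u z : F.

(** [bfun] over an arbitrary field. *)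
Definition bgen t u z : F := ((t - t^-1) + (u - u^-1) * z) / (1 - z ^+ 2).

Lemma bgen_rmorph (F' : fieldType) (f : {rmorphism F -> F'}) t u z :
  f (bgen t u z) = (f t - (f t)^-1 + (f u - (f u)^-1) * f z) / (1 - f z ^+ 2).
Proof. by rewrite /bgen fmorph_div rmorphD rmorphM !rmorphB !fmorphV rmorph1 rmorphXn. Qed.

Lemma bgenV t u z : z != 0 -> z ^+ 2 != 1 -> bgen t u z^-1 = t - t^-1 - bgen t u z.
Proof.
move=> z0 z1; have z2 : 1 - z ^+ 2 != 0 by rewrite subr_eq0 eq_sym.
have z3 : 1 - z^-1 ^+ 2 = - (1 - z ^+ 2) / z ^+ 2.
  by rewrite mulNr mulrBl mul1r mulfV ?expf_neq0 // exprVn opprB.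
rewrite /bgen z3; move: (t - t^-1) (u - u^-1) => a b; field.
by rewrite oppr_eq0 z0 z2.
Qed.

Lemma bgen_eq1 t z : z ^+ 2 != 1 -> bgen t t z * z = bgen t t z - (t - t^-1).
Proof.
move=> z1; have z2 : 1 - z ^+ 2 != 0 by rewrite subr_eq0 eq_sym.
by rewrite /bgen; move: (t - t^-1) => a; field.
Qed.

Lemma bgen_eq2 t u z : z ^+ 2 != 1 ->
  bgen t u z * z ^+ 2 = bgen t u z - (t - t^-1) - (u - u^-1) * z.
Proof.
move=> z1; have z2 : 1 - z ^+ 2 != 0 by rewrite subr_eq0 eq_sym.
by rewrite /bgen; move: (t - t^-1) (u - u^-1) => a b; field.
Qed.

Lemma bgen_quad1 (s b : F) : (s - b) * (s - s^-1 - b) + b * (s - b) = (s - s^-1) * (s - b).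
Proof. by ring. Qed.
Lemma bgen_quad2 (s b : F) : s != 0 ->
  (s - b) * (s^-1 + b) + b * b = (s - s^-1) * b + 1.
Proof. by move=> s0; field. Qed.

Lemma sub_subK (G : zmodType) (p q r : G) : p - (p - q - r) = q + r.
Proof. by rewrite -addrA -opprD subKr. Qed.
End RankOneFunctions.

(** [H_i] in a ring where the scalars [S] are twisted by [r] across [d]. *)
Section RankOneHecke.
Variables (F : fieldType) (A : pzRingType) (S : {rmorphism F -> A}) (r : F -> F).
Variables (d : A) (s s' z : F).
Let b := bgen s s' z.
Hypotheses (dS : forall x, d * S x = S (r x) * d) (dd : d * d = 1).
Hypotheses (s0 : s != 0) (z0 : z != 0) (z1 : z ^+ 2 != 1).
Hypotheses (rb : r b = s - s^-1 - b) (rc : r (s - b) = s^-1 + b).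

Definition hop : A := S (s - b) * d + S b.

Lemma hop_sqr : hop * hop = S (s - s^-1) * hop + 1.
Proof.
apply: (hecke_quadratic (dS _) (dS _) dd); rewrite ?rb ?rc -!rmorphM -rmorphD.
  by rewrite bgen_quad1.
by rewrite -(rmorph1 S) -rmorphD bgen_quad2.
Qed.

Lemma hop_scal x : hop * S x = S ((s - b) * r x) * d + S (b * x).
Proof. by rewrite mulrDl -mulrA dS !rmorphM mulrA. Qed.

Lemma scal_hopV x : S x * (hop - S (s - s^-1)) =
  S ((s - b) * x) * d + S (x * (b - (s - s^-1))).
Proof. by rewrite -addrA -rmorphB mulrDr mulrA -!rmorphM (mulrC x). Qed.

(** The relations of Bernstein and Lusztig for an exponential [x] of weight 0, 1 or 2
    (the weight 1 occurs only when the two parameters agree). *)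
Lemma hop_rel0 x : r x = x -> hop * S x = S x * hop.
Proof.
move=> rx; rewrite hop_scal rx /hop mulrDr mulrA -!rmorphM.
by rewrite (mulrC x) (mulrC x).
Qed.

Lemma hop_rel1 x : s = s' -> r x * z = x -> hop * S x = S (r x) * (hop - S (s - s^-1)).
Proof.
move=> ss rx; rewrite hop_scal scal_hopV; congr (_ + S _).
by rewrite -{1}rx mulrCA /b -ss bgen_eq1.
Qed.

Lemma hop_rel2 x : r x * z = 1 -> x = z ->
  hop * S x = S (r x) * (hop - S (s - s^-1)) - S (s' - s'^-1).
Proof.
move=> rx xz; rewrite hop_scal scal_hopV -addrA -rmorphB; congr (_ + S _).
have -> : r x = z^-1 by apply: (mulIf z0); rewrite rx mulVf.
apply: (mulfI z0); rewrite [RHS]mulrBr (mulrA z z^-1) mulfV // mul1r xz.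
by rewrite mulrCA -expr2 bgen_eq2 // (mulrC z).
Qed.

End RankOneHecke.

Opaque tscal tdelta.

Section HeckeOperators.
Context {R : realType} {V : vectType R} {I : finType} {D : rootDatum V I}.
Variable Y : lattice D.
Local Notation al := (sroot D).
Local Notation av := (scoroot D).
Local Notation W := (weyl D).
Local Notation K := (fracV Y).
Local Notation rs := (srefl D).
Local Notation A := (tgalg Y).
Implicit Types (u w : W) (a : 'Hom(V, R^o)).

Lemma sigma_root_inv u a : real_root D a -> sigma_root Y (wact_dual u a) = sigma_root Y a.
Proof. by move=> [w [i ->]]; rewrite -wact_dualM !sigma_root_act. Qed.
Lemma sigma'_root_inv u a : real_root D a -> sigma'_root Y (wact_dual u a) = sigma'_root Y a.
Proof. by move=> [w [i ->]]; rewrite -wact_dualM !sigma'_root_act. Qed.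
Lemma sigma_rootN a : real_root D a -> sigma_root Y (- a) = sigma_root Y a.
Proof.
by move=> [w [i ->]]; rewrite -raddfN /= -srefl_root -wact_dualM !sigma_root_act.
Qed.
Lemma sigma'_rootN a : real_root D a -> sigma'_root Y (- a) = sigma'_root Y a.
Proof.
by move=> [w [i ->]]; rewrite -raddfN /= -srefl_root -wact_dualM !sigma'_root_act.
Qed.
Lemma sigma_root_simple i : sigma_root Y (al i) = sigma Y i.
Proof. by rewrite -[al i](wact_dual1 (D := D)) sigma_root_act. Qed.
Lemma sigma'_root_simple i : sigma'_root Y (al i) = sigma' Y i.
Proof. by rewrite -[al i](wact_dual1 (D := D)) sigma'_root_act. Qed.
Lemma sigma_root_neq0 a : real_root D a -> sigma_root Y a != 0.
Proof. by move=> [w [i ->]]; rewrite sigma_root_act sigma_neq0. Qed.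

Notation s_ a := (const_frac (sigma_root Y a)).
Notation s'_ a := (const_frac (sigma'_root Y a)).
Notation z_ a := (expo Y (coroot D a)).

Lemma s_neq0 a : real_root D a -> s_ a != 0.
Proof. by move=> ra; rewrite const_frac_eq0 sigma_root_neq0. Qed.

Lemma coroot_neq0 a : real_root D a -> coroot D a <> 0.
Proof. by move=> ra c0; have := ev_coroot ra; rewrite c0 ev0 => /eqP; rewrite eq_sym pnatr_eq0. Qed.

Lemma z_sqr_neq1 a : real_root D a -> z_ a ^+ 2 != 1.
Proof.
move=> ra; rewrite -expoMn -(expo0 Y) (inj_eq (@expo_inj _ _ _ _ Y)).
rewrite -scaler_nat scaler_eq0 pnatr_eq0 /=; apply/eqP; exact: coroot_neq0.
Qed.

Lemma frac_act_b u a : real_root D a -> frac_act u (b_root Y a) = b_root Y (wact_dual u a).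
Proof.
move=> ra; rewrite /b_root -![bfun _ _ _]/(bgen _ _ _) bgen_rmorph /= !frac_act_const.
by rewrite frac_act_expo sigma_root_inv // sigma'_root_inv // coroot_act.
Qed.

Lemma c_rootE a : c_root Y a = s_ a - b_root Y a. Proof. by []. Qed.

Lemma frac_act_c u a : real_root D a -> frac_act u (c_root Y a) = c_root Y (wact_dual u a).
Proof.
move=> ra; rewrite !c_rootE rmorphB /= frac_act_b // frac_act_const.
by rewrite sigma_root_inv.
Qed.
Lemma frac_act_c' u a : real_root D a -> frac_act u (c'_root Y a) = c'_root Y (wact_dual u a).
Proof.
move=> ra; rewrite /c'_root rmorphM /= frac_act_const frac_act_c //.
by rewrite sigma_root_inv.
Qed.

Lemma b_rootN a : real_root D a -> b_root Y (- a) = s_ a - (s_ a)^-1 - b_root Y a.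
Proof.
move=> ra; rewrite /b_root sigma_rootN // sigma'_rootN // corootN // expoN.
by apply: bgenV; [exact: expo_neq0|exact: z_sqr_neq1].
Qed.
Lemma c_rootN a : real_root D a -> c_root Y (- a) = (s_ a)^-1 + b_root Y a.
Proof.
by move=> ra; rewrite c_rootE b_rootN // sigma_rootN // sub_subK.
Qed.

Definition tH i : A :=
  tscal (c_root Y (al i)) * tdelta Y (rs i) + tscal (b_root Y (al i)).
(** The coefficient of the quadratic relation [tH_sqr]. *)
Definition ta i : A := tscal (s_ (al i) - (s_ (al i))^-1).
(** The inverse of [tH i]; see [tHK]. *)
Definition tHV i : A := tH i - ta i.
Definition tE (v : V) : A := tscal (expo Y v).

Lemma tH_coef i : (tH i : twisted Y) = H_refl Y i.
Proof.
apply/funext => v; rewrite tcoefD tscalM_coef !tcoef_mono mulrnAr mulr1.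
by [].
Qed.

Lemma tHM_coef i (p : A) v : (tH i * p) v =
  c_root Y (al i) * frac_act (rs i) (p (rs i * v)%g) + b_root Y (al i) * p v.
Proof.
have -> : tH i * p = tscal (c_root Y (al i)) * (tdelta Y (rs i) * p) +
    tscal (b_root Y (al i)) * p by rewrite /tH mulrDl mulrA.
by rewrite tcoefD tscalM_coef tdeltaM_coef sreflV tscalM_coef.
Qed.

Lemma const_central (x : Zsigma Y) (p : A) :
  tscal (const_frac x) * p = p * tscal (const_frac x).
Proof. by apply: tgalgP => v; rewrite tscalM_coef tMscal_coef frac_act_const mulrC. Qed.

Lemma s_V i : (s_ (al i))^-1 = const_frac (sigma Y i)^-1.
Proof.
rewrite sigma_root_simple.
have s0 : const_frac (sigma Y i) != 0 by rewrite const_frac_eq0 sigma_neq0.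
by apply: (mulfI s0); rewrite mulfV // -rmorphM divrr ?rmorph1 // sigma_unit.
Qed.
Lemma s'_V i : (s'_ (al i))^-1 = const_frac (sigma' Y i)^-1.
Proof.
rewrite sigma'_root_simple.
have s0 : const_frac (sigma' Y i) != 0 by rewrite const_frac_eq0 sigma'_neq0.
by apply: (mulfI s0); rewrite mulfV // -rmorphM divrr ?rmorph1 // sigma'_unit.
Qed.

Lemma ta_central i (p : A) : ta i * p = p * ta i.
Proof. by rewrite /ta s_V sigma_root_simple -rmorphB const_central. Qed.

(** The obstruction to [H_i e^v = e^(r_i v) H_i^-1] for [v = alpha_i^vee]. *)
Definition tdefect i : A := tscal (s'_ (al i) - (s'_ (al i))^-1).
Lemma tdefect_central i (p : A) : tdefect i * p = p * tdefect i.
Proof. by rewrite /tdefect s'_V sigma'_root_simple -rmorphB const_central. Qed.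

Lemma tdelta_sqr i : tdelta Y (rs i) * tdelta Y (rs i) = 1.
Proof. by rewrite tdeltaM sreflK. Qed.

Lemma frac_act_b_simple i : frac_act (rs i) (b_root Y (al i)) =
  s_ (al i) - (s_ (al i))^-1 - b_root Y (al i).
Proof. by rewrite frac_act_b ?srefl_root ?b_rootN //; exact: real_root_simple. Qed.
Lemma frac_act_c_simple i : frac_act (rs i) (c_root Y (al i)) =
  (s_ (al i))^-1 + b_root Y (al i).
Proof. by rewrite frac_act_c ?srefl_root ?c_rootN //; exact: real_root_simple. Qed.

Let tS : {rmorphism K -> A} := @tscal R V I D Y.
Lemma tH_hop i : tH i = hop tS (tdelta Y (rs i)) (s_ (al i)) (s'_ (al i)) (z_ (al i)).
Proof. by []. Qed.
Let dS i : forall x, tdelta Y (rs i) * tS x = tS (frac_act (rs i) x) * tdelta Y (rs i).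
Proof. exact: tdelta_scal. Qed.

Lemma tH_sqr i : tH i * tH i = ta i * tH i + 1.
Proof.
rewrite !tH_hop; exact: (hop_sqr (dS i) (tdelta_sqr i) (s_neq0 (real_root_simple i))
  (frac_act_b_simple i) (frac_act_c_simple i)).
Qed.

Lemma tHK i : tH i * tHV i = 1.
Proof. by rewrite /tHV mulrBr tH_sqr -ta_central addrC addKr. Qed.
Lemma tHVK i : tHV i * tH i = 1.
Proof. by rewrite /tHV mulrBl tH_sqr addrC addKr. Qed.
Lemma tHVE i : tH i = tHV i + ta i. Proof. by rewrite subrK. Qed.

Lemma tH_rel0 i v : ev (al i) v = 0 -> tH i * tE v = tE v * tH i.
Proof.
move=> v0; rewrite tH_hop; apply: (hop_rel0 _ _ _ (dS i)).
by rewrite frac_act_expo sreflE v0 scale0r subr0.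
Qed.

Lemma tH_rel1 i v : sigma Y i = sigma' Y i -> ev (al i) v = 1 ->
  tH i * tE v = tE (v - av i) * tHV i.
Proof.
move=> ss v1; have rE : frac_act (rs i) (expo Y v) = expo Y (v - av i).
  by rewrite frac_act_expo sreflE v1 scale1r.
rewrite /tHV /tE tH_hop -rE; apply: (hop_rel1 (dS i) (z_sqr_neq1 (real_root_simple i))).
  by rewrite sigma_root_simple sigma'_root_simple ss.
by rewrite rE coroot_simple -expoD subrK.
Qed.

Lemma tH_rel2 i : tH i * tE (av i) = tE (- av i) * tHV i - tdefect i.
Proof.
have rE : frac_act (rs i) (expo Y (av i)) = expo Y (- av i).
  by rewrite frac_act_expo srefl_coroot.
have H := @hop_rel2 _ _ tS _ _ (s_ (al i)) (s'_ (al i)) (z_ (al i)) (dS i)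
  (expo_neq0 Y _) (z_sqr_neq1 (real_root_simple i)) (expo Y (av i)).
rewrite /tHV /tE /tdefect tH_hop -rE; apply: H.
  by rewrite rE coroot_simple -expoD addNr expo0.
by rewrite coroot_simple.
Qed.
End HeckeOperators.

Opaque tH.

(** * Braid relations *)
Lemma intertwine_opp (A : pzRingType) (p q e f : A) :
  (p - q) * e = f * (p - q) -> (q - p) * e = f * (q - p).
Proof. by move=> H; rewrite -(opprB p q) mulNr mulrN H. Qed.

Section HeckeBraid.
Context {R : realType} {V : vectType R} {I : finType} {D : rootDatum V I}.
Variable Y : lattice D.
Local Notation al := (sroot D).
Local Notation av := (scoroot D).
Local Notation W := (weyl D).
Local Notation rs := (srefl D).
Local Notation A := (tgalg Y).
Local Notation tH := (tH Y).
Local Notation tHV := (tHV Y).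
Local Notation ta := (ta Y).
Local Notation tE := (tE Y).
Local Notation cart := (@cartan R V I D).
Implicit Types (v w : W) (s : seq I).

Definition tHw s : A := \prod_(l <- s) tH l.

Lemma tHw_cons i s : tHw (i :: s) = tH i * tHw s.
Proof. exact: big_cons. Qed.

(** Products of [H_i] and [H_j] are supported in the group generated by [r_i] and [r_j]. *)
Lemma tHw_supp s i j v (x : V) : {subset s <= [:: i; j]} -> tHw s v <> 0 ->
  ev (al i) x = 0 -> ev (al j) x = 0 -> wact v x = x.
Proof.
move=> sij sv xi xj; elim: s sij v sv => [|l s IH] sij v.
  by rewrite /tHw big_nil tcoef1; case: eqP => [->|//]; rewrite wact1.
have sub : {subset s <= [:: i; j]} by move=> k ks; apply: sij; rewrite inE ks orbT.
rewrite tHw_cons tHM_coef => H.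
have [p0|/eqP pn] := eqVneq (tHw s v) 0; last exact: IH.
have rv : tHw s (rs l * v)%g <> 0.
  by move=> q0; apply: H; rewrite p0 q0 raddf0 !mulr0 addr0.
have lx : wact (rs l) x = x.
  rewrite sreflE; suff -> : ev (al l) x = 0 by rewrite scale0r subr0.
  by have := sij l (mem_head _ _); rewrite !inE => /orP[/eqP->|/eqP->].
have := IH sub _ rv; rewrite wactM => E.
by rewrite -[wact v x](wact1 (D := D)) -(sreflK l) wactM E lx.
Qed.

(** The constants are eigenvectors of [H_i], because [b + c] is the constant [sigma_i]. *)
Lemma tapp_tHw s : tapp (tHw s) 1 = const_frac (\prod_(l <- s) sigma Y l).
Proof.
elim: s => [|i s IH]; first by rewrite /tHw !big_nil rmorph1 [LHS]tapp_mono mul1r rmorph1.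
have E : tH i * tHw s = tmono (c_root Y (al i)) (rs i) * tHw s
    + tmono (b_root Y (al i)) 1%g * tHw s.
  apply: tgalgP => v; rewrite tHM_coef tcoefD !tcoef_monoM sreflV invg1 mul1g.
  by rewrite frac_act1.
rewrite tHw_cons E tappD !tapp_monoM IH !frac_act_const -mulrDl c_rootE subrK.
by rewrite big_cons rmorphM sigma_root_simple.
Qed.

Lemma tE_comm_coef (p : A) (e f : V) v : p * tE e = tE f * p -> p v <> 0 -> wact v e = f.
Proof.
move=> /(congr1 (fun q : A => q v)); rewrite /tE tMscal_coef tscalM_coef frac_act_expo.
rewrite mulrC => E /eqP pv; apply: (@expo_inj _ _ _ _ Y).
exact: mulIf pv _ _ E.
Qed.

(** The intertwining relations prescribe the images of [e0] and [e1], hence of the two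
    coroots, under every element of the support; as these elements fix the common
    kernel of the two roots, the support has at most one element. The
    coefficient there is then the value at 1. *)
Lemma intertwiner_eq0 (p : A) i j (e0 e1 f0 f1 : V) (k1 k2 k3 k4 : R) :
  i <> j -> (cart i j * cart j i < 4)%N ->
  (forall v (x : V), p v <> 0 -> ev (al i) x = 0 -> ev (al j) x = 0 -> wact v x = x) ->
  p * tE e0 = tE f0 * p -> p * tE e1 = tE f1 * p ->
  av i = k1 *: e0 + k2 *: e1 -> av j = k3 *: e0 + k4 *: e1 ->
  tapp p 1 = 0 -> p = 0.
Proof.
move=> ij pq supp pe0 pe1 avi avj p1.
have uniq v w : p v <> 0 -> p w <> 0 -> v = w.
  move=> pv pw; apply: weyl_ext => x.
  have ei : wact v (av i) = wact w (av i).
    rewrite avi !linearD !linearZ_LR /= (tE_comm_coef pe0 pv) (tE_comm_coef pe1 pv).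
    by rewrite (tE_comm_coef pe0 pw) (tE_comm_coef pe1 pw).
  have ej : wact v (av j) = wact w (av j).
    rewrite avj !linearD !linearZ_LR /= (tE_comm_coef pe0 pv) (tE_comm_coef pe1 pv).
    by rewrite (tE_comm_coef pe0 pw) (tE_comm_coef pe1 pw).
  (* Split [x] along the two coroots and the common kernel of the two roots; the Cartan
     matrix of rank two is invertible. *)
  set c : R := (cart i j)%:R; set d : R := (cart j i)%:R.
  have det : 4 - c * d != 0.
    by rewrite subr_eq0 -natrM (eqr_nat _ 4) eq_sym (ltn_eqF pq).
  pose m := ev (al i) x; pose n := ev (al j) x.
  pose s : R := (2 * m + c * n) / (4 - c * d).
  pose t : R := (d * m + 2 * n) / (4 - c * d).
  have [xi xj] : ev (al i) (x - s *: av i - t *: av j) = 0 /\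
                 ev (al j) (x - s *: av i - t *: av j) = 0.
    rewrite !evB !evZ !cartan_diag (cartanE ij) (cartanE (nesym ij)) -/c -/d -/m -/n.
    by rewrite /s /t {s t}; move: c d m n det => c d m n det; split; field.
  have xE : x = (x - s *: av i - t *: av j) + s *: av i + t *: av j.
    by rewrite addrAC subrK subrK.
  rewrite [in RHS]xE [in LHS]xE; move: (supp _ _ pv xi xj) (supp _ _ pw xi xj).
  move: (x - s *: av i - t *: av j) => y yv yw.
  by rewrite !(linearD (wact _)) !(linearZ_LR (wact _)) /= ei ej yv yw.
apply: tgalgP => v; rewrite tcoef0; apply: contrapT => pv; apply: (pv).
move: p1; rewrite /tapp (fsbig_single (u := v)); first by rewrite rmorph1 mulr1.
move=> w wv; have [->|/eqP pw] := eqVneq (p w) 0; first by rewrite mul0r.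
by case: wv; exact: uniq.
Qed.

Lemma tapp_braid i j m : (\prod_(l <- alt i j m) sigma Y l = \prod_(l <- alt j i m) sigma Y l) ->
  tapp (tHw (alt i j m) - tHw (alt j i m)) 1 = 0.
Proof.
move=> E; have := tapp_tHw (alt i j m); rewrite E -tapp_tHw => E'.
have := tappD (tHw (alt i j m) - tHw (alt j i m)) (tHw (alt j i m)) 1.
by rewrite subrK E' => /eqP; rewrite -subr_eq subrr eq_sym => /eqP.
Qed.

Lemma mem_alt (i j : I) m : {subset alt i j m <= [:: i; j]} /\ {subset alt j i m <= [:: i; j]}.
Proof.
elim: m i j => [|m IH] i j; first by [].
have [h1 h2] := IH i j; have [h3 h4] := IH j i.
split=> l; rewrite [alt _ _ _.+1]/= inE => /orP[/eqP->|]; rewrite ?inE ?eqxx ?orbT //.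
  by move/h2; rewrite !inE.
by move/h1; rewrite !inE.
Qed.

Lemma braid_supp i j m v (x : V) : (tHw (alt i j m) - tHw (alt j i m)) v <> 0 ->
  ev (al i) x = 0 -> ev (al j) x = 0 -> wact v x = x.
Proof.
have [h1 h2] := mem_alt i j m; rewrite tcoefB => H.
have [p0|/eqP p0] := eqVneq (tHw (alt i j m) v) 0; last exact: tHw_supp p0.
by apply: (tHw_supp h2) => q0; apply: H; rewrite p0 q0 subrr.
Qed.

Lemma tHw_alt_even i j k : tHw (alt i j k.*2) = (tH i * tH j) ^+ k.
Proof.
elim: k => [|k IH]; first by rewrite /tHw big_nil expr0.
by rewrite doubleS !tHw_cons IH exprS mulrA.
Qed.

(** In each type one follows a string of weights on which the operators act by
    [H e = e' H^-1], up to a central defect when the string crosses 0: the orbit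
    of the dominant short coroot in the types B2 and G2, and those of a
    coroot and of a fundamental weight in the types A1 x A1 and A2. *)
Lemma braid_A1A1 i j : i <> j -> cart i j = 0%N -> cart j i = 0%N ->
  tH i * tH j = tH j * tH i.
Proof.
move=> ij p q.
have half k l : k <> l -> cart k l = 0%N -> cart l k = 0%N ->
    (tH k * tH l - tH l * tH k) * tE (av k) = tE (- av k) * (tH k * tH l - tH l * tH k).
  move=> kl ckl clk.
  have lk0 : ev (al l) (av k) = 0 by rewrite (cartanE (nesym kl)) clk oppr0.
  have r1 := tH_rel2 Y k; have r2 := tH_rel0 Y lk0.
  have r3 : tH l * tE (- av k) = tE (- av k) * tH l by apply: tH_rel0; rewrite evN lk0 oppr0.
  exact: (hecke_braid2 (tHVE Y k) (@ta_central _ _ _ _ Y k)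
    (@tdefect_central _ _ _ _ Y k) r1 r2 r3).
have := @intertwiner_eq0 (tH i * tH j - tH j * tH i) i j (av i) (av j) (- av i) (- av j)
  1 0 0 1 ij.
rewrite p q => /(_ isT) H; apply/eqP; rewrite -subr_eq0; apply/eqP; apply: H.
- have := @braid_supp i j 2; rewrite /tHw /= !big_cons !big_nil !mulr1.
  by move=> H v x; exact: H.
- exact: half.
- exact: intertwine_opp (half j i (nesym ij) q p).
- by rewrite scale1r scale0r addr0.
- by rewrite scale1r scale0r add0r.
- have := @tapp_braid i j 2; rewrite /tHw /= !big_cons !big_nil !mulr1.
  by apply; rewrite mulrC.
Qed.

Lemma braid_A2 i j : i <> j -> cart i j = 1%N -> cart j i = 1%N ->
  tHw (alt i j 3) = tHw (alt j i 3).
Proof.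
move=> ij p q.
pose fund (k l : I) : V := (2 / 3) *: av k + (1 / 3) *: av l.
have half k l : k <> l -> cart k l = 1%N -> cart l k = 1%N ->
    (tHw (alt k l 3) - tHw (alt l k 3)) * tE (fund k l) =
    tE (fund k l - av k - av l) * (tHw (alt k l 3) - tHw (alt l k 3)).
  move=> kl ckl clk; have lk := nesym kl.
  have evs x y : ev (al k) (x *: av k + y *: av l) = 2 * x - y /\ ev (al l) (x *: av k + y *: av l) = 2 * y - x.
    by rewrite !evD !evZ !cartan_diag (cartanE kl) (cartanE lk) ckl clk; split; ring.
  have comb x y : fund k l - x *: av k - y *: av l =
      (2 / 3 - x) *: av k + (1 / 3 - y) *: av l.
    by rewrite /fund !scalerBl [RHS]addrACA !addrA.
  have [ss1 ss2 ss3] := sigma_A2 Y kl ckl clk.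
  have c1 := comb 1 0; rewrite scale1r scale0r subr0 in c1.
  have c2 := comb 1 1; rewrite !scale1r in c2.
  have r1 : tH k * tE (fund k l) = tE (fund k l - av k) * tHV k.
    by apply: tH_rel1 => //; rewrite (evs _ _).1; field.
  have r2 : tH l * tE (fund k l - av k) = tE (fund k l - av k - av l) * tHV l.
    by apply: tH_rel1; [rewrite -ss3 -ss2|rewrite c1 (evs _ _).2; field].
  have r3 : tH k * tE (fund k l - av k - av l) = tE (fund k l - av k - av l) * tH k.
    by apply: tH_rel0; rewrite c2 (evs _ _).1; field.
  have r4 : tH l * tE (fund k l) = tE (fund k l) * tH l.
    by apply: tH_rel0; rewrite (evs _ _).2; field.
  have tas : ta k = ta l by rewrite /ta !sigma_root_simple ss1.
  have := hecke_braid3 (tHK Y k) (tHVK Y k) (tHK Y l) (tHVK Y l) (tHVE Y k) (tHVE Y l)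
    (@ta_central _ _ _ _ Y k) (@ta_central _ _ _ _ Y l) tas r1 r2 r3 r4.
  by rewrite !tHw_cons /tHw /= !big_nil !mulr1 !mulrA.
apply/eqP; rewrite -subr_eq0; apply/eqP.
apply: (@intertwiner_eq0 _ i j (fund i j) (fund j i) (fund i j - av i - av j)
  (fund j i - av j - av i) 2 (-1) (-1) 2 ij).
- by rewrite p q.
- exact: braid_supp.
- exact: half.
- exact: intertwine_opp (half j i (nesym ij) q p).
- rewrite /fund (addrC (_ *: av j) (_ *: av i)) !scalerDr !scalerA addrACA -!scalerDl.
  have -> : 2 * (2 / 3) + -1 * (1 / 3) = 1 :> R by field.
  have -> : 2 * (1 / 3) + -1 * (2 / 3) = 0 :> R by field.
  by rewrite scale1r scale0r addr0.
- rewrite /fund (addrC (_ *: av j) (_ *: av i)) !scalerDr !scalerA addrACA -!scalerDl.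
  have -> : -1 * (2 / 3) + 2 * (1 / 3) = 0 :> R by field.
  have -> : -1 * (1 / 3) + 2 * (2 / 3) = 1 :> R by field.
  by rewrite scale1r scale0r add0r.
apply: tapp_braid; have := @sigma_braided _ _ _ _ Y i j ij.
by rewrite p q /cox_order /=; apply.
Qed.

Lemma ev_pair i j (x y : R) : i <> j ->
  ev (al i) (x *: av i + y *: av j) = 2 * x - (cart i j)%:R * y /\
  ev (al j) (x *: av i + y *: av j) = 2 * y - (cart j i)%:R * x.
Proof.
move=> ij; rewrite !evD !evZ !cartan_diag (cartanE ij) (cartanE (nesym ij)).
by split; ring.
Qed.

Lemma braid_B2 i j : i <> j -> cart i j = 1%N -> cart j i = 2%N ->
  tHw (alt i j 4) = tHw (alt j i 4).
Proof.
move=> ij p q; have ji := nesym ij.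
have ss := cartan_sigma Y ij p.
have E x y := ev_pair x y ij; rewrite p q in E.
pose e0 := av i + av j.
have e0E : e0 = 1 *: av i + 1 *: av j by rewrite !scale1r.
have e0i : e0 - av i = av j by rewrite addrAC subrr add0r.
have e2E : - av j = 0 *: av i + (-1) *: av j by rewrite scale0r add0r scaleN1r.
have e3E : - av j - av i = (-1) *: av i + (-1) *: av j by rewrite !scaleN1r addrC.
have r1 : tH i * tE e0 = tE (av j) * tHV i.
  by rewrite -e0i; apply: tH_rel1 => //; rewrite e0E (E _ _).1; ring.
have r2 := tH_rel2 Y j.
have r3 : tH i * tE (- av j) = tE (- av j - av i) * tHV i.
  by apply: tH_rel1 => //; rewrite e2E (E _ _).1; ring.
have r4 : tH j * tE (- av j - av i) = tE (- av j - av i) * tH j.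
  by apply: tH_rel0; rewrite e3E (E _ _).2; ring.
have r5 : tH j * tE e0 = tE e0 * tH j.
  by apply: tH_rel0; rewrite e0E (E _ _).2; ring.
have d0 := hecke_braid4 (tHK Y i) (tHVK Y i) (tHK Y j) (tHVK Y j) (tHVE Y i) (tHVE Y j)
    (@ta_central _ _ _ _ Y i) (@ta_central _ _ _ _ Y j)
    (@tdefect_central _ _ _ _ Y j) r1 r2 r3 r4 r5.
have d1 := hecke_defect_comm (tHK Y i) (tHVK Y i) (tHVE Y i) (@ta_central _ _ _ _ Y i)
  d0 r1 r3.
apply/eqP; rewrite -subr_eq0; apply/eqP.
apply: (@intertwiner_eq0 _ i j e0 (av j) (- av j - av i) (- av j) 1 (-1) 0 1 ij).
- by rewrite p q.
- exact: braid_supp.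
- by rewrite (tHw_alt_even i j 2) (tHw_alt_even j i 2).
- by rewrite (tHw_alt_even i j 2) (tHw_alt_even j i 2).
- by rewrite scale1r scaleN1r addrK.
- by rewrite scale0r scale1r add0r.
apply: tapp_braid; have := @sigma_braided _ _ _ _ Y i j ij.
by rewrite p q /cox_order /=; apply.
Qed.

Lemma braid_G2 i j : i <> j -> cart i j = 1%N -> cart j i = 3%N ->
  tHw (alt i j 6) = tHw (alt j i 6).
Proof.
move=> ij p q; have ji := nesym ij.
have ssi := cartan_sigma Y ij p; have ssj := cartan_sigma3 Y ji q.
have E x y := ev_pair x y ij; rewrite p q in E.
pose e0 := av i + av j + av j.
have e0E : e0 = 1 *: av i + 2 *: av j by rewrite scale1r scaler_nat mulr2n addrA.
have e1E : av i + av j = 1 *: av i + 1 *: av j by rewrite !scale1r.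
have e0j : e0 - av j = av i + av j by rewrite addrK.
have e1i : av i + av j - av i = av j by rewrite addrAC subrr add0r.
have e3E : - av j = 0 *: av i + (-1) *: av j by rewrite scale0r add0r scaleN1r.
have e4E : - av j - av i = (-1) *: av i + (-1) *: av j by rewrite !scaleN1r addrC.
have e5E : - av j - av i - av j = (-1) *: av i + (-2) *: av j.
  by rewrite scaleN1r scaleNr scaler_nat mulr2n opprD addrA (addrC (- av i)).
have r0 : tH i * tE e0 = tE e0 * tH i.
  by apply: tH_rel0; rewrite e0E (E _ _).1; ring.
have r1 : tH j * tE e0 = tE (av i + av j) * tHV j.
  by rewrite -e0j; apply: tH_rel1 => //; rewrite e0E (E _ _).2; ring.
have r2 : tH i * tE (av i + av j) = tE (av j) * tHV i.
  by rewrite -[in RHS]e1i; apply: tH_rel1 => //; rewrite e1E (E _ _).1; ring.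
have r3 := tH_rel2 Y j.
have r4 : tH i * tE (- av j) = tE (- av j - av i) * tHV i.
  by apply: tH_rel1 => //; rewrite e3E (E _ _).1; ring.
have r5 : tH j * tE (- av j - av i) = tE (- av j - av i - av j) * tHV j.
  by apply: tH_rel1 => //; rewrite e4E (E _ _).2; ring.
have r6 : tH i * tE (- av j - av i - av j) = tE (- av j - av i - av j) * tH i.
  by apply: tH_rel0; rewrite e5E (E _ _).1; ring.
have d0 := hecke_braid6 (tHK Y i) (tHVK Y i) (tHK Y j) (tHVK Y j) (tHVE Y i) (tHVE Y j)
    (@ta_central _ _ _ _ Y i) (@ta_central _ _ _ _ Y j)
    (@tdefect_central _ _ _ _ Y j) r0 r1 r2 r3 r4 r5 r6.
have d1 := hecke_defect_comm (tHK Y j) (tHVK Y j) (tHVE Y j) (@ta_central _ _ _ _ Y j)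
  (intertwine_opp d0) r1 r5.
apply/eqP; rewrite -subr_eq0; apply/eqP.
apply: (@intertwiner_eq0 _ i j e0 (av i + av j) (- av j - av i - av j) (- av j - av i)
   (-1) 2 1 (-1) ij).
- by rewrite p q.
- exact: braid_supp.
- by rewrite (tHw_alt_even i j 3) (tHw_alt_even j i 3).
- by rewrite (tHw_alt_even i j 3) (tHw_alt_even j i 3); exact: intertwine_opp d1.
- rewrite e0E e1E !scalerDr !scalerA addrACA -!scalerDl.
  have -> : -1 * 1 + 2 * 1 = 1 :> R by ring.
  have -> : -1 * 2 + 2 * 1 = 0 :> R by ring.
  by rewrite scale1r scale0r addr0.
- by rewrite scale1r scaleN1r /e0 addrC addKr.
apply: tapp_braid; have := @sigma_braided _ _ _ _ Y i j ij.
by rewrite p q /cox_order /=; apply.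
Qed.

Theorem tH_braided : braided (D := D) tH.
Proof.
move=> i j ij /[dup] pq /(cartan_small ij).
have ji := nesym ij; rewrite -![\prod_(l <- _) _]/(tHw _).
case=> [[p q]|[p q]|[[p q]|[p q]]|[[p q]|[p q]]]; rewrite p q /cox_order [nth _ _ _]/=.
- by rewrite /tHw /= !big_cons !big_nil !mulr1 braid_A1A1.
- exact: braid_A2.
- exact: braid_B2.
- by symmetry; apply: braid_B2.
- exact: braid_G2.
- by symmetry; apply: braid_G2.
Qed.
End HeckeBraid.

(** * Order of the coefficients of H_w *)
Section FieldIdentities.
Variable F : fieldType.
(** The expansion of [b] in powers of [z^-1] starts with [z^-1]. *)
Lemma bgen_inv_expansion (a b z : F) : z != 0 -> z ^+ 2 != 1 ->
  (a + b * z) / (1 - z ^+ 2) = - (a * z^-1 ^+ 2 + b * z^-1) * (1 - z^-1 ^+ 2)^-1.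
Proof.
move=> z0 z1; have z2 : 1 - z ^+ 2 != 0 by rewrite subr_eq0 eq_sym.
have z3 : 1 - z^-1 ^+ 2 = - (1 - z ^+ 2) / z ^+ 2.
  by rewrite mulNr mulrBl mul1r mulfV ?expf_neq0 // exprVn opprB.
by rewrite z3; field; rewrite oppr_eq0 z0 z2.
Qed.
Lemma scaled_c_neg (s b : F) : s != 0 -> s * (s^-1 + b) - 1 = s * b.
Proof. by move=> s0; field. Qed.
Lemma scaled_c_pos (s b : F) : s * (s - b) - s ^+ 2 = - (s * b).
Proof. by ring. Qed.
Lemma inv_sub1 (g : F) : g != 0 -> g^-1 - 1 = - ((g - 1) * g^-1).
Proof. by move=> g0; field. Qed.
End FieldIdentities.

Section Estimates.
Context {R : realType} {V : vectType R} {I : finType} {D : rootDatum V I}.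
Variable Y : lattice D.
Local Notation al := (sroot D).
Local Notation W := (weyl D).
Local Notation rs := (srefl D).
Local Notation word := (weyl_word D).
Local Notation len := (@weyl_length R V I D).
Local Notation ht := (@cht R V I D).
Local Notation s_ a := (const_frac (sigma_root Y a)).
Implicit Types (v w x : W) (s : seq I) (a : 'Hom(V, R^o)) (k n : nat).

Lemma sigma_root_unit a : real_root D a -> sigma_root Y a \is a GRing.unit.
Proof. by move=> [w [i ->]]; rewrite sigma_root_act sigma_unit. Qed.
Lemma sigma'_root_unit a : real_root D a -> sigma'_root Y a \is a GRing.unit.
Proof. by move=> [w [i ->]]; rewrite sigma'_root_act sigma'_unit. Qed.

Lemma const_fracV (u : Zsigma Y) : u \is a GRing.unit ->
  (const_frac u)^-1 = const_frac (u^-1).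
Proof.
move=> uu; have u0 : const_frac u != 0.
  by rewrite const_frac_eq0; apply: contraTneq uu => ->; rewrite unitr0.
by apply: (mulfI u0); rewrite mulfV // -rmorphM divrr ?rmorph1.
Qed.

Lemma coroot_height a : real_root D a -> ncone al a ->
  exists n, (0 < n)%N /\ ht (coroot D a) = n%:R.
Proof.
move=> ra pos; have [n nE] := cht_pos (coroot_pos ra pos).
by have [s [i [sn _]]] := root_depth ra pos nE; exists n; split=> //; lia.
Qed.

Lemma ord_expoN_coroot a n : real_root D a -> ncone al a -> ht (coroot D a) = n%:R ->
  ord n (expo Y (coroot D a))^-1.
Proof.
move=> ra pos an; rewrite -expoN; apply: ord_expo; apply: cone_ge_coroot => //.
exact: coroot_pos.
Qed.

(** Expand in powers of [e^(- a^vee)]. *)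
Lemma ord_b_pos a n : real_root D a -> ncone al a -> ht (coroot D a) = n%:R ->
  ord n (b_root Y a).
Proof.
move=> ra pos an; have [m [m0 mE]] := coroot_height ra pos.
have {mE} mn : m = n by apply/eqP; rewrite -(eqr_nat R) -mE an.
rewrite mn in m0; have zn := ord_expoN_coroot ra pos an.
rewrite /b_root /bfun (bgen_inv_expansion _ _ (expo_neq0 Y _) (z_sqr_neq1 Y ra)).
have z2 : ord n ((expo Y (coroot D a))^-1 ^+ 2).
  rewrite expr2; apply: (@ord_le _ _ _ _ _ _ (n + n)%N); first exact: leq_addr.
  exact: ordM.
rewrite (const_fracV (sigma_root_unit ra)) (const_fracV (sigma'_root_unit ra)).
rewrite -!rmorphB; apply: ordMl; last first.
  have u1 : (1 : Zsigma Y) \is a GRing.unit by exact: unitr1.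
  have [] // := @ordV _ _ _ _ Y (1 - (expo Y (coroot D a))^-1 ^+ 2) 1 u1.
  by rewrite rmorph1 addrAC subrr add0r; apply: ordN; exact: ord_le z2.
by apply: ordN; apply: ordD; apply: ordMr => //; exact: ord_const.
Qed.

Lemma ord_b a : real_root D a -> ord 0 (b_root Y a).
Proof.
move=> ra; have [pos|neg] := root_sign ra.
  have [n [_ nE]] := coroot_height ra pos.
  exact: ord_le (ord_b_pos ra pos nE).
have ra' := real_rootN ra; have [n [_ nE]] := coroot_height ra' neg.
rewrite -[a]opprK b_rootN //; apply: ordB.
  rewrite (const_fracV (sigma_root_unit ra')) -rmorphB; exact: ord_const.
exact: ord_le (ord_b_pos ra' neg nE).
Qed.

Lemma ord_c a : real_root D a -> ord 0 (c_root Y a).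
Proof. by move=> ra; rewrite c_rootE; apply: ordB; [exact: ord_const|exact: ord_b]. Qed.

Lemma c'_root_neg a : real_root D a -> c'_root Y (- a) - 1 = s_ a * b_root Y a.
Proof.
move=> ra; rewrite /c'_root c_rootN // sigma_rootN //.
exact/scaled_c_neg/s_neq0.
Qed.

Lemma ord_c'_neg a n : real_root D a -> ncone al a -> ht (coroot D a) = n%:R ->
  ord n (c'_root Y (- a) - 1).
Proof.
move=> ra pos an; rewrite c'_root_neg //; apply: ordMr; first exact: ord_const.
exact: ord_b_pos.
Qed.

Lemma ord_c'_pos a n : real_root D a -> ncone al a -> ht (coroot D a) = n%:R ->
  ord n (c'_root Y a - const_frac (sigma_root Y a ^+ 2)).
Proof.
move=> ra pos an; rewrite /c'_root c_rootE rmorphXn scaled_c_pos.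
by apply: ordN; apply: ordMr; [exact: ord_const|exact: ord_b_pos].
Qed.

Lemma ord_c' a : real_root D a -> ord 0 (c'_root Y a).
Proof. by move=> ra; apply: ordMl; [exact: ord_const|exact: ord_c]. Qed.

(** The leading coefficient is a power of [sigma_a], hence a unit. *)
Lemma ord_c'V a : real_root D a -> ord 0 (c'_root Y a)^-1 /\ c'_root Y a != 0.
Proof.
move=> ra; have [pos|neg] := root_sign ra.
  have [n [n0 nE]] := coroot_height ra pos.
  have us : sigma_root Y a ^+ 2 \is a GRing.unit by rewrite unitrX // sigma_root_unit.
  by apply: (ordV us); apply: ord_le (ord_c'_pos ra pos nE).
have ra' := real_rootN ra; have [n [n0 nE]] := coroot_height ra' neg.
have := ord_c'_neg ra' neg nE; rewrite opprK -(rmorph1 (const_frac (Y := Y))) => H.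
by apply: (ordV (unitr1 _)); apply: ord_le H.
Qed.

Lemma frac_act_tHM x i (p : tgalg Y) v : frac_act x ((tH Y i * p) v) =
  c_root Y (wact_dual x (al i)) * frac_act (x * rs i)%g (p (rs i * v)%g) +
  b_root Y (wact_dual x (al i)) * frac_act x (p v).
Proof.
have ri := real_root_simple (D := D) i.
rewrite tHM_coef -(frac_act_c Y x ri) -(frac_act_b Y x ri) frac_actM.
move: (c_root _ _) (b_root _ _) (p v) (frac_act (rs i) _) => c b g f.
have -> : frac_act x (c * f + b * g) = frac_act x (c * f) + frac_act x (b * g).
  exact: rmorphD.
by congr (_ + _); exact: rmorphM.
Qed.

(** The heart of the convergence. Choosing the term [b] instead of [c r_i] at a positive root
    whose coroot has height [n] raises the order by [n], and omits a
    reflection of length less than [2 n]; choosing it at a negative root costs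
    nothing, but then the omission lengthens the remaining product, by strong
    exchange. *)
Lemma tHw_ord s x v k : reduced D s ->
  (k.*2 <= (len (x * word s)%g - len (x * v)%g).+1)%N ->
  ord k (frac_act x (tHw Y s v)).
Proof.
elim: s x v k => [|i s IH] x v k rds.
  rewrite weyl_word0 /tHw big_nil tcoef1 mulg1; case: eqP => [->|_ _].
    by rewrite mulg1 subnn => k0; have -> : k = 0%N; [lia|rewrite rmorph1; exact: ord1].
  by rewrite rmorph0; exact: ord0.
have rds' := reduced_tail rds; set w := word s in IH *.
rewrite weyl_word_cons -/w tHw_cons frac_act_tHM => kle.
have ra := real_root_act x (real_root_simple (D := D) i).
apply: ordD.
  apply: ordMr; first exact: ord_c.
  by apply: IH => //; rewrite -!mulgA mulKl.
have [pos|neg] := root_sign ra.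
  have [n [n0 nE]] := coroot_height ra pos.
  have := ordM (ord_b_pos ra pos nE) (IH x v (k - n)%N rds' _).
  set H := (X in X -> _) => HH.
  have lr : (len (x * (rs i * w))%g < n.*2 + len (x * w)%g)%N.
    have := @len_reflection _ _ _ _ n x i pos; rewrite -coroot_act_simple => /(_ nE).
    have := lenM (x * rs i * x^-1)%g (x * w)%g.
    rewrite -!mulgA (mulgA x^-1%g) mulVg mul1g !mulgA; lia.
  apply: (@ord_le _ _ _ _ _ _ (n + (k - n))%N); first by lia.
  by apply: HH; rewrite /H; lia.
have lr : (len (x * (rs i * w))%g < len (x * w)%g)%N.
  have := @strong_exchange _ _ _ _ (x * w)%g (x * rs i)%g i.
  have E : wact_dual (x * rs i)%g (al i) = - wact_dual x (al i).
    by rewrite wact_dualM srefl_root raddfN.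
  rewrite E !invgM sreflV => /(_ neg).
  have -> : (x * rs i * rs i * (rs i * x^-1) * (x * w) = x * (rs i * w))%g.
    by rewrite mulKr -!mulgA (mulgA x^-1%g) mulVg mul1g.
  apply; rewrite raddfN /= opprK wact_dualM wact_dualK.
  apply: left_ascent; rewrite -weyl_word_cons -rds -rds' /=.
  exact: leqnSn.
by apply: ordMr; [exact: ord_b|apply: IH => //; lia].
Qed.
End Estimates.

(** * Partial sums of P_sigma *)
Section HeckeSums.
Context {R : realType} {V : vectType R} {I : finType} {D : rootDatum V I}.
Variable Y : lattice D.
Local Notation W := (weyl D).
Local Notation K := (fracV Y).
Local Notation A := (tgalg Y).
Local Notation rs := (srefl D).
Local Notation word := (weyl_word D).
Local Notation len := (@weyl_length R V I D).
Implicit Types (u v w x t : W) (s : seq I) (a : 'Hom(V, R^o)) (k n N : nat).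

(** [sigma_i H_i]; the parameters are absorbed into the operators, since the family
    [th] satisfies the braid relations as well. *)
Definition th i : A := tscal (const_frac (sigma Y i)) * tH Y i.
Definition thw w : A := \prod_(l <- reduced_word w) th l.

Lemma reduced_wordP w : word (reduced_word w) = w /\ reduced D (reduced_word w).
Proof.
rewrite /reduced_word; case: xgetP => [s -> //|H].
by have [s ss sw] := len_wordP w; case: (H s); split; rewrite // /reduced sw.
Qed.

Lemma tscalM (x y : K) : tscal (x * y) = tscal x * tscal y :> A.
Proof. exact: rmorphM. Qed.

Lemma const_scal_prod (x : Zsigma Y) (p q : A) (y : Zsigma Y) :
  tscal (const_frac x) * p * (tscal (const_frac y) * q) = tscal (const_frac (x * y)) * (p * q).
Proof.
have -> : tscal (const_frac (x * y)) = tscal (const_frac x) * tscal (const_frac y) :> A.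
  by rewrite -tscalM; congr tscal; exact: rmorphM.
by rewrite -!mulrA; congr (_ * _); rewrite !mulrA (const_central y p).
Qed.

Lemma prod_th s : \prod_(l <- s) th l = tscal (const_frac (\prod_(l <- s) sigma Y l)) * tHw Y s.
Proof.
elim: s => [|i s IH].
  rewrite /tHw !big_nil mulr1 -[LHS](rmorph1 (@tscal _ _ _ _ Y)).
  by rewrite (rmorph1 (const_frac (Y := Y))).
by rewrite !big_cons tHw_cons IH const_scal_prod.
Qed.

Lemma th_braided : braided (D := D) th.
Proof.
move=> i j ij pq; rewrite !prod_th (sigma_braided Y ij pq).
exact: (congr1 (fun p : A => _ * p) (tH_braided Y ij pq)).
Qed.

Lemma thw_word s : reduced D s -> thw (word s) = \prod_(l <- s) th l.
Proof.
have [rw rr] := reduced_wordP (word s).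
by move=> rds; apply: (matsumoto th_braided).
Qed.

Lemma thw_left i w : (len w < len (rs i * w)%g)%N -> thw (rs i * w)%g = th i * thw w.
Proof.
move=> iw; have [rw rr] := reduced_wordP w.
have le := lenM (rs i) w; have l1 := len_srefl (D := D) i.
rewrite -{1}rw -weyl_word_cons thw_word ?big_cons //.
by rewrite /reduced weyl_word_cons rw /= rr rw; lia.
Qed.

Lemma thw_right i w : (len w < len (w * rs i)%g)%N -> thw (w * rs i)%g = thw w * th i.
Proof.
move=> wi; have [rw rr] := reduced_wordP w.
have le := lenMr w i.
rewrite -{1}rw -weyl_word_rcons thw_word -?cats1 ?big_cat ?big_seq1 //=.
by rewrite /reduced cats1 weyl_word_rcons rw size_rcons rr rw; lia.
Qed.

Lemma thw1 : thw 1%g = 1.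
Proof. by rewrite -(weyl_word0 (D := D)) thw_word ?big_nil // /reduced weyl_word0 len1. Qed.

Lemma thw_ord w x v k : (k.*2 <= (len (x * w)%g - len (x * v)%g).+1)%N ->
  ord k (frac_act x (thw w v)).
Proof.
have [rw rr] := reduced_wordP w; rewrite /thw prod_th tscalM_coef => H.
have -> : forall (c : Zsigma Y) (f : K), frac_act x (const_frac c * f) =
    const_frac c * frac_act x f.
  by move=> c f; rewrite -{2}(frac_act_const x c); exact: rmorphM.
by apply: ordMr; [exact: ord_const|apply: tHw_ord; rewrite ?rw].
Qed.

(** * Balls in the Weyl group *)

Lemma finite_ball N : finite_set [set w : W | (len w <= N)%N].
Proof.
elim: N => [|N IH].
  apply: (@sub_finite_set _ _ [set 1%g]) => // w /=.
  by rewrite leqn0 => /eqP /len0.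
apply: (@sub_finite_set _ _ ([set 1%g] `|`
  [set (rs i * w)%g | i in [set: I] & w in [set w : W | (len w <= N)%N]])); last first.
  rewrite finite_setU; split => //; apply: finite_image2 => //; exact: finite_finset.
move=> w /= wN; have [[|i s] ss sw] := len_wordP w.
  by left; rewrite -sw weyl_word0.
right; exists i => //; exists (word s); last by rewrite -weyl_word_cons.
by have := len_word (D := D) s; rewrite /= in ss *; lia.
Qed.

Definition ball N : {fset W} := fset_set [set w : W | (len w <= N)%N].

Lemma mem_ball N w : (w \in ball N) = (len w <= N)%N.
Proof.
rewrite /ball in_fset_set; last exact: finite_ball.
by apply/idP/idP => [/set_mem|H] //; exact/mem_set.
Qed.

Definition tP N : A := \sum_(w <- ball N) thw w.

Lemma H_weylE w : H_weyl Y w = tHw Y (reduced_word w) :> twisted Y.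
Proof.
rewrite /H_weyl /tHw; elim: (reduced_word w) => [|i s IH].
  by rewrite big_nil; apply/funext => v; rewrite tcoef1.
by rewrite big_cons /= IH -tH_coef.
Qed.

Lemma P_partialE N : P_partial Y N = tP N :> twisted Y.
Proof.
apply/funext => v; rewrite /P_partial /tP tcoef_sum fsbig_finite; last exact: finite_ball.
apply: eq_bigr => w _; rewrite /thw prod_th tscalM_coef H_weylE.
by rewrite /sigma_weyl.
Qed.

(** Long elements contribute terms of high order to a given coefficient in a given
    chamber. *)
Lemma far_ord t v k N w : (k.*2 + len (t^-1 * v)%g + len t <= N)%N -> (N < len w)%N ->
  ord k (frac_act t^-1%g (thw w v)).
Proof.
move=> kN Nw; apply: thw_ord.
have : (len w <= len t + len (t^-1 * w)%g)%N by rewrite -{1}(mulVKg t w); exact: lenM.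
move: kN Nw; move: (len w) (len t) (len (t^-1 * v)%g) (len (t^-1 * w)%g) => a b c d; lia.
Qed.

Lemma thw_ord0 t v w : ord 0 (frac_act t (thw w v)).
Proof. exact: thw_ord. Qed.

Lemma frac_act_sum x (J : Type) (r : seq J) (P : pred J) (f : J -> K) :
  frac_act x (\sum_(j <- r | P j) f j) = \sum_(j <- r | P j) frac_act x (f j).
Proof. exact: rmorph_sum. Qed.

Lemma tP_sub N n : (N <= n)%N -> tP n - tP N = \sum_(w <- ball n | (N < len w)%N) thw w.
Proof.
move=> Nn; rewrite /tP (bigID (fun w => (len w <= N)%N)) /=.
have -> : \sum_(w <- ball n | (len w <= N)%N) thw w = \sum_(w <- ball N) thw w.
  rewrite -big_filter; apply: perm_big; apply: uniq_perm.
  - by rewrite filter_uniq // fset_uniq.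
  - exact: fset_uniq.
  move=> w; rewrite mem_filter !mem_ball.
  by apply/andP/idP => [[]//|wN]; split=> //; exact: leq_trans Nn.
rewrite addrC addrK; apply: eq_bigl => w; by rewrite -ltnNge.
Qed.

Lemma tP_tends : exists C : W -> W -> series Y, forall v, tends (fun N => P_partial Y N v) (C v).
Proof.
suff H v : exists X : W -> series Y, tends (fun N => P_partial Y N v) X.
  by have [C CP] := choice H; exists C.
apply: tends_complete => [t n|t k].
  rewrite P_partialE /tP tcoef_sum frac_act_sum; apply: ord_sum => w _; exact: thw_ord0.
exists (k.*2 + len (t^-1 * v)%g + len t)%N => n Nn.
rewrite !P_partialE -tcoefB tP_sub // tcoef_sum frac_act_sum.
by apply: ord_sum => w Nw; exact: far_ord Nw.
Qed.

(** * Invariance on both sides *)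

(** For [f] a translation by a simple reflection. It exchanges the elements that it
    lengthens and those that it shortens, so the images of the former, taken in the
    ball of radius [N], are the latter in the ball of radius [N.+1]; those of
    length [N.+1] form the remainder. *)
Lemma sum_ball_pairs (f : W -> W) (F : W -> A) N : involutive f ->
  (forall w, (len (f w) <= (len w).+1)%N) ->
  (forall w, ~~ (len w < len (f w))%N = (len (f w) < len w)%N) ->
  \sum_(w <- ball N | (len w < len (f w))%N) (F w + F (f w)) =
  \sum_(w <- ball N) F w +
  \sum_(w <- ball N.+1 | (N < len w)%N && ~~ (len w < len (f w))%N) F w.
Proof.
move=> fK fS desc; rewrite big_split /=.
have -> : \sum_(w <- ball N | (len w < len (f w))%N) F (f w) =
    \sum_(w <- ball N.+1 | ~~ (len w < len (f w))%N) F w.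
  rewrite -big_filter -[RHS]big_filter -(big_map f predT); apply: perm_big.
  apply: uniq_perm.
  - by rewrite (map_inj_uniq (can_inj fK)) filter_uniq // fset_uniq.
  - by rewrite filter_uniq // fset_uniq.
  move=> w; rewrite mem_filter mem_ball; apply/mapP/andP.
    move=> [u]; rewrite mem_filter mem_ball => /andP[fu uN] ->.
    by rewrite fK -leqNgt ltnW //; have := fS u; split=> //; lia.
  move=> [fw wN]; exists (f w); last by rewrite fK.
  by rewrite mem_filter mem_ball fK; move: fw; rewrite desc => fw; rewrite fw; lia.
rewrite [X in _ = X + _](bigID (fun w => len w < len (f w))%N) /= -addrA; congr (_ + _).
rewrite (bigID (fun w => (len w <= N)%N)) /=; congr (_ + _).
  rewrite -big_filter -[RHS]big_filter; apply: perm_big; apply: uniq_perm.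
  - by rewrite filter_uniq // fset_uniq.
  - by rewrite filter_uniq // fset_uniq.
  by move=> w; rewrite !mem_filter !mem_ball; lia.
by apply: eq_bigl => w; rewrite andbC -ltnNge.
Qed.

Lemma descent_left i w : ~~ (len w < len (rs i * w)%g)%N = (len (rs i * w)%g < len w)%N.
Proof.
have [|neg] := root_sign (real_root_act w^-1%g (real_root_simple (D := D) i)).
  by move=> /pos_left_ascent; case: ltngtP.
by have := neg_left_descent neg; case: ltngtP.
Qed.

Lemma descent_right i w : ~~ (len w < len (w * rs i)%g)%N = (len (w * rs i)%g < len w)%N.
Proof.
have [|neg] := root_sign (real_root_act w (real_root_simple (D := D) i)).
  by move=> /pos_ascent; case: ltngtP.
by have := neg_descent neg; case: ltngtP.
Qed.

Lemma tP_left i N :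
  (1 + th i) * (\sum_(w <- ball N | (len w < len (rs i * w)%g)%N) thw w) =
  tP N + \sum_(w <- ball N.+1 | (N < len w)%N && ~~ (len w < len (rs i * w)%g)%N) thw w.
Proof.
rewrite /tP -(sum_ball_pairs _ _ (mulKl^~ i) _ (descent_left i)); last first.
  by move=> w; have := lenM (rs i) w; have := len_srefl (D := D) i; lia.
by rewrite mulr_sumr; apply: eq_bigr => w iw; rewrite thw_left // mulrDl mul1r.
Qed.

Lemma tP_right i N :
  (\sum_(w <- ball N | (len w < len (w * rs i)%g)%N) thw w) * (1 + th i) =
  tP N + \sum_(w <- ball N.+1 | (N < len w)%N && ~~ (len w < len (w * rs i)%g)%N) thw w.
Proof.
rewrite /tP -(sum_ball_pairs _ _ (mulKr^~ i) (lenMr^~ i) (descent_right i)).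
by rewrite mulr_suml; apply: eq_bigr => w wi; rewrite thw_right // mulrDr mulr1.
Qed.
End HeckeSums.

(** * Infinite products over the positive roots *)
Lemma sub_chain (G : zmodType) (p q r s : G) : p - s = p - q - (r - q) + (r - s).
Proof. by rewrite opprB !subrKA. Qed.
Lemma mul3_swap (A : comPzRingType) (p q r : A) : p * q * r = r * q * p.
Proof. by rewrite mulrC mulrA mulrAC. Qed.
Lemma mul_sub1_split (A : pzRingType) (p q : A) : p * q - 1 = p * (q - 1) + (p - 1).
Proof. by rewrite mulrBr mulr1 subrKA. Qed.

Section RootProducts.
Context {R : realType} {V : vectType R} {I : finType} {D : rootDatum V I}.
Variable Y : lattice D.
Local Notation al := (sroot D).
Local Notation W := (weyl D).
Local Notation K := (fracV Y).
Local Notation rs := (srefl D).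
Local Notation word := (weyl_word D).
Local Notation len := (@weyl_length R V I D).
Local Notation P := (pos_root D).
Local Notation rt := ('Hom(V, R^o) : choiceType).
Implicit Types (u w x t : W) (s : seq I) (a : 'Hom(V, R^o)) (k n N : nat).

Lemma facM x (f g : K) : frac_act x (f * g) = frac_act x f * frac_act x g.
Proof. exact: rmorphM. Qed.
Lemma facB x (f g : K) : frac_act x (f - g) = frac_act x f - frac_act x g.
Proof. exact: rmorphB. Qed.
Lemma fac1 x : frac_act x (1 : K) = 1.
Proof. exact: rmorph1. Qed.

(** Apply the letters one by one: the root is simple before it becomes negative. *)
Lemma inversion_root s a : real_root D a -> ncone al a ->
  ncone al (- wact_dual (word s)^-1%g a) ->
  exists u j, (len u < size s)%N /\ a = wact_dual u (al j).
Proof.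
elim: s a => [|k s IH] a ra pos.
  rewrite weyl_word0 invg1 wact_dual1 => neg.
  by have := ncone_eq0 (sroot_free D) pos neg => /(real_root_neq0 ra).
rewrite weyl_word_cons invgM wact_dualM sreflV => neg.
have [ak|/eqP ak] := eqVneq a (al k).
  by exists 1%g, k; rewrite len1 wact_dual1.
have [u [j [us E]]] := IH _ (real_root_act (rs k) ra) (srefl_pos ra pos ak) neg.
exists (rs k * u)%g, j; split.
  by have := lenM (rs k) u; have := len_srefl (D := D) k; rewrite /=; lia.
by rewrite wact_dualM -E -wact_dualM sreflK wact_dual1.
Qed.

Lemma finite_roots n : finite_set [set a | P a /\
  exists w i, (len w <= n)%N /\ a = wact_dual w (al i)].
Proof.
apply: (@sub_finite_set _ _ [set wact_dual w (al i) | w in [set w : W | (len w <= n)%N]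
   & i in [set: I]]).
  by move=> a [_ [w [i [wn ->]]]]; exists w => //; exists i.
by apply: finite_image2; [exact: finite_ball|exact: finite_finset].
Qed.

(** Finite sets of positive roots, bounded by the depth, that exhaust them. *)
Definition roots_le n : {fset rt} := fset_set [set a | P a /\
  exists w i, (len w <= n)%N /\ a = wact_dual w (al i)].

Lemma mem_roots_le n a : a \in roots_le n <-> P a /\
  exists w i, (len w <= n)%N /\ a = wact_dual w (al i).
Proof.
rewrite /roots_le in_fset_set; last exact: finite_roots.
by split => [/set_mem|H] //; exact/mem_set.
Qed.

Definition exhausts (T : nat -> {fset rt}) := (forall n, [set` T n] `<=` P) /\
  forall a, P a -> exists N, forall n, (N <= n)%N -> a \in T n.

Lemma exhausts_fset T (F : {fset rt}) : exhausts T -> [set` F] `<=` P ->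
  exists N, forall n, (N <= n)%N -> (F `<=` T n)%fset.
Proof.
move=> [_ TP] FP; have H (r : seq rt) : (forall a, a \in r -> P a) ->
    exists N, forall n, (N <= n)%N -> forall a, a \in r -> a \in T n.
  elim: r => [|a r IH] rP; first by exists 0%N.
  have [|N NP] := IH; first by move=> b br; apply: rP; rewrite inE br orbT.
  have [N' NP'] := TP a (rP a (mem_head _ _)); exists (maxn N N') => n.
  rewrite geq_max => /andP[Nn N'n] b; rewrite inE => /orP[/eqP->|]; first exact: NP'.
  exact: NP.
have [N NP] := H F FP; exists N => n Nn; apply/fsubsetP => a; exact: NP.
Qed.

Lemma roots_le_exhausts : exhausts roots_le.
Proof.
split=> [n a /mem_roots_le[]//|a Pa]; have [[w [i aE]] _] := Pa.
by exists (len w) => n wn; apply/mem_roots_le; split=> //; exists w, i.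
Qed.

Section Factors.
Variable g : 'Hom(V, R^o) -> K.
Hypothesis g0 : forall t a, P a -> ord 0 (frac_act t^-1%g (g a)).
Hypothesis gfin : forall t k, finite_set
  [set a | P a /\ ~ ord k (frac_act t^-1%g (g a - 1))].

Lemma ord_prod_fset t (S : {fset rt}) : [set` S] `<=` P ->
  ord 0 (frac_act t^-1%g (\prod_(a <- S) g a)).
Proof.
move=> SP; rewrite rmorph_prod big_seq; apply: ord_prod => a aS.
by apply: g0; exact: SP.
Qed.

(** By [gfin] only the factors in a finite set matter up to order [k]. *)
Lemma prod_near t k : exists F : {fset rt}, [set` F] `<=` P /\
  forall S : {fset rt}, [set` S] `<=` P -> (F `<=` S)%fset ->
  ord k (frac_act t^-1%g (\prod_(a <- S) g a - \prod_(a <- F) g a)).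
Proof.
have fF := gfin t k; set Fs := [set a | _] in fF.
pose F : {fset rt} := fset_set Fs.
have FP a : a \in F -> Fs a by rewrite in_fset_set // => /set_mem.
have FPos : [set` F] `<=` P by move=> a /FP[].
exists F; split=> // S SP /fsubsetP FS.
have -> : \prod_(a <- S) g a =
    \prod_(a <- F) g a * \prod_(a <- S | a \notin F) g a.
  rewrite (bigID (fun a => a \in F)) /=; congr (_ * _).
  rewrite -big_filter; apply: perm_big; apply: uniq_perm.
  - by rewrite filter_uniq // fset_uniq.
  - exact: fset_uniq.
  by move=> a; rewrite mem_filter; apply/andP/idP => [[]//|aF]; split=> //; exact: FS.
have -> (p q : K) : frac_act t^-1%g (p * q - p) =
    frac_act t^-1%g p * frac_act t^-1%g (q - 1).
  by rewrite -facM mulrBr mulr1.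
apply: ordMr; first exact: ord_prod_fset.
suff [] : ord 0 (frac_act t^-1%g (\prod_(a <- S | a \notin F) g a)) /\
  ord k (frac_act t^-1%g (\prod_(a <- S | a \notin F) g a - 1)) by [].
rewrite big_seq_cond; apply: (big_ind (fun p => ord 0 (frac_act t^-1%g p) /\
  ord k (frac_act t^-1%g (p - 1)))).
- by rewrite subrr rmorph0 rmorph1; split; [exact: ord1|exact: ord0].
- move=> p q [p0 p1] [q0 q1]; split.
    by rewrite facM; exact: (ordM p0 q0).
  have E : frac_act t^-1%g (p * q - 1) =
      frac_act t^-1%g p * frac_act t^-1%g (q - 1) + frac_act t^-1%g (p - 1).
    rewrite mul_sub1_split.
    by rewrite -facM; exact: rmorphD.
  by rewrite E; apply: ordD => //; apply: ordMr.
- move=> a /andP[aS aF]; have Pa : P a by exact: SP.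
  split; first exact: g0.
  apply: contrapT => H; case/negP: aF; rewrite in_fset_set //.
  by apply/mem_set; split.
Qed.

Lemma prod_sub_far T U t k : exhausts T -> exhausts U -> exists N, forall n,
  (N <= n)%N -> forall m, (N <= m)%N ->
  ord k (frac_act t^-1%g (\prod_(a <- T n) g a - \prod_(a <- U m) g a)).
Proof.
move=> eT eU; have [F [FP Fk]] := prod_near t k.
have [N NP] := exhausts_fset eT FP; have [M MP] := exhausts_fset eU FP.
exists (maxn N M) => n; rewrite geq_max => /andP[Nn _] m; rewrite geq_max => /andP[_ Mm].
have := ordB (Fk _ (eT.1 n) (NP n Nn)) (Fk _ (eU.1 m) (MP m Mm)).
by rewrite -facB opprB addrA subrK.
Qed.

Lemma prod_tends T : exhausts T -> exists X, tends (fun n => \prod_(a <- T n) g a) X.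
Proof.
move=> eT; apply: tends_complete => [t n|t k]; first exact/ord_prod_fset/eT.1.
by have [N NP] := prod_sub_far t k eT eT; exists N => n Nn; exact: NP.
Qed.

Lemma prod_tends_eq T U X : exhausts T -> exhausts U ->
  tends (fun n => \prod_(a <- T n) g a) X -> tends (fun n => \prod_(a <- U n) g a) X.
Proof.
move=> eT eU TX; apply: (tends_near TX) => [t n|t k].
  rewrite facB; apply: ordB; apply: ord_prod_fset => //; [exact: eU.1|exact: eT.1].
by have [N NP] := prod_sub_far t k eU eT; exists N => n Nn; exact: NP.
Qed.

Lemma prod_is_prod T X : exhausts T -> tends (fun n => \prod_(a <- T n) g a) X ->
  is_prod P g (family_of X).
Proof.
move=> eT TX t; have [X0 _ XN] := TX t.
have /choice[E EP] : forall S : {fset rt}, exists E : series Y, [set` S] `<=` P ->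
    expands (frac_act t^-1%g (\prod_(a <- S) g a)) E /\ fil 0 E.
  move=> S; have [SP|SP] := pselect ([set` S] `<=` P); last by exists 0.
  by have [E h1 h2] := ord_prod_fset t SP; exists E.
exists (fun S y => E S (wact t^-1%g y)).
  by move=> S /EP[h1 h2]; exact: expands_expansion.
exists [:: 0]; first by move=> y; rewrite inE => /eqP ->; exact: rpred0.
split=> [S /EP[_ h2]|y]; first exact: fil0_supp.
have [k ky] := nat_bound (- cht (D := D) (wact t^-1%g y)).
have [F [FP Fk]] := prod_near t k; exists F => // S SP FS.
have [N NP] := XN k; have [M MP] := exhausts_fset eT FP.
have [E' h1 h2] := NP (maxn N M) (leq_maxl _ _).
have [h3 _] := EP _ SP; have [h5 _] := EP _ FP.
have [E1 e1 k1] := Fk S SP FS.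
have [E2 e2 k2] := Fk _ (eT.1 _) (MP (maxn N M) (leq_maxr _ _)).
rewrite facB in e1.
rewrite facB in e2.
have E1E := expands_uniq e1 (expandsB h3 h5).
have E2E := expands_uniq e2 (expandsB h1 h5).
have kE : fil k (E S - X t).
  have -> : E S - X t = E1 - E2 + (E' - X t).
    by rewrite E1E E2E; exact: sub_chain.
  by apply: filD => //; exact: filB.
apply/eqP; rewrite -subr_eq0; apply/eqP.
by have := fil_high kE ky; rewrite ncoefD ncoefN.
Qed.
End Factors.

Lemma is_prod_uniq (g : rt -> K) F G : is_prod P g F -> is_prod P g G -> F = G.
Proof.
move=> gF gG; apply/funext => t; apply/funext => y.
have [E EP [ms _ [_ /(_ y)[S0 S0P SE]]]] := gF t.
have [E' EP' [ms' _ [_ /(_ y)[S1 S1P SE']]]] := gG t.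
pose S := (S0 `|` S1)%fset.
have SP : [set` S] `<=` P.
  by move=> a /=; rewrite inE => /orP[/S0P|/S1P].
rewrite -(SE S) ?fsubsetUl // -(SE' S) ?fsubsetUr //.
by rewrite (expansion_uniq (EP _ SP) (EP' _ SP)).
Qed.

(** * The product Delta *)

(** The factors of [Delta]. *)
Definition cm a : K := c'_root Y (- a).

Lemma frac_act_cm t a : real_root D a ->
  frac_act t (cm a) = cm (wact_dual t a).
Proof.
by move=> ra; rewrite /cm frac_act_c' ?raddfN //; exact: real_rootN.
Qed.

Lemma cm_ord0 t a : P a -> ord 0 (frac_act t^-1%g (cm a)).
Proof.
move=> [ra _]; rewrite frac_act_cm //; apply: ord_c'; apply: real_rootN.
exact: real_root_act.
Qed.

Lemma cmV_ord0 t a : P a -> ord 0 (frac_act t^-1%g (cm a)^-1).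
Proof.
move=> [ra _].
have -> : frac_act t^-1%g (cm a)^-1 = (frac_act t^-1%g (cm a))^-1 by exact: fmorphV.
rewrite frac_act_cm //.
by have [] := ord_c'V Y (real_rootN (real_root_act t^-1%g ra)).
Qed.

Lemma cm_neq0 a : real_root D a -> cm a != 0.
Proof. by move=> ra; have [] := ord_c'V Y (real_rootN ra). Qed.

(** The factor at [a], seen from the chamber [t], is that at [t^-1 a]. If this root is
    positive, the factor is close to 1 unless the root has small depth; the other
    case concerns finitely many roots by [inversion_root]. *)
Lemma cm_exceptions t k a : P a -> ~ ord k (frac_act t^-1%g (cm a - 1)) ->
  a \in roots_le (len t + k).
Proof.
move=> Pa; have [ra pos] := Pa.
have ra' := real_root_act t^-1%g ra.
have -> : frac_act t^-1%g (cm a - 1) = cm (wact_dual t^-1%g a) - 1.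
  by rewrite facB fac1 frac_act_cm.
move=> nk; apply/mem_roots_le; split=> //.
have [pos'|neg'] := root_sign ra'.
  have [n [n0 nE]] := coroot_height ra' pos'.
  have [s [i [sn E]]] := root_depth ra' pos' nE.
  have nk' : (n < k)%N.
    rewrite ltnNge; apply/negP => kn; apply: nk.
    exact: ord_le kn (ord_c'_neg Y ra' pos' nE).
  exists (t * word s)%g, i; split; last by rewrite wact_dualM -E wact_dualVK.
  by have := lenM t (word s); have := len_word (D := D) s; lia.
have [s ss sw] := len_wordP t.
have [|u [j [us E]]] := @inversion_root s a ra pos; first by rewrite sw.
by exists u, j; split=> //; lia.
Qed.

Lemma cm_fin t k : finite_set [set a | P a /\ ~ ord k (frac_act t^-1%g (cm a - 1))].
Proof.
apply: sub_finite_set (finite_roots (len t + k)) => a [Pa /(cm_exceptions Pa)].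
by move=> /mem_roots_le.
Qed.

Lemma cmV_fin t k : finite_set [set a | P a /\ ~ ord k (frac_act t^-1%g ((cm a)^-1 - 1))].
Proof.
apply: sub_finite_set (cm_fin t k) => a [Pa H]; split=> // H'; apply: H.
rewrite inv_sub1; last by apply: cm_neq0; case: Pa.
have -> (f : K) : frac_act t^-1%g (- f) = - frac_act t^-1%g f by exact: rmorphN.
apply: ordN; rewrite facM.
by apply: ordMl => //; exact: cmV_ord0.
Qed.

Lemma delta_tends : exists X XV, [/\ tends (fun n => \prod_(a <- roots_le n) cm a) X,
  tends (fun n => \prod_(a <- roots_le n) (cm a)^-1) XV & forall t, X t * XV t = 1].
Proof.
have [X XP] := prod_tends cm_ord0 cm_fin roots_le_exhausts.
have [XV XVP] := prod_tends cmV_ord0 cmV_fin roots_le_exhausts.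
exists X, XV; split=> // t.
have := tendsM XP XVP; have -> : (fun n => \prod_(a <- roots_le n) cm a *
   \prod_(a <- roots_le n) (cm a)^-1) = (fun _ => 1).
  apply/funext => n; rewrite -big_split big_seq big1 //= => a /mem_roots_le[[ra _] _].
  by rewrite mulfV // cm_neq0.
by move=> /(tends_uniq (tends1 Y)) /(congr1 (fun X : W -> series Y => X t)).
Qed.

(** [r_i] permutes the factors of [Delta] other than that of [alpha_i], which becomes
    [c'(alpha_i^vee)]. *)
Lemma delta_srefl i X E E' : tends (fun n => \prod_(a <- roots_le n) cm a) X ->
  tends (fun _ => cm (al i)) E -> tends (fun _ => c'_root Y (al i)) E' ->
  forall t, X (rs i * t)%g * E t = X t * E' t.
Proof.
move=> TX TE TE' t.
(* Applying [r_i] to the partial product over [roots_le n] and exchanging the factors at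
   [alpha_i] gives the partial product over [U n], which exhausts the roots too. *)
pose U n : {fset rt} := (al i |` [fset wact_dual (rs i) a | a in (roots_le n `\ al i)])%fset.
have Pal : P (al i) by split; [exact: real_root_simple|exact: ncone_gen].
have rP a : P a -> a <> al i -> P (wact_dual (rs i) a) /\ wact_dual (rs i) a <> al i.
  move=> [ra pos] ai; split.
    by split; [exact: real_root_act|exact: srefl_pos].
  move=> E1; have pos' : ncone al (- a).
    by rewrite -[a](wact_dualK (rs i)) sreflV E1 srefl_root opprK; exact: ncone_gen.
  exact: real_root_neq0 ra (ncone_eq0 (sroot_free D) pos pos').
have inU n a : a \in roots_le n -> a <> al i -> wact_dual (rs i) a \in U n.
  move=> an ai; rewrite in_fset1U; apply/orP; right; apply/imfsetP; exists a => //.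
  by rewrite in_fsetD1 an andbT; apply/eqP.
have eU : exhausts U.
  split=> [n a|a Pa].
    rewrite /= in_fset1U => /orP[/eqP-> //|/imfsetP[b]].
    rewrite /= in_fsetD1 => /andP[/eqP bi /mem_roots_le[Pb _]] ->.
    by case: (rP b Pb bi).
  have [->|/eqP ai] := eqVneq a (al i).
    by exists 0%N => n _; rewrite in_fset1U eqxx.
  have [Pra rai] := rP a Pa ai.
  have [_ /(_ _ Pra)[N NP]] := roots_le_exhausts; exists N => n Nn.
  have := inU n _ (NP n Nn) rai.
  by rewrite -wact_dualM sreflK wact_dual1.
have TU := prod_tends_eq cm_ord0 cm_fin roots_le_exhausts eU TX.
have key n : frac_act (rs i) (\prod_(a <- roots_le n) cm a) * cm (al i) =
    \prod_(a <- U n) cm a * c'_root Y (al i).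
  have ain : al i \in roots_le n.
    apply/mem_roots_le; split=> //; exists 1%g, i; rewrite len1 wact_dual1.
    by split.
  rewrite (big_fsetD1 _ ain) /= big_fsetU1 /=; last first.
    apply/imfsetP => -[b]; rewrite /= in_fsetD1 => /andP[/eqP bi /mem_roots_le[Pb _]] E1.
    by have [_] := rP b Pb bi; apply.
  rewrite [in RHS]big_imfset; last first.
    by move=> b b' _ _ Eb; rewrite -(wact_dualK (rs i) b) Eb wact_dualK.
  rewrite facM frac_act_cm; last first.
    exact: real_root_simple.
  have -> : cm (wact_dual (rs i) (al i)) = c'_root Y (al i).
    by rewrite srefl_root /cm opprK.
  have E1 (S : {fset rt}) : {subset S <= roots_le n} ->
      frac_act (rs i) (\prod_(a <- S) cm a) = \prod_(a <- S) cm (wact_dual (rs i) a).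
    move=> SR; rewrite rmorph_prod big_seq [RHS]big_seq; apply: eq_bigr => a.
    by move=> /SR /mem_roots_le[[ra _] _]; exact: frac_act_cm.
  rewrite E1; last by move=> a; rewrite in_fsetD1 => /andP[].
  exact: mul3_swap.
have := tendsM (tends_act (rs i) TX) TE.
have -> : (fun n => frac_act (rs i) (\prod_(a <- roots_le n) cm a) * cm (al i)) =
  (fun n => \prod_(a <- U n) cm a * c'_root Y (al i)) by apply/funext.
move=> /(tends_uniq (tendsM TU TE')) /(congr1 (fun X : W -> series Y => X t)) ->.
by rewrite sreflV.
Qed.
End RootProducts.

(** * The symmetries of the limit *)
Section MoreFieldIdentities.
Variable F : fieldType.
Lemma left_inv_identity (s b p q : F) : s != 0 ->
  p + s * ((s - b) * q + b * p) = q + s * ((s^-1 + b) * p + (s - s^-1 - b) * q).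
Proof. by move=> s0; field. Qed.
Lemma right_inv_identity (s b p q : F) : s != 0 ->
  (p + s * (q * (s^-1 + b) + p * b)) * (s * (s - b)) =
  (q + s * (p * (s - b) + q * (s - s^-1 - b))) * (s * (s^-1 + b)).
Proof. by move=> s0; field. Qed.
Lemma rmorph_affine (f : {rmorphism F -> F}) (x s c y b z : F) :
  f (x + s * (c * y + b * z)) = f x + f s * (f c * f y + f b * f z).
Proof. by rewrite rmorphD rmorphM rmorphD !rmorphM. Qed.
End MoreFieldIdentities.

(** Cancellation of the invertible [p]; used for [c1 / d], with [cr] and [dr] for the
    images of [c1] and [d] under a simple reflection. *)
Lemma cancel_units (A : comPzRingType) (c1 cr d dr dv drv p q pv : A) :
  p * pv = 1 -> d * dv = 1 -> dr * drv = 1 ->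
  c1 * q = cr * p -> dr * p = d * q -> cr * drv = c1 * dv.
Proof.
move=> pp dd drr e1 e2.
have e3 : cr = c1 * q * pv by rewrite e1 -mulrA pp mulr1.
have e4 : d * (q * pv) = dr by rewrite mulrA -e2 -mulrA pp mulr1.
have e5 : q * pv = dr * dv by rewrite -e4 mulrAC dd mul1r.
by rewrite e3 -(mulrA c1) e5 -!mulrA (mulrC dv) (mulrA dr) drr mul1r.
Qed.

Lemma sub_one_add (G : zmodType) (o e c : G) : c - o = e - (o + e - c).
Proof. by rewrite opprB opprD (addrA c) [RHS]addrC subrK. Qed.

Section Main.
Context {R : realType} {V : vectType R} {I : finType} {D : rootDatum V I}.
Variable Y : lattice D.
Local Notation al := (sroot D).
Local Notation W := (weyl D).
Local Notation K := (fracV Y).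
Local Notation A := (tgalg Y).
Local Notation rs := (srefl D).
Local Notation len := (@weyl_length R V I D).
Local Notation s_ a := (const_frac (sigma_root Y a)).
Implicit Types (u v w t : W) (k n N : nat).

Lemma th_mul_coef i (p : A) v : ((1 + th Y i) * p) v =
  p v + s_ (al i) * (c_root Y (al i) * frac_act (rs i) (p (rs i * v)%g)
                     + b_root Y (al i) * p v).
Proof.
have -> : (1 + th Y i) * p = p + tscal (const_frac (sigma Y i)) * (tH Y i * p).
  by rewrite /th mulrDl mul1r mulrA.
by rewrite tcoefD tscalM_coef tHM_coef sigma_root_simple.
Qed.

Lemma mul_th_coef i (p : A) v : (p * (1 + th Y i)) v =
  p v + s_ (al i) * (p (v * rs i)%g * frac_act (v * rs i)%g (c_root Y (al i))
                     + p v * frac_act v (b_root Y (al i))).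
Proof.
have E : tH Y i = tscal (c_root Y (al i)) * tdelta Y (rs i) + tscal (b_root Y (al i)) by [].
have -> : p * (1 + th Y i) = p + tscal (const_frac (sigma Y i)) *
    (p * tscal (c_root Y (al i)) * tdelta Y (rs i) + p * tscal (b_root Y (al i))).
  by rewrite mulrDr mulr1 /th mulrA -const_central -mulrA E mulrDr mulrA.
rewrite tcoefD tscalM_coef tcoefD tMdelta_coef sreflV !tMscal_coef.
by rewrite sigma_root_simple.
Qed.

(** [1 + sigma_i H_i = (1 + r_i) c'(- alpha_i^vee)], which does not change under left
    multiplication by [r_i]. *)
Lemma left_inv i (p : A) v :
  ((1 + th Y i) * p) v = frac_act (rs i) (((1 + th Y i) * p) (rs i * v)%g).
Proof.
have ra := real_root_simple (D := D) i.
rewrite !th_mul_coef mulKl.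
have -> : forall x c y b z : K, frac_act (rs i) (x + s_ (al i) * (c * y + b * z)) =
    frac_act (rs i) x + s_ (al i) * (frac_act (rs i) c * frac_act (rs i) y +
      frac_act (rs i) b * frac_act (rs i) z).
  move=> x c y b z; rewrite -{2}(frac_act_const (rs i) (sigma_root Y (al i))).
  exact: rmorph_affine.
have rr (f : K) : frac_act (rs i) (frac_act (rs i) f) = f.
  by rewrite -frac_actM sreflK frac_act1.
rewrite rr.
rewrite frac_act_c_simple frac_act_b_simple c_rootE.
exact: left_inv_identity (s_neq0 Y ra).
Qed.

(** Multiplying by [(1 + r_i) c'(- alpha_i^vee)] on the right makes the coefficients
    at [1] and [r_i] proportional to [c'(- alpha_i^vee)] and to its image
    [c'(alpha_i^vee)] under [r_i]. *)
Lemma right_inv i (p : A) : (p * (1 + th Y i)) 1%g * c'_root Y (al i) =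
  (p * (1 + th Y i)) (rs i) * c'_root Y (- al i).
Proof.
have ra := real_root_simple (D := D) i.
rewrite !mul_th_coef mul1g sreflK !frac_act1 frac_act_c_simple frac_act_b_simple.
rewrite /c'_root sigma_rootN // c_rootN // c_rootE.
exact: right_inv_identity (s_neq0 Y ra).
Qed.

(** By [far_ord], what is added to the partial sums disappears in the limit. *)
Lemma sum_far_tends v (C : W -> series Y) (B : nat -> pred W) :
  tends (fun N => P_partial Y N v) C ->
  tends (fun N => (tP Y N + \sum_(w <- ball N.+1 | (N < len w)%N && B N w) thw Y w) v) C.
Proof.
move=> PC; have E N : (tP Y N + \sum_(w <- ball N.+1 | (N < len w)%N && B N w) thw Y w) v -
    P_partial Y N v = \sum_(w <- ball N.+1 | (N < len w)%N && B N w) thw Y w v.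
  by rewrite tcoefD P_partialE addrC addrA addNr add0r tcoef_sum.
apply: (tends_near PC) => [t N|t k].
  by rewrite E frac_act_sum; apply: ord_sum => w _; exact: thw_ord0.
exists (k.*2 + len (t^-1 * v)%g + len t)%N => n Nn.
rewrite E frac_act_sum; apply: ord_sum => w /andP[Nw _]; exact: far_ord Nw.
Qed.

Section Limits.
Variable C : W -> W -> series Y.
Hypothesis PC : forall v, tends (fun N => P_partial Y N v) (C v).

Lemma limit_left i v t : C v t = C (rs i * v)%g (rs i * t)%g.
Proof.
have T u := sum_far_tends (fun N w => ~~ (len w < len (rs i * w)%g)%N) (PC u).
have := tends_act (rs i) (T (rs i * v)%g).
have -> : (fun n => frac_act (rs i) ((tP Y n + \sum_(w <- ball n.+1 |
    (n < len w)%N && ~~ (len w < len (rs i * w)%g)%N) thw Y w) (rs i * v)%g)) =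
    (fun n => (tP Y n + \sum_(w <- ball n.+1 |
    (n < len w)%N && ~~ (len w < len (rs i * w)%g)%N) thw Y w) v).
  by apply/funext => n; rewrite -(tP_left Y i n) -left_inv.
by move=> /(tends_uniq (T v)) /(congr1 (fun X : W -> series Y => X t)); rewrite sreflV.
Qed.

Lemma limit_act w t : C w t = C 1%g (w^-1 * t)%g.
Proof.
have [s <-] := weyl_word_ex w; elim: s t => [|i s IH] t.
  by rewrite weyl_word0 invg1 mul1g.
rewrite weyl_word_cons (limit_left i) mulKl IH invgM sreflV.
by rewrite mulgA.
Qed.

Lemma limit_right i E E' t : tends (fun _ => c'_root Y (- al i)) E ->
  tends (fun _ => c'_root Y (al i)) E' -> C 1%g t * E' t = C (rs i) t * E t.
Proof.
move=> TE TE'.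
have T u := sum_far_tends (fun N w => ~~ (len w < len (w * rs i)%g)%N) (PC u).
have := tendsM (T 1%g) TE'; have := tendsM (T (rs i)) TE.
have -> : (fun n => (tP Y n + \sum_(w <- ball n.+1 |
    (n < len w)%N && ~~ (len w < len (w * rs i)%g)%N) thw Y w) 1%g * c'_root Y (al i)) =
    (fun n => (tP Y n + \sum_(w <- ball n.+1 |
    (n < len w)%N && ~~ (len w < len (w * rs i)%g)%N) thw Y w) (rs i) * c'_root Y (- al i)).
  by apply/funext => n; rewrite -(tP_right Y i n) right_inv.
by move=> T1 T2; have := congr1 (fun X : W -> series Y => X t) (tends_uniq T2 T1).
Qed.

(** Only [w = 1] contributes to the constant term of [Gamma] in the fundamental
    chamber: the other terms have positive order by [thw_ord]. *)
Lemma limit_const : fil 1 (C 1%g 1%g - 1).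
Proof.
have [_ _ /(_ 1%N)[N NP]] := PC 1%g 1%g.
have [E h1 h2] := NP N (leqnn N); rewrite invg1 frac_act1 P_partialE /tP in h1.
have b1 : 1%g \in ball (D := D) N by rewrite mem_ball len1.
have := h1; rewrite tcoef_sum (big_fsetD1 _ b1) /= thw1 tcoef1 eqxx.
have [E' h3 h4] : ord 1 (\sum_(w <- (ball N `\ 1%g)%fset) thw Y w 1%g).
  rewrite big_seq; apply: ord_sum => w; rewrite in_fsetD1 => /andP[w1 _].
  rewrite -[thw Y w 1%g]frac_act1; apply: thw_ord; rewrite !mul1g len1 subn0.
  have : (0 < len w)%N by rewrite lt0n; apply: contraNneq w1 => /len0 ->.
  by [].
have := expandsD (expands1 Y) h3 => h5 h6.
rewrite (expands_uniq h6 h5) in h2.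
have -> : C 1%g 1%g - 1 = E' - (1 + E' - C 1%g 1%g).
  exact: sub_one_add.
exact: filB.
Qed.
End Limits.
End Main.

(** * The factorization *)
Lemma sub_one_quot (A : comPzRingType) (c d dv : A) : d * dv = 1 ->
  1 - c * dv = (d - 1 - (c - 1)) * dv.
Proof. by move=> dd; rewrite opprB addrA subrK mulrBl dd. Qed.

Section Factorization.
Context {R : realType} {V : vectType R} {I : finType} {D : rootDatum V I}.
Variable Y : lattice D.
Local Notation W := (weyl D).
Local Notation K := (fracV Y).
Local Notation rs := (srefl D).
Local Notation cm := (cm Y).
Local Notation roots_le := (@roots_le R V I D).
Implicit Types (u v w t : W) (k n N : nat).

Lemma delta_const (X : W -> series Y) :
  tends (fun n => \prod_(a <- roots_le n) cm a) X -> fil 1 (X 1%g - 1).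
Proof.
move=> TX; have [_ _ /(_ 1%N)[N NP]] := TX 1%g.
have [E h1 h2] := NP N (leqnn N); rewrite invg1 frac_act1 in h1.
have [_ [E' h3 h4]] : ord 0 (\prod_(a <- roots_le N) cm a) /\
    ord 1 (\prod_(a <- roots_le N) cm a - 1).
  rewrite big_seq; apply: (big_ind (fun p : K => ord 0 p /\ ord 1 (p - 1))).
  - by rewrite subrr; split; [exact: ord1|exact: ord0].
  - move=> p q [p0 p1] [q0 q1]; split; first exact: (ordM p0 q0).
    by rewrite mul_sub1_split; apply: ordD => //; apply: ordMr.
  - move=> a /mem_roots_le[[ra pos] _].
    have [n [n0 nE]] := coroot_height ra pos.
    have h := ord_c'_neg Y ra pos nE.
    split; last exact: ord_le h.
    exact/ord_c'/real_rootN.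
have E3 := expands_uniq h3 (expandsB h1 (expands1 Y)).
have -> : X 1%g - 1 = E' - (E - X 1%g).
  by rewrite E3 opprB [RHS]addrC addrA subrK.
exact: filB.
Qed.

Lemma tends_c' a : real_root D a -> exists E E1 : W -> series Y,
  tends (fun _ => c'_root Y a) E /\ forall t, E t * E1 t = 1.
Proof.
move=> ra; have [E TE] : exists E, tends (fun _ => c'_root Y a) E.
  apply: tends_cst => t; rewrite frac_act_c' //; apply: ord_c'; exact: real_root_act.
have [E1 TE1] : exists E, tends (fun _ => (c'_root Y a)^-1) E.
  apply: tends_cst => t.
  have -> : frac_act t^-1%g (c'_root Y a)^-1 = (frac_act t^-1%g (c'_root Y a))^-1.
    exact: fmorphV.
  rewrite frac_act_c' //; have [h _] := ord_c'V Y (real_root_act t^-1%g ra); exact: h.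
exists E, E1; split=> // t; have := tendsM TE TE1.
have [_ n0] := ord_c'V Y ra; rewrite mulfV //.
by move=> /(tends_uniq (tends1 Y)) /(congr1 (fun X : W -> series Y => X t)).
Qed.

Section Quotient.
Variables (C : W -> W -> series Y) (X XV : W -> series Y).
Hypothesis PC : forall v, tends (fun N => P_partial Y N v) (C v).
Hypothesis TX : tends (fun n => \prod_(a <- roots_le n) cm a) X.
Hypothesis TXV : tends (fun n => \prod_(a <- roots_le n) (cm a)^-1) XV.
Hypothesis XXV : forall t, X t * XV t = 1.

(** [Gamma] and [Delta] are multiplied by the same factor under a simple reflection. *)
Lemma quotient_inv w t : C 1%g (w * t)%g * XV (w * t)%g = C 1%g t * XV t.
Proof.
have [s <-] := weyl_word_ex w; elim: s => [|i s <-]; first by rewrite weyl_word0 mul1g.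
rewrite weyl_word_cons -mulgA; move: (weyl_word D s * t)%g => {s w}t.
have ra := real_root_simple (D := D) i.
have [E [E1 [TE EE1]]] := tends_c' (real_rootN ra).
have [E' [_ [TE' _]]] := tends_c' ra.
have := limit_act PC (rs i) t; rewrite sreflV => <-.
apply: (cancel_units (EE1 t) (XXV t) (XXV _)).
  exact: (limit_right PC t TE TE').
exact: delta_srefl TX TE TE' t.
Qed.

(** By invariance it suffices to look at the fundamental chamber. *)
Lemma quotient_const t : fil 1 (1 - C 1%g t * XV t).
Proof.
have := quotient_inv t 1%g; rewrite mulg1 => ->.
rewrite (sub_one_quot _ (XXV 1%g)); apply: filMl; last by have [] := TXV 1%g.
by apply: filB; [exact: delta_const TX|exact: limit_const PC].
Qed.

End Quotient.

Lemma P_sigma_eq (C : W -> W -> series Y) v :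
  tends (fun N => P_partial Y N v) (C v) -> P_sigma Y v = family_of (C v).
Proof.
move=> /tends_cvg T; rewrite /P_sigma; case: xgetP => [F -> /cvg_family_uniq|H].
  exact.
by case: (H _ T).
Qed.

Lemma Delta_eq (X : W -> series Y) :
  tends (fun n => \prod_(a <- roots_le n) cm a) X -> Delta Y = family_of X /\
  is_prod (pos_root D) (fun a => c'_root Y (- a)) (family_of X).
Proof.
move=> TX; have H := prod_is_prod (cm_ord0 Y) (cm_fin Y) roots_le_exhausts TX.
split=> //; rewrite /Delta; case: xgetP => [F -> /is_prod_uniq|/(_ _ H)//].
exact.
Qed.
End Factorization.

Theorem proposition5p4 (R : realType) (V : vectType R) (I : finType)
    (D : rootDatum V I) (Y : lattice D) :
  [/\ forall v, cvg_family (fun N => P_partial Y N v) (P_sigma Y v),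
      is_prod (pos_root D) (fun a => c'_root Y (- a)) (Delta Y)
    & fam_unit (Delta Y)] /\
  [/\ P_sigma Y = (fun w => fam_mul (m_sigma Y) (J_sigma Y w)),
      fam_unit (m_sigma Y)
    & forall w, fam_act w (m_sigma Y) = m_sigma Y].
Proof.
have [C PC] := tP_tends Y; have [X [XV [TX TXV XXV]]] := delta_tends Y.
have PE v := P_sigma_eq (PC v); have [DE DP] := Delta_eq TX.
pose m t := C 1%g t * XV t.
have mE : m_sigma Y = family_of m.
  rewrite /m_sigma /Gamma PE DE (fam_inv_family (tends_completion TXV) XXV).
  exact: family_ofM.
have m_inv w t : m (w * t)%g = m t := quotient_inv PC TX XXV w t.
split; split.
- by move=> v; rewrite PE; exact: tends_cvg.
- by rewrite DE.
- by rewrite DE; exact: fam_unit_family TX TXV XXV.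
- apply/funext => w; rewrite PE mE /J_sigma DE family_of_act family_ofM.
  congr family_of; apply/funext => t; rewrite (limit_act PC) -(m_inv w^-1%g t) /m.
  by rewrite -mulrA (mulrC (XV _)) XXV mulr1.
- have Tm := tendsM (PC 1%g) TXV.
  have [g [T [Tg mT]]] := tends_inv Tm (quotient_const PC TX TXV XXV).
  by rewrite mE; exact: fam_unit_family Tm Tg mT.
- move=> w; rewrite mE family_of_act; congr family_of; apply/funext => t.
  exact: m_inv.
Qed.
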